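(* Let $n\ge 1$, $\sigma^2>0$, and consider the real scalar fast fading channel $Y_i=H_iX_i+Z_i$ described in the context, where the fading coefficients $H_i$ are i.i.d. with a regular fading distribution. Let $\epsilon>0$ be a fixed error probability and let $\delta^*(n,\epsilon)$ be the supremum of the NLDs of $n$-dimensional infinite constellations whose average error probability is at most $\epsilon$. Then, as $n\to\infty$, $$\delta^*(n,\epsilon)=\delta^*-\sqrt{\frac{V}{n}}\,Q^{-1}(\epsilon)+O\!\left(\frac{\ln n}{n}\right),$$ where, with $\delta(H)=\frac12\ln\!\left(\frac{H^2}{2\pi e\sigma^2}\right)$, $$\delta^*=E\{\delta(H)\}=E\left\{\tfrac12\ln\!\left(\tfrac{H^2}{2\pi e\sigma^2}\right)\right\},\qquad V=\tfrac12+\mathrm{Var}(\delta(H))=\tfrac12+\mathrm{Var}\!\left(\tfrac12\ln(H^2)\right).$$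
   Context: Channel: $Y_i=H_iX_i+Z_i$, $i=1,2,\dots$, where $\{H_i\}$ are i.i.d. nonnegative fading coefficients with $E\{H_i^2\}=1$, $\{Z_i\}$ are i.i.d. $N(0,\sigma^2)$, and inputs, fading and noise are mutually independent; the receiver knows $\mathbf H=\mathrm{diag}(H_1,\dots,H_n)$ (perfect CSI). In vector form $\mathbf y=\mathbf H\mathbf x+\mathbf z$. A fading PDF $f$ is a regular fading distribution if there is a constant $\alpha>0$ with $f(h)\propto h^{\alpha-1}$ for all sufficiently small $h>0$. An $n$-dimensional infinite constellation (IC) is a countable set $S\subset\mathbb R^n$. Let $\mathrm{Cb}(a)=\{\mathbf x\in\mathbb R^n:|x_i|<a/2\ \forall i\}$, $M(S,a)=|S\cap\mathrm{Cb}(a)|$, density $\gamma=\limsup_{a\to\infty}M(S,a)/a^n$, and normalized log density (NLD) $\delta=\frac1n\ln\gamma$. Given $\mathbf H$, the received IC is $S_{\mathbf H}=\{\mathbf Hs:s\in S\}$; for $s_{rc}\in S_{\mathbf H}$, $P_e(s_{rc}\mid\mathbf H)=\Pr\{s_{rc}+\mathbf z\notin W(s_{rc})\mid \mathbf H\}$, where $W(s_{rc})$ is the Voronoi cell of $s_{rc}$ in $S_{\mathbf H}$ (ML decoding). The average error probability is $P_e(S)=E\left\{\limsup_{a\to\infty}\frac{1}{M(S_{\mathbf H},a)}\sum_{s_{rc}\in S_{\mathbf H}\cap\mathbf H\cdot\mathrm{Cb}(a)}P_e(s_{rc}\mid\mathbf H)\right\}$, with $M(S_{\mathbf H},a)=|S_{\mathbf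 H}\cap \mathbf H\cdot\mathrm{Cb}(a)|$ and the expectation over $\mathbf H$. $Q$ is the standard Gaussian complementary CDF. *)

(* Defs.v *)
From HB Require Import structures.
From mathcomp Require Import all_boot all_order all_algebra.
From mathcomp Require Import all_classical all_reals all_analysis.
Set Implicit Arguments. Unset Strict Implicit. Unset Printing Implicit Defensive.
Import Order.TTheory GRing.Theory Num.Theory.
Import numFieldNormedType.Exports.
Local Open Scope classical_set_scope.
Local Open Scope ring_scope.

Section Defs.
Context {R : realType}.
Local Notation leb := (@lebesgue_measure R).

Fixpoint iint (n : nat) : (n.-tuple R -> \bar R) -> \bar R :=
  match n with
  | 0 => fun g => g [tuple]
  | m.+1 => fun g => (\int[leb]_x iint (fun t : m.-tuple R => g (cons_tuple x t)))%E
  end.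

(* elementwise product H x  (H = diag(h)) *)
Definition hmul n (h x : n.-tuple R) : n.-tuple R :=
  [tuple tnth h i * tnth x i | i < n].
Definition vadd n (x y : n.-tuple R) : n.-tuple R :=
  [tuple tnth x i + tnth y i | i < n].
Definition dist2 n (x y : n.-tuple R) : R :=
  \sum_(i < n) (tnth x i - tnth y i) ^+ 2.

Definition Cb n (a : R) : set (n.-tuple R) :=
  [set x | forall i : 'I_n, `|tnth x i| < a / 2].

Definition ecount n (A : set (n.-tuple R)) : \bar R := (\esum_(x in A) 1)%E.

Definition elimsup_pinfty (g : R -> \bar R) : \bar R :=
  ereal_inf [set ereal_sup [set g a | a in [set a | A < a]] | A in [set: R]].

Definition density n (S : set (n.-tuple R)) : \bar R :=
  elimsup_pinfty (fun a => (ecount (S `&` @Cb n a) * ((a ^+ n)^-1)%:E)%E).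

Definition recIC n (h : n.-tuple R) (S : set (n.-tuple R)) := hmul h @` S.

(* Voronoi cell of s_rc in S_H (ML decoding) *)
Definition voronoi n (SH : set (n.-tuple R)) (s : n.-tuple R) : set (n.-tuple R) :=
  [set y | forall s', SH s' -> dist2 y s <= dist2 y s'].

(* product Gaussian density N(0, sigma^2 I_n) (sigma = standard deviation) *)
Definition gauss_n n (sigma : R) (z : n.-tuple R) : R :=
  \prod_(i < n) normal_pdf 0 sigma (tnth z i).

Definition Pe_point n (sigma : R) (SH : set (n.-tuple R)) (s : n.-tuple R) : \bar R :=
  iint (fun z : n.-tuple R =>
    ((gauss_n sigma z)%:E * (\1_(~` voronoi SH s) (vadd s z))%:E)%E).

Definition Pe_given_H n (sigma : R) (S : set (n.-tuple R)) (h : n.-tuple R) : \bar R :=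
  let SH := recIC h S in
  elimsup_pinfty (fun a =>
    let A := SH `&` (hmul h @` @Cb n a) in
    ((\esum_(s in A) Pe_point sigma SH s) * (ecount A)^-1)%E).

Definition fading_n n (f : R -> R) (h : n.-tuple R) : R := \prod_(i < n) f (tnth h i).

Definition Pe_IC n (f : R -> R) (sigma : R) (S : set (n.-tuple R)) : \bar R :=
  iint (fun h : n.-tuple R => ((fading_n f h)%:E * Pe_given_H sigma S h)%E).

(* S is an n-dim infinite constellation with positive finite density g
   (so that its NLD (1/n) ln g is a real number) *)
Definition IC_with_density n (S : set (n.-tuple R)) (g : R) : Prop :=
  countable S /\ 0 < g /\ density S = g%:E.

Definition delta_star_n (n : nat) (f : R -> R) (sigma eps : R) : \bar R :=
  ereal_sup [set ((n%:R)^-1 * ln g)%:E | g in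
     [set g : R | exists S : set (n.-tuple R),
         IC_with_density S g /\ (Pe_IC f sigma S <= eps%:E)%E]].

Definition expect (f : R -> R) (u : R -> R) : R :=
  fine (\int[leb]_x ((f x * u x)%:E))%E.

Definition regular_fading_pdf (f : R -> R) : Prop :=
  measurable_fun [set: R] f /\
  (forall x, 0 <= f x) /\
  (forall x, x < 0 -> f x = 0) /\
  (\int[leb]_x (f x)%:E = 1)%E /\
  (\int[leb]_x (f x * x ^+ 2)%:E = 1)%E /\
  exists alpha c eta : R, 0 < alpha /\ 0 < c /\ 0 < eta /\
    forall h, 0 < h < eta -> f h = c * h `^ (alpha - 1).

Definition delta_H (sigma : R) (h : R) : R :=
  2^-1 * ln (h ^+ 2 / (2 * pi * expR 1 * sigma ^+ 2)).

Definition delta_star (f : R -> R) (sigma : R) : R := expect f (delta_H sigma).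

Definition disp_V (f : R -> R) (sigma : R) : R :=
  2^-1 + expect f (fun h => (delta_H sigma h - delta_star f sigma) ^+ 2).

Definition Qfun (x : R) : R :=
  fine (\int[leb]_(t in `[x, +oo[) (normal_pdf 0 1 t)%:E)%E.

End Defs.

(* Main.v *)
(* For h > 0 the log-density ln h + ln g(z) of H^{-1} z has mean [delta_star] and
   variance [disp_V] under the joint law of fading and noise, and both bounds on
   the density gamma of a constellation compare ln gamma with the sum of the n
   coordinate log-densities, up to a term ln n.
   Converse: a Voronoi cell of the received constellation has average volume
   (det h) / gamma, so outside {g(z) > gamma / (n det h)} the transmitted point
   is decoded correctly with probability O(1/n).
   Achievability: averaging over the lattices beta {c in Z^n : c_i = v_i c_0 mod p},
   v in F_p^(n-1), each integer vector with p not dividing c_0 lies in exactly one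
   of them, so the average error probability is bounded by the probability of
   {g(z) <= n gamma / det h} plus O(1/n).
   A Berry-Esseen estimate with rate (1 + ln n) / sqrt n turns both into the
   expansion, the rate being multiplied by sqrt (V / n). It is proved by Lindeberg's
   replacement, the derivatives of the Gaussian tail being integrated against the
   concentration of the previous partial sums. *)
Require Import Defs.
From HB Require Import structures.
From mathcomp Require Import all_boot all_order all_algebra.
From mathcomp Require Import all_classical all_reals all_analysis.
From mathcomp Require Import measurable_realfun ring lra zify.
Set Implicit Arguments. Unset Strict Implicit. Unset Printing Implicit Defensive.
Import Order.TTheory GRing.Theory Num.Theory.
Import numFieldNormedType.Exports.
Local Open Scope classical_set_scope.
Local Open Scope ring_scope.

(** Measurability is the obstacle that shapes the proof. [Pe_IC] integrates a limsup that is never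
    shown to be measurable in the fading, and the error events of the random lattices are not shown
    to be measurable either. What touches them uses only monotonicity and superadditivity of the
    integral of nonnegative functions, and both point the right way: the converse puts a measurable
    function below the conditional error probability, and in the average over lattices the sum of
    the expectations is at most the expectation of the sum. Linearity and Tonelli are kept for
    explicit measurable bounds. The ln n terms come from moving the density threshold by a factor n:
    this buys errors O(1/n), far below the Berry-Esseen rate, and costs ln n / n after
    normalization. In the Berry-Esseen estimate the logarithm is a harmonic sum of replacement
    errors, and the weight (1 + |x|^3)(1 + |x|) exceeds a third moment because replacing a summand x
    moves the concentration window by |x|. Hence fourth moments of ln H are needed, and the
    regularity of the fading near 0 provides them. *)

Section LowerIntegral.
Context d (T : measurableType d) (R : realType).
Variable mu : {measure set T -> \bar R}.
Local Open Scope ereal_scope.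
Import HBNNSimple.

(* The integral of a nonnegative function is the supremum of the integrals of
   the simple functions below it, so monotonicity and superadditivity hold
   without measurability. *)
Lemma lower_le_integral (f g : T -> \bar R) :
  (forall x, 0 <= f x) -> (forall x, f x <= g x) ->
  \int[mu]_x f x <= \int[mu]_x g x.
Proof.
move=> f0 fg; have g0 x : 0 <= g x by exact: le_trans (f0 x) (fg x).
rewrite !ge0_integralTE//; apply: ereal_sup_le => /= _ [h hf <-].
by exists h => // x; exact: le_trans (hf x) (fg x).
Qed.

Lemma lower_integralD (f g : T -> \bar R) :
  (forall x, 0 <= f x) -> (forall x, 0 <= g x) ->
  \int[mu]_x f x + \int[mu]_x g x <= \int[mu]_x (f x + g x).
Proof.
move=> f0 g0; set Z := \int[mu]_x (_ + _).
have [Zfin|] := boolP (Z \is a fin_num); last first.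
  rewrite ge0_fin_numE ?integral_ge0//; last by move=> x _; rewrite adde_ge0.
  by rewrite -leNgt leye_eq => /eqP ->; rewrite leey.
have XY (h k : {nnsfun T >-> R}) : (forall x, (h x)%:E <= f x) ->
    (forall x, (k x)%:E <= g x) -> sintegral mu h + sintegral mu k <= Z.
  move=> hf kg; rewrite -sintegralD /Z ge0_integralTE; last by move=> x; rewrite adde_ge0.
  apply: ereal_sup_ubound.
  by exists (add_nnsfun h k) => // x /=; rewrite EFinD leeD.
have sfin (h : {nnsfun T >-> R}) : sintegral mu h <= Z -> sintegral mu h \is a fin_num.
  move=> hZ; rewrite ge0_fin_numE ?sintegral_ge0//.
  by rewrite (le_lt_trans hZ)// -ge0_fin_numE// (le_trans _ hZ)// sintegral_ge0.
(* The suprema are taken one at a time, over [k] with [h] fixed and then over [h]; finiteness of [Z]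
   is what allows the subtraction. *)
have Yle (h : {nnsfun T >-> R}) : (forall x, (h x)%:E <= f x) ->
    sintegral mu h + \int[mu]_x g x <= Z.
  move=> hf; have hfin : sintegral mu h \is a fin_num.
    apply: sfin; apply: le_trans (XY h nnsfun0 hf g0).
    by rewrite leeDl// sintegral_ge0.
  rewrite addeC -leeBrDr// [leLHS]ge0_integralTE//.
  apply: ge_ereal_sup => _ [k kg <-]; rewrite leeBrDr// addeC; exact: XY.
have gfin : \int[mu]_x g x \is a fin_num.
  rewrite ge0_fin_numE ?integral_ge0//.
  have := Yle nnsfun0 f0; rewrite sintegral0 add0e => /le_lt_trans; apply.
  by rewrite ltey_eq Zfin.
rewrite -leeBrDr// [leLHS]ge0_integralTE//.
by apply: ge_ereal_sup => _ [k kg <-]; rewrite leeBrDr//; exact: Yle.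
Qed.

Lemma lower_integral_sum (I : Type) (s : seq I) (F : I -> T -> \bar R) :
  (forall i x, 0 <= F i x) ->
  \sum_(i <- s) \int[mu]_x F i x <= \int[mu]_x (\sum_(i <- s) F i x).
Proof.
move=> F0; elim: s => [|i s IH].
  by rewrite big_nil integral_ge0// => x _; rewrite big_nil.
rewrite big_cons (le_trans (leeD (lexx _) IH))//.
apply: le_trans (lower_integralD _ _) _ => //; first by move=> x; exact: sume_ge0.
apply: lower_le_integral => x; first by rewrite adde_ge0// sume_ge0.
by rewrite big_cons.
Qed.

End LowerIntegral.

(** * Iterated integrals over tuples *)

Section IteratedIntegral.
Context {R : realType}.
Local Notation leb := (@lebesgue_measure R).
Local Open Scope ereal_scope.

Lemma eq_iint n (F G : n.-tuple R -> \bar R) : F =1 G -> iint F = iint G.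
Proof. by move=> /funext ->. Qed.

Lemma iint_ge0 n (F : n.-tuple R -> \bar R) : (forall x, 0 <= F x) -> 0 <= iint F.
Proof.
by elim: n F => [|n IH] F F0 //=; apply: integral_ge0 => x _; exact: IH.
Qed.

Lemma le_iint n (F G : n.-tuple R -> \bar R) :
  (forall x, 0 <= F x) -> (forall x, F x <= G x) -> iint F <= iint G.
Proof.
elim: n F G => [|n IH] F G F0 FG //=.
by apply: lower_le_integral => x; [exact: iint_ge0|exact: IH].
Qed.

(** Only an inequality, since the summands are not assumed measurable; it is the direction that
    bounds a sum of error probabilities from above. *)
Lemma iint_sum_le n (I : Type) (s : seq I) (F : I -> n.-tuple R -> \bar R) :
  (forall i x, 0 <= F i x) ->
  \sum_(i <- s) iint (F i) <= iint (fun x => \sum_(i <- s) F i x).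
Proof.
elim: n F => [|n IH] F F0 //=.
apply: le_trans (lower_integral_sum _ _ _) _ => [i x|]; first exact: iint_ge0.
apply: lower_le_integral => x; first by apply: sume_ge0 => i _; exact: iint_ge0.
exact: IH.
Qed.

Lemma measurable_cons_comp d (T : measurableType d) n (f : T -> R) (g : T -> n.-tuple R)
    d' (T' : measurableType d') (F : n.+1.-tuple R -> T') :
  measurable_fun setT f -> measurable_fun setT g -> measurable_fun setT F ->
  measurable_fun setT (fun x => F (cons_tuple (f x) (g x))).
Proof.
by move=> mf mg mF; apply: (measurableT_comp mF); exact: measurable_cons.
Qed.

(** The parameter space is arbitrary so that the induction can move the first coordinate of the
    tuple into it, [T] becoming [T * R]. *)
Lemma measurable_iint d (T : measurableType d) n (F : T * n.-tuple R -> \bar R) :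
  (forall x, 0 <= F x) -> measurable_fun [set: T * n.-tuple R] F ->
  measurable_fun setT (fun x => iint (fun t => F (x, t))).
Proof.
elim: n d T F => [|n IH] d T F F0 mF /=.
  by apply: (measurableT_comp mF); exact: measurable_pair2.
pose G (p : T * R) := iint (fun t => F (p.1, cons_tuple p.2 t)).
apply: (@measurable_fun_fubini_tonelli_F _ _ _ _ _ leb G).
  by apply: (IH _ (T * R)%type (fun q => F (q.1.1, cons_tuple q.1.2 q.2))) => //;
    apply: (measurableT_comp mF); apply/measurable_fun_pair;
    [do 2 apply: measurableT_comp => // | apply: measurable_cons => //; apply: measurableT_comp].
by move=> p; exact: iint_ge0.
Qed.

Lemma measurable_iint_cons n (F : n.+1.-tuple R -> \bar R) :
  (forall x, 0 <= F x) -> measurable_fun setT F ->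
  measurable_fun setT (fun x => iint (fun t => F (cons_tuple x t))).
Proof.
move=> F0 mF; apply: (@measurable_iint _ R n (fun p => F (cons_tuple p.1 p.2))) => //.
exact: measurable_cons_comp.
Qed.

Lemma measurable_cons_section n (F : n.+1.-tuple R -> \bar R) x :
  measurable_fun setT F -> measurable_fun setT (fun t => F (cons_tuple x t)).
Proof. by move=> mF; exact: measurable_cons_comp. Qed.

Lemma iintD n (F G : n.-tuple R -> \bar R) :
  (forall x, 0 <= F x) -> measurable_fun setT F ->
  (forall x, 0 <= G x) -> measurable_fun setT G ->
  iint (fun x => F x + G x) = iint F + iint G.
Proof.
elim: n F G => [|n IH] F G F0 mF G0 mG //=.
rewrite -ge0_integralD//.
- by apply: eq_integral => x _; rewrite IH//; exact: measurable_cons_section.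
- by move=> x _; exact: iint_ge0.
- exact: measurable_iint_cons.
- by move=> x _; exact: iint_ge0.
- exact: measurable_iint_cons.
Qed.

Lemma iintZl n (F : n.-tuple R -> \bar R) k : 0 <= k ->
  (forall x, 0 <= F x) -> measurable_fun setT F ->
  iint (fun x => k * F x) = k * iint F.
Proof.
elim: n F => [|n IH] F k0 F0 mF //=.
rewrite -ge0_integralZl//.
- by apply: eq_integral => x _; rewrite IH//; exact: measurable_cons_section.
- exact: measurable_iint_cons.
- by move=> x _; exact: iint_ge0.
Qed.

(** Tonelli exchanges [nu] with the outermost Lebesgue integral, and the induction hypothesis
    handles the remaining coordinates. *)
Lemma iint_integral d (T : measurableType d) (nu : {sigma_finite_measure set T -> \bar R})
    n (F : T * n.-tuple R -> \bar R) :
  (forall x, 0 <= F x) -> measurable_fun setT F ->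
  iint (fun t => \int[nu]_x F (x, t)) = \int[nu]_x iint (fun t => F (x, t)).
Proof.
elim: n F => [|n IH] F F0 mF //=.
pose G (p : T * R) := iint (fun t => F (p.1, cons_tuple p.2 t)).
rewrite (fubini_tonelli (m1 := nu) (m2 := leb) G).
- apply: eq_integral => y _; rewrite (IH (fun p => F (p.1, cons_tuple y p.2)))//=.
  apply: (measurableT_comp mF); apply/measurable_fun_pair => //.
  by apply: measurable_cons.
- apply: (@measurable_iint _ _ n (fun q : (T * R) * n.-tuple R => F (q.1.1, cons_tuple q.1.2 q.2))) => //.
  apply: (measurableT_comp mF); apply/measurable_fun_pair.
    by do 2 apply: measurableT_comp => //.
  by apply: measurable_cons => //; apply: measurableT_comp.
- by move=> p; exact: iint_ge0.
Qed.

(** The factors depend on the coordinate, so that one coordinate may carry a square (Gaussian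
    moments) or each its own interval (boxes). *)
Lemma iint_prod n (F : 'I_n -> R -> \bar R) :
  (forall i x, 0 <= F i x) -> (forall i, measurable_fun setT (F i)) ->
  iint (fun x : n.-tuple R => \prod_(i < n) F i (tnth x i)) =
  \prod_(i < n) \int[leb]_x F i x.
Proof.
elim: n F => [|n IH] F F0 mF; first by rewrite /= !big_ord0.
rewrite [RHS]big_ord_recl -(@ge0_integralZr _ _ _ leb setT measurableT _ (mF ord0))//; last first.
  by apply: prode_ge0 => i _; exact: integral_ge0.
apply: eq_integral => x _ /=.
have mP : measurable_fun setT
    (fun t : n.-tuple R => \prod_(i < n) F (lift ord0 i) (tnth t i)).
  rewrite (_ : (fun _ => _) = (fun t => \prod_(i <- index_enum 'I_n) F (lift ord0 i) (tnth t i)))//.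
  elim: (index_enum _) => [|i s IHs]; first by (under eq_fun do rewrite big_nil); exact: measurable_cst.
  under eq_fun do rewrite big_cons.
  apply: emeasurable_funM => //.
  by apply: (measurableT_comp (mF _)); exact: measurable_tnth.
transitivity (iint (fun t : n.-tuple R =>
    F ord0 x * \prod_(i < n) F (lift ord0 i) (tnth t i))).
  by apply: eq_iint => t; rewrite big_ord_recl tnth0;
    congr (_ * _); apply: eq_bigr => i _; rewrite tnthS.
rewrite iintZl//; first by rewrite (IH (fun i => F (lift ord0 i))).
by move=> t; apply: prode_ge0 => i _; exact: F0.
Qed.

End IteratedIntegral.

(** * The joint law of fading and noise *)

Section DensityProbability.
Context d (T : measurableType d) (R : realType).
Variable mu : {sigma_finite_measure set T -> \bar R}.
Variable p : T -> R.
Hypothesis mp : measurable_fun setT p.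
Hypothesis p0 : forall x, (0 <= p x)%R.
Local Open Scope ereal_scope.
Hypothesis p1 : \int[mu]_x (p x)%:E = 1.

Let nu (A : set T) : \bar R := \int[mu]_(x in A) (p x)%:E.

Let nu0 : nu set0 = 0. Proof. by rewrite /nu integral_set0. Qed.

Let nu_ge0 A : 0 <= nu A.
Proof. by apply: integral_ge0 => x _; rewrite lee_fin. Qed.

Let nu_sigma_additive : semi_sigma_additive nu.
Proof.
move=> /= F mF tF mUF; rewrite /nu; apply: cvg_toP.
  apply: ereal_nondecreasing_is_cvgn => m n mn.
  apply: lee_sum_nneg_natr => // k _ _; exact: nu_ge0.
rewrite ge0_integral_bigcup//=.
- by apply: measurable_funTS; exact/measurable_EFinP.
- by move=> x _; rewrite lee_fin.
Qed.

HB.instance Definition _ := isMeasure.Build _ _ _ nu nu0 nu_ge0 nu_sigma_additive.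

Let nu_setT : nu setT = 1. Proof. exact: p1. Qed.

HB.instance Definition _ := @Measure_isProbability.Build _ _ R nu nu_setT.

Let nu_dominates : nu `<< mu.
Proof.
apply/null_content_dominatesP => A mA muA0; rewrite /nu.
apply: null_set_integral => //=.
by apply: measurable_funTS; exact/measurable_EFinP.
Qed.

(** The change of variables is available for the Radon-Nikodym derivative of [nu]; that derivative
    equals [p] almost everywhere, both having the same integral over every measurable set. *)
Lemma density_probability : exists P : probability T R,
  forall phi : T -> \bar R, measurable_fun setT phi -> (forall x, 0 <= phi x) ->
  \int[P]_x phi x = \int[mu]_x ((p x)%:E * phi x).
Proof.
exists nu => phi mphi phi0.
rewrite -(Radon_Nikodym_SigmaFinite.change_of_variables nu_dominates)//.
have intp : mu.-integrable setT (EFin \o p).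
  apply/integrableP; split; first exact/measurable_EFinP.
  by under eq_integral => x _ do rewrite /= ger0_norm//; rewrite p1 ltry.
have intg := Radon_Nikodym_SigmaFinite.f_integrable nu_dominates.
have : ae_eq mu setT (Radon_Nikodym_SigmaFinite.f nu mu) (EFin \o p).
  apply: integral_ae_eq => //; first exact/measurable_EFinP.
  move=> A _ mA; by rewrite -(Radon_Nikodym_SigmaFinite.f_integral nu_dominates).
move=> aeq; apply: ge0_ae_eq_integral => //.
- by apply: emeasurable_funM => //; exact: measurable_int intg.
- by apply: emeasurable_funM => //; exact/measurable_EFinP.
- by move=> x _; rewrite mule_ge0// Radon_Nikodym_SigmaFinite.f_ge0.
- by move=> x _; rewrite mule_ge0// lee_fin.
- by apply: filterS aeq => x + _ => /(_ Logic.I) /= ->; rewrite muleC.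
Qed.

End DensityProbability.

Section ProductExpectation.
Context {R : realType}.
Variables (f : R -> R) (sigma : R).
Hypothesis mf : measurable_fun setT f.
Hypothesis f0 : forall x, 0 <= f x.
Local Notation leb := (@lebesgue_measure R).
Local Notation g := (normal_pdf 0 sigma).
Local Open Scope ereal_scope.

(** [P] is the law of one pair (H, Z). Its only interface is this formula, which turns the integrals
    of one coordinate into integrals against a probability. *)
Lemma fading_gauss_probability : \int[leb]_x (f x)%:E = 1 ->
  exists P : probability (measurableTypeR R * measurableTypeR R)%type R,
  forall u : R * R -> \bar R, measurable_fun setT u -> (forall p, 0 <= u p) ->
  \int[P]_p u p =
  \int[leb]_h ((f h)%:E * \int[leb]_z ((g z)%:E * u (h, z))).
Proof.
move=> f1.
have [Pf HPf] := density_probability (mu := leb) mf f0 f1.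
have [Pg HPg] := density_probability (mu := leb) (measurable_normal_pdf 0 sigma)
  (normal_pdf_ge0 0 sigma) (integral_normal_pdf 0 sigma).
exists (Pf \x Pg) => u mu u0.
rewrite fubini_tonelli1// HPf.
- apply: eq_integral => h _; congr (_ * _).
  by rewrite /fubini_F HPg//; exact: measurableT_comp.
- exact: measurable_fun_fubini_tonelli_F.
- by move=> h; apply: integral_ge0.
Qed.

(* E[F(H, Z)] for H with i.i.d. coordinates of density f and Z Gaussian. *)
Definition fg_expect n (F : n.-tuple R * n.-tuple R -> \bar R) : \bar R :=
  iint (fun h => (fading_n f h)%:E *
    iint (fun z => (gauss_n sigma z)%:E * F (h, z))).

Lemma fading_n_ge0 n (h : n.-tuple R) : (0 <= fading_n f h)%R.
Proof. by apply: prodr_ge0. Qed.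

Lemma gauss_n_ge0 n (z : n.-tuple R) : (0 <= gauss_n sigma z)%R.
Proof. by apply: prodr_ge0 => i _; exact: normal_pdf_ge0. Qed.

Lemma measurable_fading_n n : measurable_fun setT (@fading_n R n f).
Proof.
apply: measurable_prod => i _.
by apply: (measurableT_comp mf); exact: measurable_tnth.
Qed.

Lemma measurable_gauss_n n : measurable_fun setT (@gauss_n R n sigma).
Proof.
apply: measurable_prod => i _.
by apply: (measurableT_comp (measurable_normal_pdf _ _)); exact: measurable_tnth.
Qed.

Lemma fading_n_cons n x (h : n.-tuple R) :
  fading_n f (cons_tuple x h) = (f x * fading_n f h)%R.
Proof.
rewrite /fading_n big_ord_recl tnth0; congr (_ * _)%R.
by apply: eq_bigr => i _; rewrite tnthS.
Qed.

Lemma gauss_n_cons n x (z : n.-tuple R) :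
  gauss_n sigma (cons_tuple x z) = (g x * gauss_n sigma z)%R.
Proof.
rewrite /gauss_n big_ord_recl tnth0; congr (_ * _)%R.
by apply: eq_bigr => i _; rewrite tnthS.
Qed.

Lemma le_fg_expect n (F G : n.-tuple R * n.-tuple R -> \bar R) :
  (forall p, 0 <= F p) ->
  (forall h z, fading_n f h != 0%R -> F (h, z) <= G (h, z)) ->
  fg_expect F <= fg_expect G.
Proof.
move=> F0 FG; apply: le_iint => h.
  rewrite mule_ge0 ?lee_fin ?fading_n_ge0//; apply: iint_ge0 => z.
  by rewrite mule_ge0 ?lee_fin ?gauss_n_ge0.
have [->|fh] := eqVneq (fading_n f h) 0%R; first by rewrite !mul0e.
rewrite lee_wpmul2l ?lee_fin ?fading_n_ge0//; apply: le_iint => z.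
  by rewrite mule_ge0 ?lee_fin ?gauss_n_ge0.
by rewrite lee_wpmul2l ?lee_fin ?gauss_n_ge0// FG.
Qed.

Lemma fg_expect_ge0 n (F : n.-tuple R * n.-tuple R -> \bar R) :
  (forall p, 0 <= F p) -> 0 <= fg_expect F.
Proof.
move=> F0; apply: iint_ge0 => h.
rewrite mule_ge0 ?lee_fin ?fading_n_ge0//; apply: iint_ge0 => z.
by rewrite mule_ge0 ?lee_fin ?gauss_n_ge0.
Qed.

(** Stated without measurability for the sake of the error events of random lattices. *)
Lemma fg_expect_sum_le n (I : Type) (s : seq I)
    (F : I -> n.-tuple R * n.-tuple R -> \bar R) :
  (forall i p, 0 <= F i p) ->
  \sum_(i <- s) fg_expect (F i) <= fg_expect (fun p => \sum_(i <- s) F i p).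
Proof.
move=> F0.
have in0 i h : 0 <= iint (fun z => (gauss_n sigma z)%:E * F i (h, z)).
  by apply: iint_ge0 => z; rewrite mule_ge0 ?lee_fin ?gauss_n_ge0.
apply: le_trans (iint_sum_le _ _) _ => [i h|].
  by rewrite mule_ge0 ?lee_fin ?fading_n_ge0.
apply: le_iint => h; first by apply: sume_ge0 => i _; rewrite mule_ge0 ?lee_fin ?fading_n_ge0.
rewrite -ge0_sume_distrr// lee_wpmul2l ?lee_fin ?fading_n_ge0//.
apply: le_trans (iint_sum_le _ _) _ => [i z|].
  by rewrite mule_ge0 ?lee_fin ?gauss_n_ge0.
apply: le_iint => z; first by apply: sume_ge0 => i _; rewrite mule_ge0 ?lee_fin ?gauss_n_ge0.
by rewrite ge0_sume_distrr.
Qed.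

Lemma measurable_gauss_expect d (T : measurableType d) n
    (F : T * n.-tuple R -> \bar R) :
  (forall q, 0 <= F q) -> measurable_fun setT F ->
  measurable_fun setT (fun x => iint (fun z => (gauss_n sigma z)%:E * F (x, z))).
Proof.
move=> F0 mF.
apply: (measurable_iint (F := fun q => (gauss_n sigma q.2)%:E * F q)) => [q|].
  by rewrite mule_ge0 ?lee_fin ?gauss_n_ge0.
apply: emeasurable_funM => //; apply/measurable_EFinP.
exact: (measurableT_comp (@measurable_gauss_n n)).
Qed.

Lemma measurable_fg_expect d (T : measurableType d) n
    (F : T * (n.-tuple R * n.-tuple R) -> \bar R) :
  (forall q, 0 <= F q) -> measurable_fun setT F ->
  measurable_fun setT (fun x => fg_expect (fun p => F (x, p))).
Proof.
move=> F0 mF.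
apply: (measurable_iint (F := fun q : T * n.-tuple R => (fading_n f q.2)%:E *
    iint (fun z => (gauss_n sigma z)%:E * F (q.1, (q.2, z))))) => [q|].
  rewrite mule_ge0 ?lee_fin ?fading_n_ge0//; apply: iint_ge0 => z.
  by rewrite mule_ge0 ?lee_fin ?gauss_n_ge0.
apply: emeasurable_funM.
  apply/measurable_EFinP; exact: (measurableT_comp (@measurable_fading_n n)).
apply: (measurable_gauss_expect (F := fun r : (T * n.-tuple R) * n.-tuple R =>
    F (r.1.1, (r.1.2, r.2)))) => //.
apply: (measurableT_comp mF); apply/measurable_fun_pair.
  by apply: measurableT_comp.
by apply/measurable_fun_pair => //; apply: measurableT_comp.
Qed.

Section WithLaw.
Variable P : probability (measurableTypeR R * measurableTypeR R)%type R.
Hypothesis PE : forall u : R * R -> \bar R, measurable_fun setT u ->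
  (forall p, 0 <= u p) -> \int[P]_p u p =
  \int[leb]_h ((f h)%:E * \int[leb]_z ((g z)%:E * u (h, z))).

Lemma measurable_cons_pair d (T : measurableType d) n
    (F : n.+1.-tuple R * n.+1.-tuple R -> \bar R) (a b : T -> R) (s t : T -> n.-tuple R) :
  measurable_fun setT F -> measurable_fun setT a -> measurable_fun setT b ->
  measurable_fun setT s -> measurable_fun setT t ->
  measurable_fun setT (fun x => F (cons_tuple (a x) (s x), cons_tuple (b x) (t x))).
Proof.
move=> mF ma mb ms mt; apply: (measurableT_comp mF).
by apply/measurable_fun_pair; apply: measurable_cons.
Qed.

(** The left side integrates in the order h0, h, z0, z and the right side in the order h0, z0, h, z.
    The work is the exchange of z0 with the remaining fading coordinates, by [iint_integral]. *)
Lemma fg_expect_cons n (F : n.+1.-tuple R * n.+1.-tuple R -> \bar R) :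
  (forall p, 0 <= F p) -> measurable_fun setT F ->
  fg_expect F = \int[P]_p
    fg_expect (fun q : n.-tuple R * n.-tuple R => F (cons_tuple p.1 q.1, cons_tuple p.2 q.2)).
Proof.
move=> F0 mF; rewrite PE; last 2 first.
- apply: (measurable_fg_expect (F := fun r : (R * R) * (n.-tuple R * n.-tuple R) =>
    F (cons_tuple r.1.1 r.2.1, cons_tuple r.1.2 r.2.2))) => //.
  by apply: measurable_cons_pair => //; apply: measurableT_comp.
- by move=> p; exact: fg_expect_ge0.
apply: eq_integral => h0 _ /=.
pose K (q : R * n.-tuple R) := iint (fun z => (gauss_n sigma z)%:E *
  F (cons_tuple h0 q.2, cons_tuple q.1 z)).
have K0 q : 0 <= K q.
  by apply: iint_ge0 => z; rewrite mule_ge0 ?lee_fin ?gauss_n_ge0.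
have mK : measurable_fun setT K.
  apply: (measurable_gauss_expect (F := fun r : (R * n.-tuple R) * n.-tuple R =>
    F (cons_tuple h0 r.1.2, cons_tuple r.1.1 r.2))) => //.
  by apply: measurable_cons_pair => //; apply: measurableT_comp.
have mg := measurable_normal_pdf (0:R) sigma.
have g0 := normal_pdf_ge0 (0:R) sigma.
have innerE (h : n.-tuple R) : \int[leb]_z0 iint (fun z : n.-tuple R =>
    (gauss_n sigma (cons_tuple z0 z))%:E * F (cons_tuple h0 h, cons_tuple z0 z)) =
    \int[leb]_z0 ((g z0)%:E * K (z0, h)).
  apply: eq_integral => z0 _; rewrite -iintZl ?lee_fin//.
  - by apply: eq_iint => z; rewrite gauss_n_cons EFinM muleA.
  - by move=> z; rewrite mule_ge0 ?lee_fin ?gauss_n_ge0.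
  - apply: emeasurable_funM; first by apply/measurable_EFinP; exact: measurable_gauss_n.
    by apply: measurable_cons_pair.
transitivity (iint (fun h : n.-tuple R => \int[leb]_z0
    ((f h0)%:E * ((g z0)%:E * ((fading_n f h)%:E * K (z0, h)))))).
  apply: eq_iint => h; rewrite innerE fading_n_cons -ge0_integralZl//.
  - by apply: eq_integral => z0 _; rewrite EFinM -muleA; congr (_ * _); rewrite muleCA.
  - apply: emeasurable_funM; first exact/measurable_EFinP.
    by apply: (measurableT_comp mK); exact: measurable_pair2.
  - by move=> z0 _; rewrite mule_ge0 ?lee_fin.
  - by rewrite lee_fin mulr_ge0 ?fading_n_ge0.
have mfK : measurable_fun setT (fun q : R * n.-tuple R => (fading_n f q.2)%:E * K q).
  apply: emeasurable_funM => //; apply/measurable_EFinP.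
  exact: (measurableT_comp (@measurable_fading_n n)).
have mgfK : measurable_fun setT (fun q : R * n.-tuple R =>
    (g q.1)%:E * ((fading_n f q.2)%:E * K q)).
  apply: emeasurable_funM => //; apply/measurable_EFinP.
  exact: (measurableT_comp mg).
have gfK0 (q : R * n.-tuple R) : 0 <= (g q.1)%:E * ((fading_n f q.2)%:E * K q).
  by rewrite !mule_ge0 ?lee_fin ?fading_n_ge0.
pose L (q : R * n.-tuple R) := (f h0)%:E * ((g q.1)%:E * ((fading_n f q.2)%:E * K q)).
have L0 q : 0 <= L q by rewrite mule_ge0 ?lee_fin.
have mL : measurable_fun setT L by exact: measurable_funeM.
transitivity (\int[leb]_z0 iint (fun h : n.-tuple R => L (z0, h))).
  exact: (iint_integral leb (F := L)).
rewrite -ge0_integralZl ?lee_fin//; last 2 first.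
- apply: emeasurable_funM; first exact/measurable_EFinP.
  by apply: (measurable_iint (F := fun q : R * n.-tuple R => (fading_n f q.2)%:E * K q)) => // q;
    rewrite mule_ge0 ?lee_fin ?fading_n_ge0.
- by move=> z0 _; rewrite mule_ge0 ?lee_fin// fg_expect_ge0.
apply: eq_integral => z0 _ /=; rewrite iintZl ?lee_fin//; last first.
  by apply: (measurableT_comp mgfK); exact: measurable_pair1.
congr (_ * _); transitivity (iint (fun h : n.-tuple R =>
  (g z0)%:E * ((fading_n f h)%:E * K (z0, h)))); first by [].
rewrite iintZl ?lee_fin//.
- by move=> h; rewrite mule_ge0 ?lee_fin ?fading_n_ge0.
- by apply: (measurableT_comp mfK); exact: measurable_pair1.
Qed.

End WithLaw.
End ProductExpectation.

Lemma integral_probability_cst d (T : measurableType d) (R : realType)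
  (P : probability T R) (c : \bar R) : (\int[P]_x c = c)%E.
Proof. by rewrite integral_cst//= (probability_setT P) mule1. Qed.

Section ProductExpectationFormulas.
Context {R : realType}.
Variables (f : R -> R) (sigma : R).
Hypothesis mf : measurable_fun setT f.
Hypothesis f0 : forall x, 0 <= f x.
Local Notation leb := (@lebesgue_measure R).
Local Notation g := (normal_pdf 0 sigma).
Local Open Scope ereal_scope.
Variable P : probability (measurableTypeR R * measurableTypeR R)%type R.
Hypothesis PE : forall u : R * R -> \bar R, measurable_fun setT u ->
  (forall p, 0 <= u p) -> \int[P]_p u p =
  \int[leb]_h ((f h)%:E * \int[leb]_z ((g z)%:E * u (h, z))).
Local Notation E := (@fg_expect R f sigma _).

Lemma fg_expect_cst n (c : R) : (0 <= c)%R -> fg_expect f sigma (fun=> c%:E : \bar R) (n := n) = c%:E.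
Proof.
move=> c0; elim: n => [|n IH].
  by rewrite /fg_expect /= /fading_n /gauss_n !big_ord0 !mul1e.
rewrite (fg_expect_cons mf f0 PE) ?lee_fin//.
under eq_integral do rewrite IH.
exact: integral_probability_cst.
Qed.

Lemma fg_expectD n (F G : n.-tuple R * n.-tuple R -> \bar R) :
  (forall p, 0 <= F p) -> measurable_fun setT F ->
  (forall p, 0 <= G p) -> measurable_fun setT G ->
  fg_expect f sigma (fun p => F p + G p) = E F + E G.
Proof.
move=> F0 mF G0 mG; rewrite /fg_expect.
have in0 (H : n.-tuple R * n.-tuple R -> \bar R) h : (forall p, 0 <= H p) ->
    0 <= iint (fun z => (gauss_n sigma z)%:E * H (h, z)).
  by move=> H0; apply: iint_ge0 => z; rewrite mule_ge0 ?lee_fin ?gauss_n_ge0.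
have mH (H : n.-tuple R * n.-tuple R -> \bar R) h : measurable_fun setT H ->
    measurable_fun setT (fun z => (gauss_n sigma z)%:E * H (h, z)).
  move=> mH; apply: emeasurable_funM.
    by apply/measurable_EFinP; exact: measurable_gauss_n.
  by apply: (measurableT_comp mH); exact: measurable_pair1.
have mfd : measurable_fun setT (fun h : n.-tuple R => (fading_n f h)%:E).
  by apply/measurable_EFinP; exact: measurable_fading_n.
rewrite -iintD; first last.
- apply: emeasurable_funM => //; exact: (measurable_gauss_expect _ G0 mG).
- by move=> h; rewrite mule_ge0 ?lee_fin ?fading_n_ge0 ?in0.
- apply: emeasurable_funM => //; exact: (measurable_gauss_expect _ F0 mF).
- by move=> h; rewrite mule_ge0 ?lee_fin ?fading_n_ge0 ?in0.
apply: eq_iint => h; rewrite -ge0_muleDr ?in0//; congr (_ * _).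
rewrite -iintD; [| | exact: mH | |exact: mH]; last 2 first.
- by move=> z; rewrite mule_ge0 ?lee_fin ?gauss_n_ge0.
- by move=> z; rewrite mule_ge0 ?lee_fin ?gauss_n_ge0.
by apply: eq_iint => z; rewrite ge0_muleDr.
Qed.

Lemma fg_expectZl n (F : n.-tuple R * n.-tuple R -> \bar R) k : 0 <= k ->
  (forall p, 0 <= F p) -> measurable_fun setT F ->
  fg_expect f sigma (fun p => k * F p) = k * E F.
Proof.
move=> k0 F0 mF; rewrite /fg_expect -iintZl//; last 2 first.
- move=> h; rewrite mule_ge0 ?lee_fin ?fading_n_ge0//; apply: iint_ge0 => z.
  by rewrite mule_ge0 ?lee_fin ?gauss_n_ge0.
- apply: emeasurable_funM; last exact: (measurable_gauss_expect _ F0 mF).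
  by apply/measurable_EFinP; exact: measurable_fading_n.
apply: eq_iint => h; rewrite muleCA; congr (_ * _).
rewrite -iintZl//; last 2 first.
- by move=> z; rewrite mule_ge0 ?lee_fin ?gauss_n_ge0.
- apply: emeasurable_funM; first by apply/measurable_EFinP; exact: measurable_gauss_n.
  by apply: (measurableT_comp mF); exact: measurable_pair1.
by apply: eq_iint => z; rewrite muleCA.
Qed.

Lemma measurable_tnth_pair n (u : R * R -> \bar R) (i : 'I_n) : measurable_fun setT u ->
  measurable_fun setT (fun p : n.-tuple R * n.-tuple R => u (tnth p.1 i, tnth p.2 i)).
Proof.
move=> mu; apply: (measurableT_comp mu); apply/measurable_fun_pair => /=.
  by apply: (measurableT_comp (measurable_tnth i)).
by apply: (measurableT_comp (measurable_tnth i)).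
Qed.

Lemma fg_expect_prod n (u : R * R -> \bar R) :
  measurable_fun setT u -> (forall p, 0 <= u p) ->
  fg_expect f sigma (fun p : n.-tuple R * n.-tuple R =>
    \prod_(i < n) u (tnth p.1 i, tnth p.2 i)) = \prod_(i < n) \int[P]_p u p.
Proof.
move=> mu u0; elim: n => [|n IH].
  by rewrite /fg_expect /= /fading_n /gauss_n !big_ord0 !mul1e.
have mprod m : measurable_fun setT (fun p : m.-tuple R * m.-tuple R =>
    \prod_(i < m) u (tnth p.1 i, tnth p.2 i)).
  rewrite (_ : (fun _ => _) = (fun p : m.-tuple R * m.-tuple R =>
    \prod_(i <- index_enum 'I_m) u (tnth p.1 i, tnth p.2 i)))//.
  elim: (index_enum _) => [|i s IHs]; first by (under eq_fun do rewrite big_nil); exact: measurable_cst.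
  under eq_fun do rewrite big_cons.
  by apply: emeasurable_funM => //; exact: measurable_tnth_pair.
rewrite (fg_expect_cons mf f0 PE)//; last by move=> p; exact: prode_ge0.
rewrite big_ord_recl -ge0_integralZr//; last by apply: prode_ge0 => i _; exact: integral_ge0.
apply: eq_integral => p _; rewrite -IH.
have -> : (fun q : n.-tuple R * n.-tuple R => \prod_(i < n.+1)
    u (tnth (cons_tuple p.1 q.1) i, tnth (cons_tuple p.2 q.2) i)) =
  (fun q : n.-tuple R * n.-tuple R => u p * \prod_(i < n) u (tnth q.1 i, tnth q.2 i)).
  apply/funext => q; rewrite big_ord_recl !tnth0 -surjective_pairing; congr (_ * _).
  by apply: eq_bigr => i _; rewrite !tnthS.
rewrite fg_expectZl//; first by move=> q; exact: prode_ge0.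
Qed.

Lemma fg_expect_sum n (u : R * R -> \bar R) :
  measurable_fun setT u -> (forall p, 0 <= u p) ->
  fg_expect f sigma (fun p : n.-tuple R * n.-tuple R =>
    \sum_(i < n) u (tnth p.1 i, tnth p.2 i)) = \sum_(i < n) \int[P]_p u p.
Proof.
move=> mu u0; elim: n => [|n IH].
  by rewrite /fg_expect /= /fading_n /gauss_n !big_ord0 !mul1e.
have msum m : measurable_fun setT (fun p : m.-tuple R * m.-tuple R =>
    \sum_(i < m) u (tnth p.1 i, tnth p.2 i)).
  by apply: emeasurable_sum => i; exact: measurable_tnth_pair.
rewrite (fg_expect_cons mf f0 PE)//; last by move=> p; exact: sume_ge0.
transitivity (\int[P]_p (u p + \sum_(i < n) \int[P]_p u p)); last first.
  rewrite ge0_integralD//; last by move=> p _; apply: sume_ge0 => i _; exact: integral_ge0.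
  by rewrite integral_probability_cst big_ord_recl.
apply: eq_integral => p _; rewrite -IH.
have -> : (fun q : n.-tuple R * n.-tuple R => \sum_(i < n.+1)
    u (tnth (cons_tuple p.1 q.1) i, tnth (cons_tuple p.2 q.2) i)) =
  (fun q : n.-tuple R * n.-tuple R => u p + \sum_(i < n) u (tnth q.1 i, tnth q.2 i)).
  apply/funext => q; rewrite big_ord_recl !tnth0 -surjective_pairing; congr (_ + _).
  by apply: eq_bigr => i _; rewrite !tnthS.
rewrite fg_expectD//; last by move=> q; exact: sume_ge0.
(* [u p] may be infinite; it is then written as [+oo * 1] so that [fg_expectZl] applies. *)
congr (_ + _); have := u0 p; case: (u p) => [r r0|_|//].
  exact: fg_expect_cst.
have -> : fg_expect f sigma (fun _ : n.-tuple R * n.-tuple R => +oo) =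
  fg_expect f sigma (fun _ : n.-tuple R * n.-tuple R => +oo * 1%:E).
  by congr fg_expect; apply/funext => _; rewrite mule1.
by rewrite fg_expectZl// fg_expect_cst// mule1.
Qed.

(** Identifies the law of a sum of n independent copies of [X] with the n-th convolution power, so
    that a theorem about measures on the line can be used for [fg_expect]. Laws are described only
    through integrals of nonnegative functions. *)
Lemma fg_expect_law (mu : probability R R) (nu : nat -> probability R R)
    (X : R * R -> R) :
  measurable_fun setT X ->
  (forall phi : R -> \bar R, measurable_fun setT phi -> (forall x, 0 <= phi x) ->
    \int[mu]_x phi x = \int[P]_p phi (X p)) ->
  (forall phi : R -> \bar R, measurable_fun setT phi -> (forall x, 0 <= phi x) ->
    \int[nu 0%N]_x phi x = phi 0%R) ->
  (forall n (phi : R -> \bar R), measurable_fun setT phi -> (forall x, 0 <= phi x) ->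
    \int[nu n.+1]_x phi x = \int[mu]_x \int[nu n]_w phi (x + w)%R) ->
  forall n (phi : R -> \bar R), measurable_fun setT phi -> (forall x, 0 <= phi x) ->
  fg_expect f sigma (fun p : n.-tuple R * n.-tuple R =>
    phi (\sum_(i < n) X (tnth p.1 i, tnth p.2 i))%R) = \int[nu n]_w phi w.
Proof.
move=> mX muE nu0 nuS; elim=> [|n IH] phi mphi phi0.
  rewrite nu0// /fg_expect /= /fading_n /gauss_n !big_ord0 !mul1e.
  by [].
have mS m : measurable_fun setT (fun p : m.-tuple R * m.-tuple R =>
    \sum_(i < m) X (tnth p.1 i, tnth p.2 i))%R.
  apply: measurable_sum => i; apply: (measurableT_comp mX).
  by apply/measurable_fun_pair => /=; [apply: (measurableT_comp (measurable_tnth i))|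
    apply: (measurableT_comp (measurable_tnth i))].
rewrite (fg_expect_cons mf f0 PE)//; last exact: (measurableT_comp mphi (mS n.+1)).
rewrite nuS// muE.
- apply: eq_integral => p _; rewrite -IH//; last first.
    by apply: (measurableT_comp mphi); exact: measurable_funD.
  congr fg_expect; apply/funext => q; rewrite big_ord_recl !tnth0 -surjective_pairing.
  by congr (phi (_ + _)%R); apply: eq_bigr => i _; rewrite !tnthS.
- apply: (measurable_fun_fubini_tonelli_F (m2 := nu n) (fun q : R * R => phi (q.1 + q.2)%R)).
    by apply: (measurableT_comp mphi); exact: measurable_funD.
  by move=> q.
- by move=> x; exact: integral_ge0.
Qed.

End ProductExpectationFormulas.

(** * Pushforwards and convolution powers *)

Section LawSequence.
Context {R : realType}.
Local Open Scope ereal_scope.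

Lemma pushforward_probability d (T : measurableType d) (P : probability T R) (X : T -> R) :
  measurable_fun setT X -> exists mu : probability R R,
  forall phi : R -> \bar R, measurable_fun setT phi -> (forall x, 0 <= phi x) ->
    \int[mu]_x phi x = \int[P]_p phi (X p).
Proof.
move=> mX; pose Xm := isMeasurableFun.Build _ _ _ _ X mX.
pose X' : {mfun T >-> R} := HB.pack X Xm.
exists (distribution P X') => phi mphi phi0.
by rewrite ge0_integral_pushforward.
Qed.

Lemma convolution_probability (mu nu : probability R R) : exists rho : probability R R,
  forall phi : R -> \bar R, measurable_fun setT phi -> (forall x, 0 <= phi x) ->
    \int[rho]_x phi x = \int[mu]_x \int[nu]_w phi (x + w)%R.
Proof.
have mD : measurable_fun setT (fun p : R * R => p.1 + p.2)%R by exact: measurable_funD.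
have [rho rhoE] := pushforward_probability (mu \x nu)%E mD.
exists rho => phi mphi phi0; rewrite rhoE//.
rewrite (fubini_tonelli1 (fun p : R * R => phi (p.1 + p.2)%R))//.
exact: (measurableT_comp mphi mD).
Qed.

Lemma law_sequence (mu : probability R R) : exists nu : nat -> probability R R,
  (forall phi : R -> \bar R, measurable_fun setT phi -> (forall x, 0 <= phi x) ->
    \int[nu 0%N]_x phi x = phi 0%R) /\
  (forall n (phi : R -> \bar R), measurable_fun setT phi -> (forall x, 0 <= phi x) ->
    \int[nu n.+1]_x phi x = \int[mu]_x \int[nu n]_w phi (x + w)%R).
Proof.
pose nu := fix nu n : probability R R :=
  if n is m.+1 then projT1 (cid (convolution_probability mu (nu m))) else \d_(0%R : R).
exists nu; split=> [phi mphi phi0|n phi mphi phi0].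
  by rewrite /= integral_dirac// diracT mul1e.
by rewrite /=; case: cid => rho /= ->.
Qed.

End LawSequence.

(** * Translation invariance and null hyperplanes *)

Section IteratedLebesgue.
Context {R : realType}.
Local Notation leb := (@lebesgue_measure R).
Local Open Scope ereal_scope.

Lemma integral_translate (c : R) (F : R -> \bar R) : measurable_fun setT F ->
  (forall x, 0 <= F x) -> \int[leb]_x F (c + x)%R = \int[leb]_x F x.
Proof.
move=> mF F0.
have mt : measurable_fun setT ((fun x => c + x)%R : measurableTypeR R -> measurableTypeR R).
  exact: measurable_funD.
have <- : \int[pushforward leb ((fun x => c + x)%R : measurableTypeR R -> measurableTypeR R)]_x F x =
    \int[leb]_x F x.
  (* The translate of Lebesgue measure gives half-open intervals their length, so uniqueness
     identifies it with Lebesgue measure. *)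
  apply: eq_measure_integral => A mA _; apply/esym/lebesgue_measure_unique => //= _ [[a b]] _ <-.
  rewrite /pushforward /=.
  have -> : [eta +%R c] @^-1` `]a, b]%classic = `](a - c)%R, (b - c)%R]%classic.
    by apply/seteqP; split => x /=; rewrite !in_itv/= ltrBlDl lerBrDl.
  by rewrite !lebesgue_measure_itv/= !lte_fin ltrD2r; case: ifPn => // _; rewrite -!EFinB; congr EFin; ring.
by rewrite ge0_integral_pushforward.
Qed.

Lemma vadd_cons n (a b : R) (s t : n.-tuple R) :
  vadd (cons_tuple a s) (cons_tuple b t) = cons_tuple (a + b)%R (vadd s t).
Proof.
apply: eq_from_tnth => i; rewrite tnth_mktuple.
by case: (unliftP ord0 i) => [j ->|->]; rewrite ?tnth0// !tnthS tnth_mktuple.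
Qed.

Lemma cons_tuple_eta n (s : n.+1.-tuple R) : exists a (t : n.-tuple R), s = cons_tuple a t.
Proof. by exists (thead s), [tuple of behead s]; rewrite [LHS]tuple_eta; exact: val_inj. Qed.

Lemma iint_translate n (s : n.-tuple R) (F : n.-tuple R -> \bar R) :
  measurable_fun setT F -> (forall x, 0 <= F x) ->
  iint (fun z => F (vadd s z)) = iint F.
Proof.
elim: n s F => [|n IH] s F mF F0 /=; first by congr F; apply: eq_from_tnth => -[].
have [a [t ->]] := cons_tuple_eta s.
rewrite -[RHS](integral_translate a); last 2 first.
- exact: measurable_iint_cons.
- by move=> x; exact: iint_ge0.
apply: eq_integral => x _.
rewrite -(IH t (fun z => F (cons_tuple (a + x)%R z)))//; last exact: measurable_cons_section.
by apply: eq_iint => z; rewrite vadd_cons.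
Qed.

Lemma measurable_linear n (a : 'I_n -> R) :
  measurable_fun setT (fun y : n.-tuple R => \sum_(i < n) a i * tnth y i)%R.
Proof.
apply: measurable_sum => i; apply: measurable_funM => //; exact: measurable_tnth.
Qed.

(** If the first coefficient vanishes, the induction applies to every section. Otherwise the first
    coordinate is integrated innermost, after an exchange, and for fixed other coordinates the
    equation leaves a single point. *)
Lemma iint_hyperplane n (a : 'I_n -> R) (c : R) : (exists i, a i != 0%R) ->
  iint (fun y : n.-tuple R =>
    ((\sum_(i < n) a i * tnth y i)%R == c)%:R%:E : \bar R) = 0.
Proof.
elim: n a c => [|n IH] a c; first by case=> -[].
move=> [i ai]; rewrite /=.
have sumE x (t : n.-tuple R) : (\sum_(j < n.+1) a j * tnth (cons_tuple x t) j =
    a ord0 * x + \sum_(j < n) a (lift ord0 j) * tnth t j)%R.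
  by rewrite big_ord_recl tnth0; congr (_ + _)%R; apply: eq_bigr => j _; rewrite tnthS.
have [a0|a0] := eqVneq (a ord0) 0%R.
  case: (unliftP ord0 i) ai => [j ->|->]; last by rewrite a0 eqxx.
  move=> aj; apply: integral0_eq => x _.
  rewrite -[RHS](IH (fun j => a (lift ord0 j)) c); last by exists j.
  by apply: eq_iint => t; rewrite sumE a0 mul0r add0r.
have mG : measurable_fun setT (fun q : R * n.-tuple R =>
    ((\sum_(j < n.+1) a j * tnth (cons_tuple q.1 q.2) j)%R == c)%:R%:E : \bar R).
  have mS : measurable_fun setT (fun q : R * n.-tuple R =>
      (\sum_(j < n.+1) a j * tnth (cons_tuple q.1 q.2) j)%R).
    exact: (measurable_cons_comp _ _ (measurable_linear a)).
  have mB : measurable_fun setT (fun q : R * n.-tuple R =>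
      (\sum_(j < n.+1) a j * tnth (cons_tuple q.1 q.2) j)%R == c).
    by apply: measurable_fun_eqr.
  apply/measurable_EFinP.
  rewrite (_ : (fun _ => _) = (fun b : bool => b%:R : R) \o (fun q : R * n.-tuple R =>
      (\sum_(j < n.+1) a j * tnth (cons_tuple q.1 q.2) j)%R == c))//.
  by apply: measurableT_comp.
rewrite -(iint_integral leb (F := fun q : R * n.-tuple R =>
    ((\sum_(j < n.+1) a j * tnth (cons_tuple q.1 q.2) j)%R == c)%:R%:E))//.
rewrite (_ : (fun t : n.-tuple R => _) = (fun _ => 0)); last first.
  apply/funext => t; rewrite /=.
  set y := ((c - \sum_(j < n) a (lift ord0 j) * tnth t j) / a ord0)%R.
  transitivity (\int[leb]_x (\1_[set y] x)%:E); last first.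
    rewrite integral_indic//.
    exact: etrans (congr1 leb (setIT _)) (lebesgue_measure_set1 y).
  apply: eq_integral => x _; rewrite sumE indicE; congr (_%:R%:E); congr nat_of_bool.
  apply/idP/idP => [/eqP Ec|].
    by rewrite inE /= /y -Ec addrK mulrAC divff// mul1r.
  by rewrite inE /= => ->; rewrite /y mulrC divfK// subrK.
by elim: {IH} n a {i ai sumE a0 mG} => [|n IHn] _ //=; apply: integral0_eq => x _; exact: IHn.
Qed.

End IteratedLebesgue.

(** * Taylor estimates and the Gaussian tail *)

Section RealCalculus.
Context {R : realType}.
Implicit Types (f df : R -> R).

(** The hypotheses run along the segment [u + th * t], with [t] of any sign, so that both
    orientations are treated here once and for all. *)
Lemma mvt_abs f df (u t M : R) :
  (forall th : R, 0 <= th <= 1 -> is_derive (u + th * t) 1 f (df (u + th * t))) ->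
  (forall th : R, 0 <= th <= 1 -> `|df (u + th * t)| <= M) ->
  `|f (u + t) - f u| <= M * `|t|.
Proof.
move=> fdf dfM; have [->|t0] := eqVneq t 0; first by rewrite addr0 subrr normr0 mulr0.
have seg x : 0 <= (x - u) / t <= 1 -> is_derive x 1 f (df x) /\ `|df x| <= M.
  move=> xI; have -> : x = u + (x - u) / t * t by rewrite divfK// addrC subrK.
  by split; [exact: fdf|exact: dfM].
have cf a b : (forall x, a <= x <= b -> 0 <= (x - u) / t <= 1) -> {within `[a, b], continuous f}.
  move=> abI; apply: derivable_within_continuous => x; rewrite in_itv/= => /abI /seg[]; by case.
have [tp|tn|/eqP] := ltgtP t 0; last by rewrite (negbTE t0).
- have xI x : u + t <= x <= u -> 0 <= (x - u) / t <= 1.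
    move=> /andP[xu xt]; rewrite ler_ndivrMr// mul1r ler_ndivlMr// mul0r; lra.
  have [||c cI e] := @MVT_segment _ f df (u + t) u _ _ (cf _ _ xI).
  + by rewrite gerDl ltW.
  + by move=> x; rewrite in_itv/= => /andP[/ltW ux /ltW xt]; case: (seg x) => //; rewrite xI ?ux.
  + rewrite distrC e opprD addNKr normrM normrN ler_wpM2r//.
    by case: (seg c) => //; apply: xI; move: cI; rewrite in_itv.
- have xI x : u <= x <= u + t -> 0 <= (x - u) / t <= 1.
    move=> /andP[xu xt]; rewrite ler_pdivrMr// mul1r ler_pdivlMr// mul0r; lra.
  have [||c cI e] := @MVT_segment _ f df u (u + t) _ _ (cf _ _ xI).
  + by rewrite lerDl ltW.
  + by move=> x; rewrite in_itv/= => /andP[/ltW ux /ltW xt]; case: (seg x) => //; rewrite xI ?ux.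
  + rewrite e [u + t]addrC addrK normrM ler_wpM2r//.
    by case: (seg c) => //; apply: xI; move: cI; rewrite in_itv.
Qed.

Lemma segment_scale (P : R -> Prop) (u t th : R) : 0 <= th <= 1 ->
  (forall th : R, 0 <= th <= 1 -> P (u + th * t)) ->
  forall th' : R, 0 <= th' <= 1 -> P (u + th' * (th * t)).
Proof.
move=> /andP[a0 a1] HP th' /andP[b0 b1]; rewrite mulrA; apply: HP.
by rewrite mulr_ge0//= mulr_ile1.
Qed.

(** The mean value inequality for the first-order remainder, whose derivative is at most M |t| on
    the segment. The factor 1/2 is given up; only the order matters. *)
Lemma taylor2_abs f f1 f2 (u t M : R) :
  (forall th : R, 0 <= th <= 1 -> is_derive (u + th * t) 1 f (f1 (u + th * t))) ->
  (forall th : R, 0 <= th <= 1 -> is_derive (u + th * t) 1 f1 (f2 (u + th * t))) ->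
  (forall th : R, 0 <= th <= 1 -> `|f2 (u + th * t)| <= M) ->
  `|f (u + t) - f u - t * f1 u| <= M * `|t| ^+ 2.
Proof.
move=> Df Df1 f2M.
have := @mvt_abs (fun x => f x - (x - u) * f1 u) (fun x => f1 x - f1 u) u t (M * `|t|).
rewrite subrr mul0r subr0 [u + t - u]addrAC subrr add0r addrAC -mulrA -expr2; apply => th th01.
- have := Df th th01 => Dfx; apply: is_derive_eq.
  by rewrite /GRing.scale/=; ring.
- have := mvt_abs (segment_scale (P := fun x => is_derive x 1 f1 (f2 x)) th01 Df1) (segment_scale (P := fun x => `|f2 x| <= M) th01 f2M).
  move=> /le_trans; apply; rewrite ler_wpM2l ?(le_trans (normr_ge0 _) (f2M _ th01))//.
  by move: th01 => /andP[a0 a1]; rewrite normrM (ger0_norm a0) ler_piMl.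
Qed.

Lemma taylor3_abs f f1 f2 f3 (u t M : R) :
  (forall th : R, 0 <= th <= 1 -> is_derive (u + th * t) 1 f (f1 (u + th * t))) ->
  (forall th : R, 0 <= th <= 1 -> is_derive (u + th * t) 1 f1 (f2 (u + th * t))) ->
  (forall th : R, 0 <= th <= 1 -> is_derive (u + th * t) 1 f2 (f3 (u + th * t))) ->
  (forall th : R, 0 <= th <= 1 -> `|f3 (u + th * t)| <= M) ->
  `|f (u + t) - f u - t * f1 u - t ^+ 2 / 2 * f2 u| <= M * `|t| ^+ 3.
Proof.
move=> Df Df1 Df2 f3M.
have := @mvt_abs (fun x => f x - (x - u) * f1 u - (x - u) ^+ 2 / 2 * f2 u)
  (fun x => f1 x - f1 u - (x - u) * f2 u) u t (M * `|t| ^+ 2).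
have -> : f (u + t) - (u + t - u) * f1 u - (u + t - u) ^+ 2 / 2 * f2 u -
   (f u - (u - u) * f1 u - (u - u) ^+ 2 / 2 * f2 u) =
   f (u + t) - f u - t * f1 u - t ^+ 2 / 2 * f2 u by field.
have -> : M * `|t| ^+ 3 = M * `|t| ^+ 2 * `|t| by ring.
apply => th th01.
- have := Df th th01 => Dfx; apply: is_derive_eq.
  by rewrite /GRing.scale/=; field.
- have := taylor2_abs (segment_scale (P := fun x => is_derive x 1 f1 (f2 x)) th01 Df1) (segment_scale (P := fun x => is_derive x 1 f2 (f3 x)) th01 Df2)
    (segment_scale (P := fun x => `|f3 x| <= M) th01 f3M).
  have -> : u + th * t - u = th * t by ring.
  move=> /le_trans; apply.
  rewrite ler_wpM2l ?(le_trans (normr_ge0 _) (f3M _ th01))//.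
  move: th01 => /andP[a0 a1]; rewrite normrM (ger0_norm a0) exprMn ler_piMl ?sqr_ge0//.
  by rewrite exprn_ile1.
Qed.

End RealCalculus.

Section GaussTail.
Context {R : realType}.
Local Notation leb := (@lebesgue_measure R).
Local Notation phi := (normal_pdf (0:R) 1).
Local Notation Q := (@Qfun R).

Lemma normal_pdf01E u : phi u = (Num.sqrt (pi *+ 2))^-1 * expR (- (u ^+ 2 / 2)).
Proof.
rewrite normal_pdfE ?oner_neq0// /normal_peak /normal_fun expr1n mul1r subr0 mulNr.
by [].
Qed.

Lemma is_derive_normal_pdf01 (u : R) : is_derive u 1 phi (- (u * phi u)).
Proof.
rewrite (_ : normal_pdf 0 1 = fun u => (Num.sqrt (pi *+ 2))^-1 * expR (- (u ^+ 2 / 2))); last first.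
  by apply/funext => x; exact: normal_pdf01E.
apply: is_derive_eq; rewrite /GRing.scale/=; field.
by rewrite gt_eqF// sqrtr_gt0 mulrn_wgt0// pi_gt0.
Qed.

Lemma normal_pdf01_le1 u : phi u <= 1.
Proof.
rewrite normal_pdf01E; apply: mulr_ile1 => //.
- have sge1 : 1 <= Num.sqrt (pi *+ 2) :> R.
    rewrite -[X in X <= _]sqrtr1 ler_wsqrtr//.
    by have := @pi_ge2 R; rewrite mulr2n; lra.
  by rewrite invf_le1// (lt_le_trans ltr01).
- by rewrite -expR0 ler_expR oppr_le0 divr_ge0// sqr_ge0.
Qed.

(** Rewrites the upper tail through a left-unbounded integral, the form to which the fundamental
    theorem of calculus applies. *)
Lemma QfunE x : Q x = 1 - \int[leb]_(t in `]-oo, x]) phi t.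
Proof.
have mphi := measurable_normal_pdf (0:R) 1.
have intphi := integrable_normal_pdf (0:R) 1.
have intS (A : set R) : measurable A -> leb.-integrable A (EFin \o phi).
  by move=> mA; exact: (integrableS measurableT).
apply/eqP; rewrite eq_sym subr_eq; apply/eqP.
have := integral_normal_pdf (0:R) 1.
rewrite -(setUv `]-oo, x[) ge0_integral_setU//=; last 4 first.
- exact: measurableC.
- exact/measurable_EFinP/measurable_funTS.
- by move=> y _; rewrite lee_fin normal_pdf_ge0.
- by apply/disj_setPLR; rewrite setCK.
rewrite setCitvl integral_itv_bndo_bndc; last exact/measurable_EFinP/measurable_funTS.
have fin1 : (\int[leb]_(t in `]-oo, x]) (phi t)%:E \is a fin_num)%E.
  exact: integrable_fin_num (intS _ _).
have fin2 : (\int[leb]_(t in `[x, +oo[) (phi t)%:E \is a fin_num)%E.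
  exact: integrable_fin_num (intS _ _).
by move=> /(congr1 fine); rewrite fineD// /Qfun /Rintegral addrC.
Qed.

Lemma is_derive_Qfun (x : R) : is_derive x 1 Q (- phi x).
Proof.
have -> : Q = fun x => 1 - \int[leb]_(t in `]-oo, x]) phi t.
  by apply/funext => y; exact: QfunE.
have xx : x < x + 1 by rewrite ltrDl.
have intp : leb.-integrable `]-oo, x + 1] (EFin \o phi).
  by apply: (integrableS measurableT) => //; exact: integrable_normal_pdf.
have /= [||d e] := @continuous_FTC1 R phi -oo%O x (x + 1) xx intp.
- exact: ltNyr.
- exact: continuous_normal_pdf.
rewrite -e derive1E -(add0r (- _)); apply: is_deriveB.
exact: derivableP.
Qed.

Lemma Qfun_ge0 x : 0 <= Q x.
Proof. by apply: fine_ge0; apply: integral_ge0 => t _; rewrite lee_fin normal_pdf_ge0. Qed.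

Lemma Qfun_le1 x : Q x <= 1.
Proof. by rewrite QfunE gerBl Rintegral_ge0// => t _; exact: normal_pdf_ge0. Qed.

Lemma Qfun_lipschitz x y : `|Q x - Q y| <= `|x - y|.
Proof.
have := @mvt_abs R Q (fun x => - phi x) y (x - y) 1.
rewrite mul1r [y + _]addrC subrK; apply => z _; first exact: is_derive_Qfun.
by rewrite normrN ger0_norm ?normal_pdf_ge0// normal_pdf01_le1.
Qed.

Lemma continuous_Qfun : continuous Q.
Proof.
move=> x; apply: differentiable_continuous; apply/derivable1_diffP.
by have [] := is_derive_Qfun x.
Qed.

Lemma measurable_Qfun : measurable_fun setT Q.
Proof. exact: continuous_measurable_fun continuous_Qfun. Qed.

Lemma Qfun_integral u :
  ((Q u)%:E = \int[leb]_z ((phi z)%:E * ((u <= z)%R%:R)%:E))%E.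
Proof.
rewrite /Qfun fineK; last first.
  apply: (@integrable_fin_num _ _ _ leb `[u, +oo[) => //.
  by apply: (integrableS measurableT) => //; exact: integrable_normal_pdf.
rewrite integral_mkcond; apply: eq_integral => z _.
rewrite patchE; have [|] := boolP (u <= z) => uz.
  by rewrite mem_set ?mule1//= in_itv/= uz.
by rewrite memNset ?mule0//= in_itv/= (negbTE uz).
Qed.

(** This is (|a| - 2)^2 >= 0. One of the two factors exp(-|a|) will pay for a polynomial, the other
    remains as decay. *)
Lemma expR_le_gauss (a : R) : expR (- (a ^+ 2 / 2)) <= expR 2 * (expR (- `|a|) * expR (- `|a|)).
Proof.
rewrite -!expRD ler_expR -(real_normK (num_real a)); have := sqr_ge0 (`|a| - 2).
by rewrite !expr2; nra.
Qed.

(** The 9 serves |u|^3 + 3 |u| <= 6 exp |u| + 3 exp |u|, the largest polynomial among the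
    derivatives in use; exp 2 comes from [expR_le_gauss]. *)
Definition gauss_env : R := 9 * expR 2.

Lemma gauss_env_gt0 : 0 < gauss_env.
Proof. by rewrite mulr_gt0// expR_gt0. Qed.

Lemma normal_pdf01_env (p u : R) : `|p| <= 9 * expR `|u| -> `|p * phi u| <= gauss_env * expR (- `|u|).
Proof.
move=> pu; rewrite normrM (ger0_norm (normal_pdf_ge0 _ _ _)).
have phiu : phi u <= expR (- (u ^+ 2 / 2)).
  rewrite normal_pdf01E ler_piMl ?expR_ge0//.
  have sge1 : 1 <= Num.sqrt (pi *+ 2) :> R.
    rewrite -[X in X <= _]sqrtr1 ler_wsqrtr//.
    by have := @pi_ge2 R; rewrite mulr2n; lra.
  by rewrite invf_le1// (lt_le_trans ltr01).
apply: le_trans (ler_pM _ _ pu (le_trans phiu (expR_le_gauss u))) _ => //.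
  exact: normal_pdf_ge0.
have e1 : expR `|u| * expR (- `|u|) = 1 by rewrite -expRD subrr expR0.
rewrite (_ : 9 * expR `|u| * (expR 2 * (expR (- `|u|) * expR (- `|u|))) =
  9 * expR 2 * ((expR `|u| * expR (- `|u|)) * expR (- `|u|))); last by ring.
by rewrite e1 mul1r.
Qed.

Lemma expR_norm_ge (u : R) : [/\ 1 + `|u| <= expR `|u|, 1 + u ^+ 2 / 2 <= expR `|u|
  & 1 + `|u| ^+ 3 / 6 <= expR `|u|].
Proof.
split; first exact: expR_ge1Dx.
- by rewrite -(real_normK (num_real u)); apply: le_trans (expR_ge1Dxn 1 (normr_ge0 u)).
- by apply: le_trans (expR_ge1Dxn 2 (normr_ge0 u)).
Qed.

Lemma Qfun_d3_env (u : R) : `|(1 - u ^+ 2) * phi u| <= gauss_env * expR (- `|u|).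
Proof.
apply: normal_pdf01_env; have [_ + _] := expR_norm_ge u => h.
by have := sqr_ge0 u; rewrite ler_norml; lra.
Qed.

Lemma Qfun_d4_env (u : R) : `|(u ^+ 3 - u *+ 3) * phi u| <= gauss_env * expR (- `|u|).
Proof.
apply: normal_pdf01_env; have [h1 _ h3] := expR_norm_ge u.
apply: le_trans (ler_normB _ _) _; rewrite normrX normrMn mulrS mulr2n; lra.
Qed.

Lemma Qfun_d2_env (u : R) : `|u * phi u| <= gauss_env * expR (- `|u|).
Proof. by apply: normal_pdf01_env; have [h1 _ h3] := expR_norm_ge u; have := expR_gt0 `|u|; lra. Qed.

(** The cap at 0 keeps it at most 1 when the argument is negative, that is when the increment
    exceeds the distance to the centre. It is also the integral of exp(-r) over r >= max(b, 0). *)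
Definition envelope (b : R) : R := expR (- Num.max b 0).

(** The third derivative is taken at a point u + th w, whose modulus is at least |u| - |w|; hence
    the argument of the envelope. *)
Lemma Qfun_taylor (u w : R) :
  `|Q (u + w) - Q u + w * phi u - w ^+ 2 / 2 * (u * phi u)| <=
  gauss_env * `|w| ^+ 3 * envelope (`|u| - `|w|).
Proof.
have D0 (x : R) : is_derive x 1 Q (- phi x) by exact: is_derive_Qfun.
have D1 (x : R) : is_derive x 1 (fun x => - phi x) (x * phi x).
  by have := is_derive_normal_pdf01 x => H; apply: is_derive_eq; rewrite opprK.
have D2 (x : R) : is_derive x 1 (fun x => x * phi x) ((1 - x ^+ 2) * phi x).
  have := is_derive_normal_pdf01 x => H; apply: is_derive_eq.
  by rewrite /GRing.scale/=; ring.
have := @taylor3_abs R Q (fun x => - phi x) (fun x => x * phi x) (fun x => (1 - x ^+ 2) * phi x)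
  u w _ (fun x _ => D0 _) (fun x _ => D1 _) (fun x _ => D2 _).
rewrite mulrN opprK.
rewrite [gauss_env * _ * _]mulrAC; apply=> th /andP[th0 th1].
apply: le_trans (Qfun_d3_env _) _.
rewrite ler_wpM2l ?(ltW gauss_env_gt0)// ler_expR lerN2 ge_max normr_ge0 andbT.
apply: le_trans (lerB_normD _ _); rewrite lerD2l lerN2 normrM (ger0_norm th0).
by rewrite ler_piMl.
Qed.

Lemma is_derive_invsqrt (v : R) : 0 < v ->
  is_derive v 1 (fun v => (Num.sqrt v)^-1) (- ((2 * v)^-1 * (Num.sqrt v)^-1)).
Proof.
move=> v0; have s0 : 0 < Num.sqrt v by rewrite sqrtr_gt0.
have Ds : is_derive v 1 (fun v : R => Num.sqrt v) ((2 * Num.sqrt v)^-1).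
  exact: is_derive1_sqrt.
have H := is_deriveV (f := fun v => Num.sqrt v) (lt0r_neq0 s0) Ds.
apply: (is_derive_eq H).
rewrite /GRing.scale/= -[in (2 * v)](@sqr_sqrtr _ v) ?ltW//; field.
exact: lt0r_neq0.
Qed.

(** The heat equation: the derivative in the variance is half the second derivative in y. This makes
    the second-order Taylor term of a summand of variance 1 cancel against one unit of variance. *)
Lemma is_derive_Qheat (y v : R) : 0 < v ->
  is_derive v 1 (fun v => Q (y / Num.sqrt v))
    ((y / Num.sqrt v) * phi (y / Num.sqrt v) / (2 * v)).
Proof.
move=> v0; have Di := is_derive_invsqrt v0.
have Dl : is_derive v 1 (fun v => y / Num.sqrt v) (y * - ((2 * v)^-1 * (Num.sqrt v)^-1)).
  by apply: is_derive_eq; rewrite /GRing.scale/=; ring.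
have := @is_derive1_comp R Q (fun v => y / Num.sqrt v) v _ _ (is_derive_Qfun _) Dl.
move=> H; apply: (is_derive_eq H); rewrite /GRing.scale/=.
by rewrite invfM; ring.
Qed.

Lemma is_derive_Qheat2 (y v : R) : 0 < v ->
  is_derive v 1 (fun v => (y / Num.sqrt v) * phi (y / Num.sqrt v) / (2 * v))
    (((y / Num.sqrt v) ^+ 3 - (y / Num.sqrt v) *+ 3) * phi (y / Num.sqrt v) / (4 * v ^+ 2)).
Proof.
move=> v0; have Di := is_derive_invsqrt v0.
have Dl : is_derive v 1 (fun v => y / Num.sqrt v) (y * - ((2 * v)^-1 * (Num.sqrt v)^-1)).
  by apply: is_derive_eq; rewrite /GRing.scale/=; ring.
have Dp := @is_derive1_comp R phi (fun v => y / Num.sqrt v) v _ _ (is_derive_normal_pdf01 _) Dl.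
have v20 : 2 * v != 0 by rewrite mulf_neq0 ?gt_eqF.
have Dv : is_derive v 1 (fun v : R => (2 * v)^-1) (- (2 * v) ^- 2 * 2).
  have D2 : is_derive v 1 (fun v : R => 2 * v) 2.
    by apply: is_derive_eq; rewrite /GRing.scale/=; ring.
  exact: (is_deriveV (f := fun v => 2 * v) v20 D2).
have H := is_deriveM (is_deriveM Dl Dp) Dv.
apply: (is_derive_eq H); rewrite !fctE /GRing.scale/= /=.
have s0 : Num.sqrt v != 0 by rewrite gt_eqF// sqrtr_gt0.
by field; rewrite s0 gt_eqF.
Qed.

Lemma Qfun_heat (y v : R) : 1 <= v ->
  `|Q (y / Num.sqrt (v + 1)) - Q (y / Num.sqrt v)
     - (y / Num.sqrt v) * phi (y / Num.sqrt v) / (2 * v)| <=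
  gauss_env * (v ^+ 2)^-1 * expR (- (`|y| / (2 * Num.sqrt v))).
Proof.
move=> v1; have v0 : 0 < v by exact: lt_le_trans v1.
have M0 : 0 <= gauss_env * (v ^+ 2)^-1 * expR (- (`|y| / (2 * Num.sqrt v))).
  by rewrite !mulr_ge0 ?expR_ge0 ?invr_ge0 ?sqr_ge0 ?ltW ?gauss_env_gt0.
(* On [v, v + 1] one has w >= v for the algebraic factor, and w <= 4 v, so sqrt w <= 2 sqrt v, for
   the exponential one. *)
have D4 (w : R) : v <= w -> w <= v + 1 ->
   `|((y / Num.sqrt w) ^+ 3 - (y / Num.sqrt w) *+ 3) * phi (y / Num.sqrt w) / (4 * w ^+ 2)| <=
   gauss_env * (v ^+ 2)^-1 * expR (- (`|y| / (2 * Num.sqrt v))).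
  move=> vw wv; have w0 : 0 < w by exact: lt_le_trans vw.
  have sw0 : 0 < Num.sqrt w by rewrite sqrtr_gt0.
  rewrite normrM (le_trans (ler_wpM2r (normr_ge0 _) (Qfun_d4_env _)))//.
  rewrite -[leLHS]mulrA -[leRHS]mulrA ler_wpM2l ?(ltW gauss_env_gt0)// mulrC ler_pM ?expR_ge0//.
    rewrite normfV ger0_norm; last by rewrite mulr_ge0 ?sqr_ge0.
    rewrite lef_pV2 ?posrE ?exprn_gt0 ?mulr_gt0 ?exprn_gt0//.
    by rewrite !expr2; nra.
  rewrite ler_expR lerN2 normrM normfV (ger0_norm (ltW sw0)) ler_wpM2l//.
  rewrite lef_pV2 ?posrE ?mulr_gt0 ?sqrtr_gt0//.
  rewrite -(@ler_sqr R) ?nnegrE ?mulr_ge0 ?sqrtr_ge0// exprMn !sqr_sqrtr ?ltW//; lra.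
have D1 (w : R) : v <= w -> w <= v + 1 -> is_derive w 1 (fun v => Q (y / Num.sqrt v))
    ((y / Num.sqrt w) * phi (y / Num.sqrt w) / (2 * w)).
  by move=> vw _; apply: is_derive_Qheat; exact: lt_le_trans vw.
have D2 (w : R) : v <= w -> w <= v + 1 ->
  is_derive w 1 (fun v => (y / Num.sqrt v) * phi (y / Num.sqrt v) / (2 * v))
    (((y / Num.sqrt w) ^+ 3 - (y / Num.sqrt w) *+ 3) * phi (y / Num.sqrt w) / (4 * w ^+ 2)).
  by move=> vw _; apply: is_derive_Qheat2; exact: lt_le_trans vw.
have := @taylor2_abs R (fun v => Q (y / Num.sqrt v))
  (fun v => (y / Num.sqrt v) * phi (y / Num.sqrt v) / (2 * v))
  (fun w => ((y / Num.sqrt w) ^+ 3 - (y / Num.sqrt w) *+ 3) * phi (y / Num.sqrt w) / (4 * w ^+ 2))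
  v 1 (gauss_env * (v ^+ 2)^-1 * expR (- (`|y| / (2 * Num.sqrt v)))).
rewrite mul1r normr1 expr1n mulr1; apply => th th01.
- by apply: D1; move: th01; lra.
- by apply: D2; move: th01; lra.
- by apply: D4; move: th01; lra.
Qed.

(** Used with a = n and b = v: the smoothing variance v is discarded at a cost O(v / n). *)
Lemma Qfun_variance (t a b : R) : 0 < a -> 0 <= b ->
  `|Q (t / Num.sqrt (a + b)) - Q (t / Num.sqrt a)| <= gauss_env * b / a.
Proof.
move=> a0 b0.
have := @mvt_abs R (fun v => Q (t / Num.sqrt v))
  (fun v => (t / Num.sqrt v) * phi (t / Num.sqrt v) / (2 * v)) a b (gauss_env / a).
rewrite (ger0_norm b0) [gauss_env * b / a]mulrAC; apply => th /andP[th0 th1].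
  by apply: is_derive_Qheat; rewrite ltr_pwDl// mulr_ge0.
have a1 : 0 < a + th * b by rewrite ltr_pwDl// mulr_ge0.
rewrite normrM (le_trans (ler_wpM2r (normr_ge0 _) (Qfun_d2_env _)))//.
rewrite -[leLHS]mulrA ler_wpM2l ?(ltW gauss_env_gt0)// -[leRHS]mul1r ler_pM ?expR_ge0//.
have a2 : 0 < 2 * (a + th * b) by rewrite mulr_gt0.
rewrite normfV (ger0_norm (ltW a2)) lef_pV2 ?posrE//.
by have := mulr_ge0 th0 b0; lra.
Qed.

End GaussTail.

Lemma cvg_natV0 (R : realType) : (n%:R^-1 : R) @[n --> \oo] --> (0 : R).
Proof.
apply/cvgrPdist_lt => e e0; near=> n.
have ne : e^-1 < n%:R by near: n; exact: nbhs_infty_gtr.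
have n0 : 0 < n%:R :> R by apply: lt_trans ne; rewrite invr_gt0.
by rewrite sub0r normrN gtr0_norm ?invr_gt0// invf_plt.
Unshelve. all: by end_near. Qed.

Lemma is_derive_exprn (R : realType) n (z : R) :
  is_derive z 1 (fun z : R => z ^+ n.+1) (n.+1%:R * z ^+ n).
Proof.
elim: n => [|n IH]; first by rewrite expr0 mulr1; exact: is_derive_id.
have -> : (fun z : R => z ^+ n.+2) = (fun z => z * z ^+ n.+1) by apply/funext => x; rewrite exprS.
apply: is_derive_eq; rewrite /GRing.scale/= -[n.+2]addn1 natrD !exprS; ring.
Qed.

(** * Gaussian moments *)

Section NormalMoments.
Context {R : realType}.
Variable sigma : R.
Hypothesis sigma0 : 0 < sigma.
Local Notation leb := (@lebesgue_measure R).
Local Notation p := (normal_pdf (0:R) sigma).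

Lemma normal_pdf0E z : p z = normal_peak sigma * expR (- (z ^+ 2 / (2 * sigma ^+ 2))).
Proof.
rewrite normal_pdfE ?gt_eqF// /normal_fun subr0 mulNr -mulr_natl //.
Qed.

Lemma is_derive_normal_pdf (z : R) : is_derive z 1 p (- (z / sigma ^+ 2 * p z)).
Proof.
rewrite (_ : normal_pdf 0 sigma = fun z => normal_peak sigma * expR (- (z ^+ 2 / (2 * sigma ^+ 2)))); last first.
  by apply/funext => x; exact: normal_pdf0E.
by apply: is_derive_eq; rewrite /GRing.scale/=; field; rewrite gt_eqF.
Qed.

Lemma continuous_pow_normal m : continuous (fun z : R => z ^+ m * p z).
Proof.
move=> z; apply: cvgM; first exact: exprn_continuous.
by apply: continuous_normal_pdf; rewrite gt_eqF.
Qed.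

Lemma normal_pow_cvg0 m : (n%:R ^+ m * p n%:R : R) @[n --> \oo] --> (0 : R).
Proof.
have s0 : 0 < 2 * sigma ^+ 2 by rewrite mulr_gt0// exprn_gt0.
(* From exp x >= x^(m+1) / (m+1)! at x = n^2 / (2 sigma^2), which leaves n^m / n^(2(m+1)) <= 1 /
   n. *)
pose c := normal_peak sigma * ((m.+1)`!%:R * (2 * sigma ^+ 2) ^+ m.+1).
have pk0 := normal_peak_ge0 sigma.
have c0 : 0 <= c by rewrite !mulr_ge0// exprn_ge0// ltW.
apply: (@squeeze_cvgr _ _ _ _ (fun=> 0) (fun n => c * (n%:R)^-1)); last 2 first.
- exact: cvg_cst.
- rewrite -[X in _ --> X](mulr0 c); apply: cvgM; first exact: cvg_cst.
  exact: cvg_natV0.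
exists 1%N => // n /= n0; have nr : 0 < n%:R :> R by rewrite ltr0n.
have n1 : 1 <= n%:R :> R by rewrite ler1n.
rewrite mulr_ge0 ?exprn_ge0 ?normal_pdf_ge0 ?(ltW nr)//= normal_pdf0E.
rewrite mulrCA /c -mulrA ler_wpM2l// expRN.
set x := n%:R ^+ 2 / (2 * sigma ^+ 2).
have x0 : 0 < x by rewrite divr_gt0// exprn_gt0.
have ex : x ^+ m.+1 / (m.+1)`!%:R <= expR x.
  by apply: le_trans (expR_ge1Dxn m (ltW x0)); rewrite lerDr.
have xf : 0 < x ^+ m.+1 / (m.+1)`!%:R by rewrite divr_gt0 ?exprn_gt0// ltr0n fact_gt0.
have exi : (expR x)^-1 <= (x ^+ m.+1 / (m.+1)`!%:R)^-1.
  by rewrite lef_pV2 ?posrE ?expR_gt0.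
apply: le_trans (ler_wpM2l (exprn_ge0 _ (ltW nr)) exi) _.
rewrite invf_div mulrCA -mulrA ler_wpM2l ?ler0n//.
rewrite /x expr_div_n invf_div mulrCA ler_wpM2l ?exprn_ge0 ?(ltW s0)//.
rewrite ler_pdivrMr ?exprn_gt0// ler_pdivlMl// -exprS -exprM ler_weXn2l//.
by rewrite mul2n -addnn leq_addr.
Qed.

Local Open Scope ereal_scope.

(** Integration by parts on [-n, n] with antiderivative z^(2m+1) p(z), whose boundary values tend to
    0. The equality lives in the extended reals, so that finiteness of the even moments follows from
    the recursion itself. *)
Lemma normal_moment_rec (m : nat) :
  \int[leb]_z ((z ^+ m.*2.+2)%R * p z)%:E =
  ((m.*2.+1)%:R * sigma ^+ 2)%:E * \int[leb]_z ((z ^+ m.*2)%R * p z)%:E.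
Proof.
pose I (n : nat) := `[(- n%:R : R)%R, n%:R]%classic.
have cvgI k : \int[leb]_(z in I n) ((z ^+ k.*2)%R * p z)%:E @[n --> \oo] -->
    \int[leb]_z ((z ^+ k.*2)%R * p z)%:E.
  have -> : [set: R] = \bigcup_n I n.
    apply/seteqP; split => // x _; have nx := archi_boundP (normr_ge0 x).
    exists (Num.bound `|x|%R) => //; rewrite /I/= in_itv/= lerNl.
    by rewrite !(le_trans _ (ltW nx))// ?ler_norm// -normrN ler_norm.
  apply: ge0_nondecreasing_set_cvg_integral.
  - move=> a b ab; rewrite subsetEset => x; rewrite /I/= !in_itv/= => /andP[xa xb].
    by rewrite (le_trans _ xa) ?lerN2 ?ler_nat// (le_trans xb)// ler_nat.
  - by move=> n; exact: measurable_itv.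
  - move=> n; apply/measurable_EFinP/measurable_funTS.
    exact: continuous_measurable_fun (@continuous_pow_normal _).
  - by move=> n x _; rewrite lee_fin mulr_ge0 ?normal_pdf_ge0// exprn_even_ge0// odd_double.
have intI k n : leb.-integrable (I n) (EFin \o (fun z => (z ^+ k)%R * p z)%R).
  apply: continuous_compact_integrable; first exact: segment_compact.
  by apply: continuous_subspaceT => x; exact: continuous_pow_normal.
have stepI n : (0 < n)%N -> \int[leb]_(z in I n) ((z ^+ m.*2.+2)%R * p z)%:E =
   ((m.*2.+1)%:R * sigma ^+ 2)%:E * \int[leb]_(z in I n) ((z ^+ m.*2)%R * p z)%:E +
   (- (2 * sigma ^+ 2) * (n%:R ^+ m.*2.+1 * p n%:R))%:E.
  move=> n0; pose F (z : R) := (z ^+ m.*2.+1 * p z)%R.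
  pose f (z : R) := ((m.*2.+1)%:R * (z ^+ m.*2 * p z) - (sigma ^+ 2)^-1 * (z ^+ m.*2.+2 * p z))%R.
  have DF (z : R) : is_derive z (1%R : R) F (f z).
    have Dp := is_derive_normal_pdf z.
    have Dx : is_derive z (1%R : R) (fun z : R => z ^+ m.*2.+1)%R (m.*2.+1%:R * z ^+ m.*2)%R.
      exact: is_derive_exprn.
    rewrite /F; apply: is_derive_eq; rewrite /GRing.scale/= /f.
    rewrite !exprS; move: (z ^+ m.*2)%R => w; move: (m.*2.+1) => k.
    by field; rewrite gt_eqF.
  have FTC : \int[leb]_(z in I n) (f z)%:E = (F n%:R)%:E - (F (- n%:R)%R)%:E.
    apply: continuous_FTC2.
    + by rewrite -subr_gt0 opprK -natrD ltr0n addn_gt0 n0.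
    + apply: continuous_subspaceT => x.
      by apply: cvgB; apply: cvgM; (try exact: cvg_cst); exact: continuous_pow_normal.
    + have cF : continuous F by exact: continuous_pow_normal.
      split.
      * by move=> x _; have [] := DF x.
      * exact: cvg_at_right_filter (cF _).
      * exact: cvg_at_left_filter (cF _).
    + by move=> x _; rewrite derive1E; have [_ ->] := DF x.
  have FN : (F (- n%:R) = - F n%:R)%R.
    by rewrite /F exprNn -signr_odd /= odd_double /= expr1 !normal_pdf0E sqrrN mulN1r mulNr.
  have fI k : \int[leb]_(z in I n) ((z ^+ k)%R * p z)%:E \is a fin_num.
    apply: (@integrable_fin_num _ _ _ leb (I n)); first exact: measurable_itv.
    exact: intI.
  have fA := fI m.*2.+2; have fB := fI m.*2.
  have : \int[leb]_(z in I n) (f z)%:E =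
      (m.*2.+1)%:R%:E * \int[leb]_(z in I n) ((z ^+ m.*2)%R * p z)%:E -
      ((sigma ^+ 2)^-1)%:E * \int[leb]_(z in I n) ((z ^+ m.*2.+2)%R * p z)%:E.
    have ZI k (c : R) : \int[leb]_(z in I n) (c%:E * ((z ^+ k)%R * p z)%:E) =
        c%:E * \int[leb]_(z in I n) ((z ^+ k)%R * p z)%:E.
      exact: (@integralZl _ _ _ leb (I n) (measurable_itv _) _ (intI k n)).
    rewrite -!ZI -integralB//; last 2 first.
    - exact: (@integrableZl _ _ _ leb (I n) (measurable_itv _) _ _ (intI m.*2 n)).
    - exact: (@integrableZl _ _ _ leb (I n) (measurable_itv _) _ _ (intI m.*2.+2 n)).
    exact: measurable_itv.
  rewrite FTC FN -(fineK fA) -(fineK fB); set B := fine _; set A := fine _.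
  rewrite -!EFinM -!EFinB => -[] e; congr (_%:E).
  have {}e : ((sigma ^+ 2)^-1 * A = m.*2.+1%:R * B - (F n%:R - - F n%:R))%R.
    by rewrite e opprB addrC subrK.
  have : (A = sigma ^+ 2 * ((sigma ^+ 2)^-1 * A))%R by field; rewrite gt_eqF.
  by rewrite e => ->; rewrite /F; ring.
have lim0 : ((- (2 * sigma ^+ 2) * (n%:R ^+ m.*2.+1 * p n%:R))%R)%:E @[n --> \oo] --> 0%:E.
  apply: cvg_EFin; first exact: nearW.
  rewrite -[X in _ --> X](mulr0 (- (2 * sigma ^+ 2))%R); apply: cvgM; first exact: cvg_cst.
  exact: normal_pow_cvg0.
have M0 : 0 <= \int[leb]_z ((z ^+ m.*2)%R * p z)%:E.
  by apply: integral_ge0 => z _; rewrite lee_fin mulr_ge0 ?normal_pdf_ge0// exprn_even_ge0// odd_double.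
have limR : (((m.*2.+1)%:R * sigma ^+ 2)%:E * \int[leb]_(z in I n) ((z ^+ m.*2)%R * p z)%:E +
   (- (2 * sigma ^+ 2) * (n%:R ^+ m.*2.+1 * p n%:R))%:E) @[n --> \oo] -->
   ((m.*2.+1)%:R * sigma ^+ 2)%:E * \int[leb]_z ((z ^+ m.*2)%R * p z)%:E + 0%:E.
  apply: cvgeD => //; first by rewrite fin_num_adde_defl.
  by apply: cvgeZl => //; exact: cvgI.
rewrite -[RHS]adde0; apply: cvg_unique (cvgI m.+1) _ => //.
apply: cvg_trans limR; apply: near_eq_cvg; near=> n.
by rewrite /= doubleS stepI//; near: n; exists 1%N.
Unshelve. all: by end_near. Qed.

Lemma normal_moment0 : \int[leb]_z ((z ^+ 0)%R * p z)%:E = 1.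
Proof.
under eq_integral do rewrite expr0 mul1r.
exact: integral_normal_pdf.
Qed.

Lemma normal_moment2 : \int[leb]_z ((z ^+ 2)%R * p z)%:E = (sigma ^+ 2)%:E.
Proof. by rewrite (normal_moment_rec 0) normal_moment0 mule1 mul1r. Qed.

Lemma normal_moment4 : \int[leb]_z ((z ^+ 4)%R * p z)%:E = (3 * sigma ^+ 4)%:E.
Proof.
rewrite (normal_moment_rec 1) normal_moment2 -EFinM; congr EFin.
rewrite -[(1.*2.+1)%N]/3%N; ring.
Qed.

Lemma normal_moment8 : \int[leb]_z ((z ^+ 8)%R * p z)%:E < +oo.
Proof.
by rewrite (normal_moment_rec 3) (normal_moment_rec 2) normal_moment4 -!EFinM ltry.
Qed.

End NormalMoments.

(** * Lindeberg replacement of one summand *)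

Section EnvelopeConcentration.
Context {R : realType}.
Local Notation leb := (@lebesgue_measure R).
Local Open Scope ereal_scope.

Lemma integral_exp_tail (k b : R) : (0 < k)%R ->
  \int[leb]_r (k * expR (- (k * r)) * (b <= r)%R%:R)%:E = (expR (- (k * b)))%:E.
Proof.
move=> k0.
transitivity (\int[leb]_(r in `[b, +oo[) (k * expR (- (k * r)))%:E).
  rewrite [RHS]integral_mkcond; apply: eq_integral => r _; rewrite patchE.
  have [br|br] := boolP (b <= r)%R; first by rewrite mem_set ?mulr1//= in_itv/= br.
  by rewrite memNset ?mulr0//= in_itv/= (negbTE br).
pose F r : R := (- expR (- (k * r)))%R.
have DF (r : R) : is_derive r (1%R : R) F (k * expR (- (k * r)))%R.
  by rewrite /F; apply: is_derive_eq; rewrite /GRing.scale/=; ring.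
rewrite (@ge0_continuous_FTC2y _ _ F b 0%R).
- by rewrite /F sub0e EFinN oppeK.
- by move=> x _; rewrite mulr_ge0 ?expR_ge0// ltW.
- apply: continuous_subspaceT => x; apply: cvgM; first exact: cvg_cst.
  apply: (@continuous_comp _ _ _ (fun r => - (k * r))%R expR); last exact: continuous_expR.
  by apply: cvgN; apply: cvgM; [exact: cvg_cst|exact: cvg_id].
- rewrite -[X in _ --> X]oppr0; apply: cvgN.
  apply: (cvg_comp (fun r => k * r)%R (fun y => expR (- y)) _ (@cvgr_expR R)).
  under eq_cvg do rewrite mulrC.
  by apply: gt0_cvgMly.
- by move=> x _; have [] := DF x.
- apply: cvg_at_right_filter; apply: differentiable_continuous; apply/derivable1_diffP.
  by have [] := DF b.
- by move=> x _; rewrite derive1E; have [_ ->] := DF x.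
Qed.

Lemma measurable_bool_EFin d (T : measurableType d) (b : T -> bool) :
  measurable_fun setT b -> measurable_fun setT (fun x => (b x)%:R : R).
Proof.
by move=> mb; apply: (measurableT_comp (f := fun c : bool => c%:R : R)).
Qed.

(** Layer-cake formula: the envelope is the integral of exp(-r) over r above its argument, and the
    set of w counted at level r >= 0 is a window of radius rho + c r, to which the concentration
    bound applies. *)
Lemma integral_envelope (nu : probability R R) (a d c rho b : R) :
  (0 <= a)%R -> (0 <= d)%R -> (0 < c)%R -> (0 <= rho)%R ->
  (forall r : R, (0 <= r)%R -> nu [set w | (`|w - b| <= r)%R] <= (a * r + d)%:E) ->
  \int[nu]_w (envelope ((`|w - b| - rho) / c))%:E <= (a * (rho + 4 * c) + d)%:E.
Proof.
move=> a0 d0 c0 rho0 conc.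
pose m (w : R) := Num.max ((`|w - b| - rho) / c)%R 0%R.
have mm : measurable_fun setT m.
  apply: measurable_maxr => //; apply: measurable_funM => //; apply: measurable_funB => //.
  by apply: measurableT_comp => //; apply: measurable_funB.
pose g (p : R * R) : \bar R := (1 * expR (- (1 * p.2)) * (m p.1 <= p.2)%R%:R)%:E.
have mg : measurable_fun setT g.
  apply/measurable_EFinP; apply: measurable_funM.
    apply: measurable_funM => //; apply: measurableT_comp => //; apply: measurableT_comp => //.
    exact: measurable_funM.
  apply: measurable_bool_EFin; apply: measurable_fun_ler => //.
  exact: (measurableT_comp mm).
have g0 p : 0 <= g p by rewrite lee_fin !mulr_ge0 ?expR_ge0.
have -> : \int[nu]_w (envelope ((`|w - b| - rho) / c))%:E = \int[nu]_w \int[leb]_r g (w, r).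
  by apply: eq_integral => w _; rewrite /g/= integral_exp_tail// mul1r.
rewrite fubini_tonelli//.
(* The linear growth in r is absorbed by r exp(-r) <= 2 exp(-r/2), whose integral 4 is the constant
   in the statement. *)
pose h (r : R) : \bar R := (a * rho + d)%:E * (1 * expR (- (1 * r)) * (0 <= r)%R%:R)%:E +
   (4 * (a * c))%:E * (2^-1 * expR (- (2^-1 * r)) * (0 <= r)%R%:R)%:E.
have mexp k : measurable_fun setT (fun r : R => (k * expR (- (k * r)) * (0 <= r)%R%:R)%:E).
  apply/measurable_EFinP; apply: measurable_funM.
    by apply: measurable_funM => //; apply: measurableT_comp => //; apply: measurableT_comp.
  by apply: measurable_bool_EFin; apply: measurable_fun_ler.
have e0 k r : (0 <= k)%R -> 0 <= (k * expR (- (k * r)) * (0 <= r)%R%:R)%:E :> \bar R.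
  by move=> k0; rewrite lee_fin !mulr_ge0 ?expR_ge0.
have c10 : 0 <= (a * rho + d)%:E by rewrite lee_fin addr_ge0 ?mulr_ge0.
have c20 : 0 <= (4 * (a * c))%:E by rewrite lee_fin !mulr_ge0// ltW.
apply: (@le_trans _ _ (\int[leb]_r h r)).
  apply: lower_le_integral => r; first exact: integral_ge0.
  have [r0|r0] := ltP r 0%R.
    rewrite integral0_eq ?adde_ge0 ?mule_ge0 ?e0// => w _.
    rewrite /g/= [(m w <= r)%R](_ : _ = false) ?mulr0//.
    by apply/negbTE; rewrite -ltNge (lt_le_trans r0)// /m le_max lexx orbT.
  have -> : \int[nu]_w g (w, r) = \int[nu]_w ((expR (- r))%:E * (\1_[set w | (`|w - b| <= rho + c * r)%R] w)%:E).
    apply: eq_integral => w _; rewrite /g/= !mul1r -EFinM indicE; congr (_ * _%:R)%:E; congr nat_of_bool.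
    apply/idP/idP.
      rewrite /m ge_max r0 andbT ler_pdivrMr// => H; rewrite inE/=; move: H; rewrite mulrC; lra.
    rewrite inE/= /m ge_max r0 andbT ler_pdivrMr// mulrC; lra.
  have mA : measurable [set w : R | (`|w - b| <= rho + c * r)%R].
    have mf : measurable_fun setT (fun w : R => `|w - b|%R).
      by apply: measurableT_comp => //; apply: measurable_funB.
    by have := measurable_fun_ler mf (measurable_cst (rho + c * r)%R);
      move=> /(_ measurableT [set true] I); rewrite setTI; congr measurable; apply/seteqP.
  rewrite ge0_integralZl; [|exact: measurableT
    |by apply/measurable_EFinP; exact: measurable_indic|by move=> w _; rewrite lee_fin
    |by rewrite lee_fin expR_ge0].
  rewrite integral_indic// setIT.
  apply: le_trans (lee_wpmul2l _ (conc _ _)) _.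
  - by rewrite lee_fin expR_ge0.
  - by rewrite addr_ge0// mulr_ge0// ltW.
  rewrite /h r0 !mulr1 !mul1r -!EFinM -EFinD lee_fin.
  set E := expR (- (2^-1 * r)).
  have EE : expR (- r) = (E * E)%R by rewrite -expRD; congr expR; field.
  have rE : (r * E <= 2)%R.
    have := expR_ge1Dx (2^-1 * r); have : (expR (2^-1 * r) * E = 1)%R by rewrite -expRD subrr expR0.
    have : (0 < E)%R by exact: expR_gt0.
    by move: (expR _) => X; nra.
  have E0 : (0 < E)%R by exact: expR_gt0.
  rewrite EE.
  have : (a * c * (E * (r * E)) <= a * c * (E * 2))%R.
    by rewrite ler_wpM2l ?mulr_ge0 ?(ltW c0)// ler_wpM2l// ltW.
  by move: rho0 r0; lra.
have i20 : (0 <= 2^-1 :> R)%R by rewrite invr_ge0.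
rewrite ge0_integralD; [|exact: measurableT|by move=> r _; rewrite mule_ge0// e0
  |exact: measurable_funeM (mexp _)|by move=> r _; rewrite mule_ge0// e0|exact: measurable_funeM (mexp _)].
rewrite (@ge0_integralZl _ _ _ leb setT measurableT _ (mexp 1%R)); [|by move=> r _; exact: e0|by []].
rewrite (@ge0_integralZl _ _ _ leb setT measurableT _ (mexp (2^-1)%R)); [|by move=> r _; exact: e0|by []].
rewrite !integral_exp_tail ?invr_gt0//.
by rewrite !mulr0 oppr0 expR0 !mule1 -EFinD lee_fin; lra.
Qed.

End EnvelopeConcentration.

Lemma integrable_bounded d (T : measurableType d) (R : realType) (P : probability T R)
    (h : T -> R) (K : R) : measurable_fun setT h -> (forall x, `|h x| <= K) ->
  P.-integrable setT (EFin \o h).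
Proof.
move=> mh hK; apply: measurable_bounded_integrable => //.
  by rewrite (le_lt_trans (probability_le1 _ _))// ltry.
exists K; split; first exact: num_real.
by move=> M KM x _ /=; rewrite (le_trans (hK x))// ltW.
Qed.

Lemma Rintegral_probability_cst d (T : measurableType d) (R : realType)
  (P : probability T R) (c : R) : \int[P]_x c = c.
Proof. by rewrite /Rintegral integral_probability_cst. Qed.

Lemma envelope_ge0 (R : realType) (b : R) : 0 <= envelope b.
Proof. exact: expR_ge0. Qed.

Lemma envelope_le1 (R : realType) (b : R) : envelope b <= 1.
Proof. by rewrite -[leRHS]expR0 ler_expR oppr_le0 le_max lexx orbT. Qed.

Lemma envelope_le (R : realType) (b c : R) : c <= Num.max b 0 -> envelope b <= envelope c.
Proof. by move=> cb; rewrite ler_expR lerN2 ge_max cb le_max lexx orbT. Qed.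

Lemma measurable_envelope (R : realType) : measurable_fun setT (@envelope R).
Proof.
apply: measurableT_comp => //; apply: measurableT_comp => //.
exact: measurable_maxr.
Qed.

Section LindebergStep.
Context {R : realType}.
Variables (mu : probability R R) (nu : nat -> probability R R).
Local Notation leb := (@lebesgue_measure R).
Local Notation phi := (normal_pdf (0:R) 1).
Local Notation Q := (@Qfun R).
Hypothesis nuS : forall n (h : R -> \bar R), measurable_fun setT h -> (forall x, (0 <= h x)%E) ->
    (\int[nu n.+1]_x h x = \int[mu]_x \int[nu n]_w h (x + w)%R)%E.
Hypothesis int1 : mu.-integrable setT (EFin \o (fun x : R => x)).
Hypothesis mean0 : \int[mu]_x x = 0.
Hypothesis int2 : mu.-integrable setT (EFin \o (fun x : R => x ^+ 2)).
Hypothesis var1 : \int[mu]_x (x ^+ 2) = 1.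
Let wt (x : R) := (1 + `|x| ^+ 3) * (1 + `|x|).
Hypothesis intw : mu.-integrable setT (EFin \o wt).

Let wt_ge0 x : 0 <= wt x.
Proof. by rewrite mulr_ge0// addr_ge0// exprn_ge0. Qed.

Let normQ1 x : `|Q x| <= 1.
Proof. by rewrite ger0_norm ?Qfun_ge0// Qfun_le1. Qed.

Let mnorm : measurable_fun setT (fun x : R => `|x|).
Proof. exact: measurableT_comp. Qed.

(** A common bound for two errors: |x|^3 stands for the Taylor remainder and 1 for the heat
    remainder. The scale 2 sqrt v is that of [Qfun_heat], the weaker of the two decays. *)
Definition lindeberg_rem (v t w x : R) : R :=
  gauss_env / Num.sqrt v ^+ 3 *
  ((1 + `|x| ^+ 3) * envelope ((`|w - t| - `|x|) / (2 * Num.sqrt v))).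

Lemma lindeberg_rem_ge0 v t w x : 0 <= lindeberg_rem v t w x.
Proof.
rewrite mulr_ge0// ?divr_ge0 ?exprn_ge0// ?(ltW gauss_env_gt0)//.
by rewrite mulr_ge0 ?envelope_ge0// addr_ge0// exprn_ge0.
Qed.

Lemma measurable_lindeberg_rem v t d (T : measurableType d) (a b : T -> R) :
  measurable_fun setT a -> measurable_fun setT b ->
  measurable_fun setT (fun p => lindeberg_rem v t (a p) (b p)).
Proof.
move=> ma mb; apply: measurable_funM => //.
have mnb : measurable_fun setT (fun p => `|b p|) by exact: (measurableT_comp mnorm).
apply: measurable_funM; first by apply: measurable_funD => //; exact: measurable_funX.
apply: (measurableT_comp (@measurable_envelope R)); apply: measurable_funM => //.
by apply: measurable_funB => //; apply: (measurableT_comp mnorm); exact: measurable_funB.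
Qed.

Lemma lindeberg_taylor (v t w x u : R) : 1 <= v -> u = (w - t) / Num.sqrt v ->
  `|Q ((x + w - t) / Num.sqrt v) -
    (Q u + (- phi u / Num.sqrt v) * x + (u * phi u / (2 * v)) * x ^+ 2)| +
  gauss_env * (v ^+ 2)^-1 * expR (- (`|w - t| / (2 * Num.sqrt v))) <= lindeberg_rem v t w x.
Proof.
move=> v1 ->; clear u; set u := (w - t) / Num.sqrt v.
have v0 : 0 < v by exact: lt_le_trans v1.
set s := Num.sqrt v; have s0 : 0 < s by rewrite sqrtr_gt0.
have ss : s ^+ 2 = v by rewrite sqr_sqrtr// ltW.
have s1 : 1 <= s by rewrite /s -[leLHS]sqrtr1 ler_wsqrtr.
have sn0 : s != 0 by rewrite gt_eqF.
have C0 := @gauss_env_gt0 R.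
have -> : lindeberg_rem v t w x =
    gauss_env / s ^+ 3 * envelope ((`|w - t| - `|x|) / (2 * s)) +
    gauss_env / s ^+ 3 * (`|x| ^+ 3 * envelope ((`|w - t| - `|x|) / (2 * s))).
  by rewrite /lindeberg_rem -/s; ring.
rewrite addrC; apply: lerD.
  rewrite -[leLHS]mulrA -[leRHS]mulrA ler_wpM2l ?(ltW C0)//; apply: ler_pM; rewrite ?expR_ge0 ?invr_ge0 ?sqr_ge0//.
    rewrite lef_pV2 ?posrE ?exprn_gt0// -ss -exprM.
    exact: ler_weXn2l.
  rewrite ler_expR lerN2 ge_max; apply/andP; split; last by rewrite divr_ge0// mulr_ge0// ltW.
  by rewrite ler_pM2r ?invr_gt0 ?mulr_gt0// gerBl.
have -> : (x + w - t) / s = u + x / s by rewrite /u -/s -mulrDl; congr (_ / _); ring.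
have -> : Q (u + x / s) - (Q u + - phi u / s * x + u * phi u / (2 * v) * x ^+ 2) =
   Q (u + x / s) - Q u + x / s * phi u - (x / s) ^+ 2 / 2 * (u * phi u).
  by rewrite -ss; field.
apply: le_trans (Qfun_taylor _ _) _.
have -> : `|x / s| = `|x| / s by rewrite normrM normfV (ger0_norm (ltW s0)).
have -> : gauss_env / s ^+ 3 * (`|x| ^+ 3 * envelope ((`|w - t| - `|x|) / (2 * s))) =
   gauss_env * (`|x| / s) ^+ 3 * envelope ((`|w - t| - `|x|) / (2 * s)).
  by field.
rewrite ler_wpM2l ?mulr_ge0 ?exprn_ge0 ?mulr_ge0 ?invr_ge0 ?(ltW C0) ?(ltW s0)//.
apply: envelope_le.
have -> : `|u| = `|w - t| / s by rewrite /u normrM normfV (ger0_norm (ltW s0)).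
rewrite -mulrBl; set y := (_ / s).
have -> : (`|w - t| - `|x|) / (2 * s) = y / 2 by rewrite /y; field.
by rewrite le_max; have [y0|y0] := leP 0 y; apply/orP; [left|right]; lra.
Qed.

Lemma integrable_lindeberg_rem v t w :
  mu.-integrable setT (EFin \o lindeberg_rem v t w).
Proof.
have C0 := @gauss_env_gt0 R.
apply: (@le_integrable _ _ _ mu setT measurableT _
  (fun x => (gauss_env / Num.sqrt v ^+ 3)%:E * (wt x)%:E)%E).
- apply/measurable_EFinP; exact: measurable_lindeberg_rem.
- move=> x _; rewrite /= lee_fin ger0_norm ?lindeberg_rem_ge0//.
  rewrite ger0_norm; last by rewrite mulr_ge0// divr_ge0 ?exprn_ge0 ?(ltW C0).
  rewrite /lindeberg_rem ler_wpM2l ?divr_ge0 ?exprn_ge0 ?(ltW C0)//.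
  rewrite ler_wpM2l ?addr_ge0 ?exprn_ge0// (le_trans (envelope_le1 _))//.
  by rewrite lerDl.
- exact: (@integrableZl _ _ _ mu setT measurableT _ _ intw).
Qed.

(** With mean 0 and variance 1 the quadratic Taylor polynomial integrates to Q u + u phi(u) / (2 v),
    which is also the first-order expansion of Q((w - t) / sqrt(v + 1)). So one summand is traded
    for one unit of smoothing variance. *)
Lemma lindeberg_step_pointwise (v t w : R) : 1 <= v ->
  `|\int[mu]_x Q ((x + w - t) / Num.sqrt v) - Q ((w - t) / Num.sqrt (v + 1))| <=
  \int[mu]_x lindeberg_rem v t w x.
Proof.
move=> v1; set s := Num.sqrt v; set u := (w - t) / s.
set H := gauss_env * (v ^+ 2)^-1 * expR (- (`|w - t| / (2 * s))).
pose h x := Q ((x + w - t) / s).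
pose lin x := Q u + (- phi u / s) * x + (u * phi u / (2 * v)) * x ^+ 2.
have mh : measurable_fun setT h.
  apply: (measurableT_comp (@measurable_Qfun R)); apply: measurable_funM => //.
  by apply: measurable_funB => //; apply: measurable_funD.
have ih : mu.-integrable setT (EFin \o h) by apply: (@integrable_bounded _ _ _ _ _ 1) => // x; exact: normQ1.
have icst (c : R) : mu.-integrable setT (EFin \o (fun=> c)).
  by apply: (@integrable_bounded _ _ _ _ _ `|c|) => //; exact: measurable_cst.
have i1 (c : R) : mu.-integrable setT (EFin \o (fun x => c * x)).
  exact: (@integrableZl _ _ _ mu setT measurableT _ _ int1).
have i2 (c : R) : mu.-integrable setT (EFin \o (fun x => c * x ^+ 2)).
  exact: (@integrableZl _ _ _ mu setT measurableT _ _ int2).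
have i01 (c c' : R) : mu.-integrable setT (EFin \o (fun x => c + c' * x)).
  exact: (@integrableD _ _ _ mu setT measurableT _ _ (icst c) (i1 c')).
have ilin : mu.-integrable setT (EFin \o lin).
  exact: (@integrableD _ _ _ mu setT measurableT _ _ (i01 _ _) (i2 _)).
have Elin : \int[mu]_x lin x = Q u + u * phi u / (2 * v).
  rewrite /lin RintegralD// RintegralD//.
  rewrite !RintegralZl// mean0 var1 mulr0 addr0 mulr1; congr (_ + _).
  exact: Rintegral_probability_cst.
have idiff : mu.-integrable setT (EFin \o (fun x => h x - lin x)).
  exact: (@integrableB _ _ _ mu setT measurableT _ _ ih ilin).
have idn : mu.-integrable setT (EFin \o (fun x => `|h x - lin x|)).
  exact: (integrable_norm idiff).
have -> : \int[mu]_x h x - Q ((w - t) / Num.sqrt (v + 1)) =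
  \int[mu]_x (h x - lin x) - (Q ((w - t) / Num.sqrt (v + 1)) - Q u - u * phi u / (2 * v)).
  by rewrite RintegralB// Elin; ring.
apply: le_trans (ler_normB _ _) _.
apply: (@le_trans _ _ (\int[mu]_x (`|h x - lin x| + H))).
  rewrite (@RintegralD _ _ _ mu setT _ _ measurableT idn (icst H)) Rintegral_probability_cst.
  apply: lerD.
    exact: le_normr_Rintegral.
  exact: Qfun_heat.
apply: le_Rintegral => //.
- exact: (@integrableD _ _ _ mu setT measurableT _ _ idn (icst _)).
- exact: integrable_lindeberg_rem.
- by move=> x _; exact: lindeberg_taylor.
Qed.

(** Tonelli integrates over the partial sum first, for fixed x. [integral_envelope] with rho = |x|
    and c = 2 sqrt v gives a |x| + 8 a sqrt v + d, which is at most (a + 8 a sqrt v + d)(1 + |x|);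
    this is the second factor of [wt]. *)
Lemma lindeberg_step (m : nat) (v t a d : R) : 1 <= v -> 0 <= a -> 0 <= d ->
  (forall b r : R, 0 <= r -> (nu m [set w | (`|w - b| <= r)%R] <= (a * r + d)%:E)%E) ->
  `|\int[nu m.+1]_w Q ((w - t) / Num.sqrt v) - \int[nu m]_w Q ((w - t) / Num.sqrt (v + 1))| <=
  gauss_env / Num.sqrt v ^+ 3 * ((a + 8 * a * Num.sqrt v + d) * \int[mu]_x wt x).
Proof.
move=> v1 a0 d0 conc; set s := Num.sqrt v.
have s0 : 0 < s by rewrite sqrtr_gt0 (lt_le_trans ltr01).
have C0 := @gauss_env_gt0 R.
have mQ s' t' : measurable_fun setT (fun w : R => Q ((w - t') / s')).
  apply: (measurableT_comp (@measurable_Qfun R)); apply: measurable_funM => //.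
  exact: measurable_funB.
pose q (p : R * R) : \bar R := (Q ((p.2 + p.1 - t) / s))%:E.
have mq : measurable_fun setT q.
  apply/measurable_EFinP; apply: (measurableT_comp (mQ s t)); exact: measurable_funD.
have q0 p : (0 <= q p)%E by rewrite lee_fin Qfun_ge0.
pose h1 w := \int[mu]_x Q ((x + w - t) / s).
have h1E w : ((h1 w)%:E = \int[mu]_x q (w, x))%E.
  rewrite /h1 /Rintegral fineK//; apply: (@integrable_fin_num _ _ _ mu setT measurableT).
  apply: (@integrable_bounded _ _ _ _ _ 1); last by move=> x; exact: normQ1.
  apply: (measurableT_comp (@measurable_Qfun R)); apply: measurable_funM => //.
  by apply: measurable_funB => //; apply: measurable_funD.
have mh1 : measurable_fun setT h1.
  apply/measurable_EFinP; rewrite (_ : EFin \o h1 = fubini_F mu q).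
    exact: measurable_fun_fubini_tonelli_F.
  by apply/funext => w; rewrite /= h1E.
have h10 w : 0 <= h1 w by apply: Rintegral_ge0 => x _; exact: Qfun_ge0.
have h11 w : `|h1 w| <= 1.
  rewrite ger0_norm// -lee_fin h1E -[leRHS](integral_probability_cst mu).
  by apply: lower_le_integral => x; rewrite lee_fin ?Qfun_ge0 ?Qfun_le1.
have -> : \int[nu m.+1]_w Q ((w - t) / s) = \int[nu m]_w h1 w.
  congr fine; rewrite (nuS m (h := fun w => (Q ((w - t) / s))%:E)); last 2 first.
  - by apply/measurable_EFinP; exact: mQ.
  - by move=> x; rewrite lee_fin Qfun_ge0.
  under [RHS]eq_integral do rewrite h1E.
  rewrite (fubini_tonelli (m1 := nu m) (m2 := mu) q)//.
have ih1 : (nu m).-integrable setT (EFin \o h1) by apply: (@integrable_bounded _ _ _ _ _ 1).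
have iq' : (nu m).-integrable setT (EFin \o (fun w => Q ((w - t) / Num.sqrt (v + 1)))).
  by apply: (@integrable_bounded _ _ _ _ _ 1) => // x; exact: normQ1.
rewrite -RintegralB//; apply: le_trans (le_normr_Rintegral _ _) _ => //.
  exact: (@integrableB _ _ _ (nu m) setT measurableT _ _ ih1 iq').
have mB : measurable_fun setT (fun p : R * R => (lindeberg_rem v t p.1 p.2)%:E).
  by apply/measurable_EFinP; exact: measurable_lindeberg_rem.
have idn : (nu m).-integrable setT
    (EFin \o (fun w => `|h1 w - Q ((w - t) / Num.sqrt (v + 1))|)).
  exact: integrable_norm (@integrableB _ _ _ (nu m) setT measurableT _ _ ih1 iq').
rewrite -lee_fin [X in (X%:E <= _)%E]/Rintegral (fineK (integrable_fin_num measurableT idn)).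
apply: (@le_trans _ _ (\int[nu m]_w \int[mu]_x (lindeberg_rem v t w x)%:E)%E).
  apply: lower_le_integral => w; first by rewrite lee_fin.
  have -> : (\int[mu]_x (lindeberg_rem v t w x)%:E = (\int[mu]_x lindeberg_rem v t w x)%:E)%E.
    by rewrite fineK//; exact: (integrable_fin_num measurableT (integrable_lindeberg_rem v t w)).
  by rewrite lee_fin; exact: lindeberg_step_pointwise.
rewrite (fubini_tonelli (m1 := nu m) (m2 := mu) (fun p : R * R => (lindeberg_rem v t p.1 p.2)%:E))//; last first.
  by move=> p; rewrite lee_fin lindeberg_rem_ge0.
set K := a + 8 * a * s + d.
have K0 : 0 <= K by rewrite !addr_ge0 ?mulr_ge0 ?(ltW s0).
apply: (@le_trans _ _ (\int[mu]_x ((gauss_env / s ^+ 3 * K)%:E * (wt x)%:E))%E).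
  apply: lower_le_integral => x.
    by apply: integral_ge0 => w _; rewrite lee_fin lindeberg_rem_ge0.
  rewrite /lindeberg_rem.
  under eq_integral do rewrite /= mulrA EFinM.
  rewrite ge0_integralZl; [|exact: measurableT| |by move=> w _; rewrite lee_fin envelope_ge0|]; last 2 first.
  - apply/measurable_EFinP; apply: (measurableT_comp (@measurable_envelope R)).
    apply: measurable_funM => //; apply: measurable_funB => //.
    by apply: (measurableT_comp mnorm); exact: measurable_funB.
  - by rewrite lee_fin mulr_ge0 ?divr_ge0 ?addr_ge0 ?exprn_ge0 ?(ltW C0) ?(ltW s0).
  apply: le_trans (lee_wpmul2l _ (integral_envelope a0 d0 _ _ (conc t))) _ => //.
  - by rewrite lee_fin mulr_ge0 ?divr_ge0 ?addr_ge0 ?exprn_ge0 ?(ltW C0) ?(ltW s0).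
  - by rewrite mulr_gt0.
  rewrite -!EFinM lee_fin /wt -[leLHS]mulrA -[leRHS]mulrA ler_wpM2l ?divr_ge0 ?exprn_ge0 ?(ltW C0) ?(ltW s0)//.
  rewrite [leRHS]mulrCA ler_wpM2l ?addr_ge0 ?exprn_ge0// /K.
  rewrite -/s; have x0 := normr_ge0 x.
  have := a0; have := mulr_ge0 (mulr_ge0 a0 (ltW s0)) x0; have := mulr_ge0 a0 x0; have := mulr_ge0 d0 x0.
  by lra.
rewrite ge0_integralZl; [|exact: measurableT|exact: (measurable_int mu intw)
  |by move=> x _; rewrite lee_fin wt_ge0
  |by rewrite lee_fin mulr_ge0 ?divr_ge0 ?exprn_ge0 ?(ltW C0) ?(ltW s0)].
rewrite -(fineK (integrable_fin_num measurableT intw)) -EFinM lee_fin.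
by rewrite mulrA.
Qed.

End LindebergStep.

(** * From smoothed to true distribution functions *)

Section Desmoothing.
Context {R : realType}.
Local Notation leb := (@lebesgue_measure R).
Local Notation phi := (normal_pdf (0:R) 1).
Local Notation Q := (@Qfun R).

Definition cdf_of (nu : probability R R) (t : R) : R := fine (nu [set w | w <= t]).

Lemma measurable_le_set (t : R) : measurable [set w : R | w <= t].
Proof.
rewrite (_ : [set w | w <= t] = `]-oo, t]%classic); first exact: measurable_itv.
by apply/seteqP; split => w /=; rewrite in_itv.
Qed.

Variable nu : probability R R.
Local Notation F := (cdf_of nu).

Lemma cdf_ofE t : nu [set w | w <= t] = (F t)%:E.
Proof.
rewrite fineK// ge0_fin_numE//; apply: le_lt_trans (probability_le1 _ _) (ltry _).
exact: measurable_le_set.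
Qed.

Lemma cdf_of_ge0 t : 0 <= F t.
Proof. exact: fine_ge0. Qed.

Lemma cdf_of_le1 t : F t <= 1.
Proof. rewrite -lee_fin -cdf_ofE; apply: probability_le1; exact: measurable_le_set. Qed.

Lemma cdf_of_le s t : s <= t -> F s <= F t.
Proof.
move=> st; rewrite -lee_fin -!cdf_ofE; apply: le_measure; rewrite ?inE.
- exact: measurable_le_set.
- exact: measurable_le_set.
- by move=> w /= /le_trans; apply.
Qed.

(** Both sides are the probability of w <= t + s z with z an independent standard Gaussian. *)
Lemma smoothed_cdf (P : probability (measurableTypeR R) R) (s t : R) : 0 < s ->
  (forall h : R -> \bar R, measurable_fun setT h -> (forall x, (0 <= h x)%E) ->
    (\int[P]_z h z = \int[leb]_z ((phi z)%:E * h z))%E) ->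
  measurable_fun setT (fun z => F (t + s * z)) /\
  \int[nu]_w Q ((w - t) / s) = \int[P]_z F (t + s * z).
Proof.
move=> s0 PE.
pose k (p : R * R) : \bar R := ((p.1 <= t + s * p.2)%R%:R)%:E.
have mk : measurable_fun setT k.
  apply/measurable_EFinP; apply: measurable_bool_EFin; apply: measurable_fun_ler => //.
  by apply: measurable_funD => //; apply: measurable_funM.
have k0 p : (0 <= k p)%E by rewrite lee_fin.
have FE z : ((F (t + s * z))%:E = \int[nu]_w k (w, z))%E.
  rewrite -cdf_ofE -[in LHS](setIT [set w | w <= t + s * z]).
  rewrite -integral_indic//; last exact: measurable_le_set.
  apply: eq_integral => w _; rewrite indicE /k /=; congr (_%:R%:E); congr nat_of_bool.
  by apply/idP/idP; rewrite inE.
have FEE : EFin \o (fun z => F (t + s * z)) = fubini_G nu k by apply/funext => z; exact: FE.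
split.
  apply/measurable_EFinP; rewrite FEE; exact: measurable_fun_fubini_tonelli_G.
congr fine.
transitivity (\int[nu]_w \int[P]_z k (w, z))%E.
  apply: eq_integral => w _; rewrite Qfun_integral PE.
  - apply: eq_integral => z _; congr (_ * _%:R%:E)%E; congr nat_of_bool.
    by rewrite /= ler_pdivrMr// lerBlDl [z * s]mulrC.
  - by apply: (measurableT_comp mk); exact: measurable_pair1.
  - by move=> z.
by rewrite fubini_tonelli//; apply: eq_integral => z _; rewrite FE.
Qed.

(** The centre is moved by 2 s. For |z| <= 2 monotonicity of F transfers the discrepancy at t to the
    shifted point; for |z| > 2 only the bound D is known, and it is charged to (dl + D) z^2 / 4, of
    mean (dl + D) / 4. So 3/4 of the discrepancy survives, whence the factors 4/3 and 1/3. The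
    factor of D below 1 lets the estimate be solved for D when D is the supremum. *)
Lemma desmoothing (N : R -> R) (l s D tau : R) : 0 < s -> 0 <= l ->
  (forall x y, `|N x - N y| <= l * `|x - y|) ->
  (forall t, `|F t - N t| <= D) ->
  (forall t, `|\int[nu]_w Q ((w - t) / s) - N t| <= tau) ->
  forall t, `|F t - N t| <= 4 / 3 * (tau + 3 * l * s) + D / 3.
Proof.
move=> s0 l0 Nl FD Gtau t.
have [P PE] := density_probability (mu := leb) (measurable_normal_pdf (0:R) 1)
  (normal_pdf_ge0 (0:R) 1) (integral_normal_pdf (0:R) 1).
have icst (c : R) : P.-integrable setT (EFin \o (fun=> c)).
  by apply: (@integrable_bounded _ _ _ _ _ `|c|) => //; exact: measurable_cst.
have z2E : (\int[P]_z (z ^+ 2)%:E = 1)%E.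
  rewrite PE.
  - rewrite -[RHS](_ : (1 ^+ 2)%:E = 1%E :> \bar R); last by rewrite expr1n.
    rewrite -(normal_moment2 ltr01); apply: eq_integral => z _.
    by rewrite -EFinM mulrC.
  - by apply/measurable_EFinP; exact: measurable_funX.
  - by move=> z; rewrite lee_fin sqr_ge0.
have i2 : P.-integrable setT (EFin \o (fun z : R => z ^+ 2)).
  apply/integrableP; split; first by apply/measurable_EFinP; exact: measurable_funX.
  under eq_integral do rewrite /= ger0_norm ?sqr_ge0//.
  by rewrite z2E ltry.
have z2R : \int[P]_z (z ^+ 2) = 1 by rewrite /Rintegral z2E.
have i2c (c : R) : P.-integrable setT (EFin \o (fun z : R => c * z ^+ 2)).
  exact: (@integrableZl _ _ _ P setT measurableT _ _ i2).
have iq (A B : R) : P.-integrable setT (EFin \o (fun z : R => A + B * z ^+ 2)).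
  exact: (@integrableD _ _ _ P setT measurableT _ _ (icst A) (i2c B)).
have Eq (A B : R) : \int[P]_z (A + B * z ^+ 2) = A + B.
  rewrite (@RintegralD _ _ _ P setT _ _ measurableT (icst A) (i2c B)).
  rewrite (@RintegralZl _ _ _ P setT _ _ measurableT i2).
  by rewrite Rintegral_probability_cst z2R mulr1.
have iF t' : P.-integrable setT (EFin \o (fun z => F (t' + s * z))).
  apply: (@integrable_bounded _ _ _ _ _ 1); first exact: (smoothed_cdf t' s0 PE).1.
  by move=> z; rewrite ger0_norm ?cdf_of_ge0// cdf_of_le1.
have GE t' := (smoothed_cdf t' s0 PE).2.
have D0 : 0 <= D by exact: le_trans (FD t).
have sl0 : 0 <= l * s by rewrite mulr_ge0// ltW.
have zz (z : R) : `|z| <= (1 + z ^+ 2) / 2.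
  by rewrite -(real_normK (num_real z)); have := sqr_ge0 (1 - `|z|); rewrite !expr2; nra.
have Nz (t' z : R) : `|N (t' + s * z) - N t'| <= l * s * ((1 + z ^+ 2) / 2).
  apply: le_trans (Nl _ _) _; rewrite [t' + _]addrC addrK normrM (gtr0_norm s0) [leLHS]mulrA.
  by rewrite ler_wpM2l.
have big (z : R) : 2 < `|z| -> 4 < z ^+ 2.
  by move=> z2; rewrite -(real_normK (num_real z)) expr2; nra.
rewrite ler_norml; apply/andP; split.
- set dl := N t - F t; set t' := t - 2 * s.
  have dD : - D <= dl by have := FD t; rewrite ler_norml /dl; lra.
  have Nt' : `|N t - N t'| <= l * (2 * s).
    apply: le_trans (Nl _ _) _; rewrite /t' opprB addrC subrK gtr0_norm ?mulr_gt0//.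
  have pw z : F (t' + s * z) <= (N t' - dl + 5 / 2 * (l * s)) + ((l * s) / 2 + (dl + D) / 4) * z ^+ 2.
    have [z2|z2] := leP `|z| 2.
      have : F (t' + s * z) <= F t.
        apply: cdf_of_le; rewrite /t' -addrA gerDl addrC subr_le0 mulrC ler_pM2r//.
        by rewrite (le_trans (ler_norm _)).
      have := mulr_ge0 sl0 (sqr_ge0 z); have dD' : 0 <= dl + D by lra.
      have := mulr_ge0 dD' (sqr_ge0 z).
      by move: Nt'; rewrite ler_norml /dl; lra.
    have := big _ z2; have dD' : 0 <= dl + D by lra.
    have := FD (t' + s * z); have := Nz t' z; rewrite !ler_norml => /andP[_ h1] /andP[_ h2] h3.
    have : 0 <= (dl + D) * (z ^+ 2 - 4) by rewrite mulr_ge0// subr_ge0 ltW.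
    by lra.
  have := le_Rintegral measurableT (iF t') (iq _ _) (fun z _ => pw z).
  rewrite -GE Eq => h; have := Gtau t'; rewrite ler_norml /dl in h *; lra.
- set dl := F t - N t; set t' := t + 2 * s.
  have dD : - D <= dl by have := FD t; rewrite ler_norml /dl; lra.
  have Nt' : `|N t - N t'| <= l * (2 * s).
    apply: le_trans (Nl _ _) _; rewrite distrC /t' [t + _]addrC addrK gtr0_norm ?mulr_gt0//.
  have pw z : (N t' + dl - 5 / 2 * (l * s)) + (- ((l * s) / 2 + (dl + D) / 4)) * z ^+ 2 <= F (t' + s * z).
    have [z2|z2] := leP `|z| 2.
      have : F t <= F (t' + s * z).
        apply: cdf_of_le; rewrite /t' -addrA lerDl -[2 * s]mulrC -mulrDr pmulr_rge0//.
        by move: z2; rewrite ler_norml; lra.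
      have := mulr_ge0 sl0 (sqr_ge0 z); have dD' : 0 <= dl + D by lra.
      have := mulr_ge0 dD' (sqr_ge0 z).
      by move: Nt'; rewrite ler_norml /dl; lra.
    have := big _ z2; have dD' : 0 <= dl + D by lra.
    have := FD (t' + s * z); have := Nz t' z; rewrite !ler_norml => /andP[h1 _] /andP[h2 _] h3.
    have : 0 <= (dl + D) * (z ^+ 2 - 4) by rewrite mulr_ge0// subr_ge0 ltW.
    by lra.
  have := le_Rintegral measurableT (iq _ _) (iF t') (fun z _ => pw z).
  rewrite -GE Eq => h; have := Gtau t'; rewrite ler_norml /dl in h *; lra.
Qed.

(** The closed window is enlarged to []b - r - 1, b + r]], whose mass is a difference of two values
    of the distribution function; the extra unit of length costs the term [l]. *)
Lemma concentration_of_cdf (N : R -> R) (l D : R) :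
  (forall x y, `|N x - N y| <= l * `|x - y|) ->
  (forall t, `|F t - N t| <= D) -> forall b r : R, 0 <= r ->
  (nu [set w | (`|w - b| <= r)%R] <= (2 * l * r + (l + 2 * D))%:E)%E.
Proof.
move=> Nl FD b r r0.
have mD (x y : R) : measurable [set w : R | x < w <= y].
  rewrite (_ : [set w | _] = `]x, y]%classic); first exact: measurable_itv.
  by apply/seteqP; split => w /=; rewrite in_itv.
have : (nu [set w | (`|w - b| <= r)%R] <= nu [set w | b - r - 1 < w <= b + r]%R)%E.
  apply: le_measure; rewrite ?inE.
  - rewrite (_ : [set w | _] = `[b - r, b + r]%classic); first exact: measurable_itv.
    apply/seteqP; split => w /=; rewrite in_itv/= ler_norml; lra.
  - exact: mD.
  - by move=> w /=; rewrite ler_norml; lra.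
move=> /le_trans; apply.
have : (nu [set w | (w <= b - r - 1)%R] + nu [set w | b - r - 1 < w <= b + r]%R =
        nu [set w | (w <= b + r)%R])%E.
  rewrite -measureU//.
  - congr (nu _); apply/seteqP; split => w /=; first by case=> [|/andP[]]; lra.
    by move=> wb; have [|] := leP w (b - r - 1); [left|right].
  - exact: measurable_le_set.
  - apply/seteqP; split => w //= []; lra.
rewrite !cdf_ofE.
have fin : nu [set w | b - r - 1 < w <= b + r]%R \is a fin_num.
  by rewrite ge0_fin_numE// (le_lt_trans (probability_le1 _ _) (ltry _)).
rewrite -(fineK fin) -EFinD => -[] e; rewrite lee_fin.
have := FD (b - r - 1); have := FD (b + r); have := Nl (b + r) (b - r - 1).
have -> : b + r - (b - r - 1) = 2 * r + 1 by ring.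
rewrite [`|2 * r + 1|]ger0_norm; last by lra.
rewrite !ler_norml => /andP[_ h1] /andP[h2 h2'] /andP[h3 h3']; move: e; set X := fine _ => e.
lra.
Qed.

End Desmoothing.

(** * Berry-Esseen with a logarithm *)

Section BerryEsseen.
Context {R : realType}.
Variables (mu : probability R R) (nu : nat -> probability R R).
Local Notation Q := (@Qfun R).
Hypothesis nu0 : forall h : R -> \bar R, measurable_fun setT h -> (forall x, (0 <= h x)%E) ->
    (\int[nu 0%N]_x h x = h 0%R)%E.
Hypothesis nuS : forall n (h : R -> \bar R), measurable_fun setT h -> (forall x, (0 <= h x)%E) ->
    (\int[nu n.+1]_x h x = \int[mu]_x \int[nu n]_w h (x + w)%R)%E.
Hypothesis int1 : mu.-integrable setT (EFin \o (fun x : R => x)).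
Hypothesis mean0 : \int[mu]_x x = 0.
Hypothesis int2 : mu.-integrable setT (EFin \o (fun x : R => x ^+ 2)).
Hypothesis var1 : \int[mu]_x (x ^+ 2) = 1.
Hypothesis intw : mu.-integrable setT (EFin \o (fun x : R => (1 + `|x| ^+ 3) * (1 + `|x|))).

Let M := \int[mu]_x ((1 + `|x| ^+ 3) * (1 + `|x|)).
Let C := gauss_env * M.
Let F n := cdf_of (nu n).
(** The normal distribution function of variance n, since Q(-u) is the lower tail at u. *)
Let N n (t : R) := Q (- t / Num.sqrt n%:R).
Let G n v t := \int[nu n]_w Q ((w - t) / Num.sqrt v).
Let L n : R := 1 + ln n%:R.

Let M0 : 0 <= M.
Proof. by apply: Rintegral_ge0 => x _; rewrite mulr_ge0 ?addr_ge0 ?exprn_ge0. Qed.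

Let C0 : 0 <= C.
Proof. by rewrite mulr_ge0// ltW// gauss_env_gt0. Qed.

Let sqrtn_gt0 n : (0 < n)%N -> 0 < Num.sqrt n%:R :> R.
Proof. by move=> n0; rewrite sqrtr_gt0 ltr0n. Qed.

Lemma normal_cdf_lipschitz n : (0 < n)%N ->
  forall x y, `|N n x - N n y| <= (Num.sqrt n%:R)^-1 * `|x - y|.
Proof.
move=> n0 x y; apply: le_trans (Qfun_lipschitz _ _) _.
rewrite -mulrBl normrM normfV (gtr0_norm (sqrtn_gt0 n0)) mulrC.
by rewrite opprK addrC distrC.
Qed.

Lemma smoothed_cdf0 v t : G 0 v t = Q (- t / Num.sqrt v).
Proof.
rewrite /G /Rintegral nu0 ?sub0r//; last by move=> x; rewrite lee_fin Qfun_ge0.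
apply/measurable_EFinP; apply: (measurableT_comp (@measurable_Qfun R)).
by apply: measurable_funM => //; exact: measurable_funB.
Qed.

(** After j replacements n - j summands remain and the smoothing variance has grown from v to v +
    j. *)
Lemma lindeberg_telescope n v t (e : nat -> R) :
  (forall m j, (m.+1 + j)%N = n -> `|G m.+1 (v + j%:R) t - G m (v + j%:R + 1) t| <= e j) ->
  `|G n v t - G 0 (v + n%:R) t| <= \sum_(j < n) e j.
Proof.
move=> step; suff H j : (j <= n)%N -> `|G n v t - G (n - j) (v + j%:R) t| <= \sum_(i < j) e i.
  by have := H n (leqnn n); rewrite subnn.
elim: j => [|j IH] jn; first by rewrite subn0 addr0 subrr normr0 big_ord0.
rewrite big_ord_recr /=.
have -> : G n v t - G (n - j.+1) (v + j.+1%:R) t =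
  (G n v t - G (n - j) (v + j%:R) t) + (G (n - j) (v + j%:R) t - G (n - j.+1) (v + j.+1%:R) t).
  by rewrite addrA subrK.
apply: le_trans (ler_normD _ _) _; apply: lerD; first exact: IH (ltnW jn).
have -> : v + j.+1%:R = v + j%:R + 1 by rewrite -addrA natr1.
have -> : (n - j = (n - j.+1).+1)%N by rewrite -subSn.
by apply: step; rewrite -subSn// subSS subnK// ltnW.
Qed.

Lemma harmonic_le n : (0 < n)%N -> \sum_(i < n) (i.+1%:R)^-1 <= L n.
Proof.
elim: n => // -[|n] IH _; first by rewrite big_ord1 /L ln1 addr0 invr1.
rewrite big_ord_recr/=; apply: le_trans (lerD (IH isT) (lexx _)) _.
rewrite /L -addrA lerD2l -lerBrDl.
have n1 : 0 < n.+1%:R :> R by rewrite ltr0n.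
have n2 : 0 < n.+2%:R :> R by rewrite ltr0n.
have := @le_ln1Dx R (- (n.+2%:R)^-1).
have -> : 1 + - n.+2%:R^-1 = n.+1%:R / n.+2%:R :> R.
  have -> : n.+1%:R = n.+2%:R - 1 :> R by rewrite -[n.+2%:R]natr1 addrK.
  by rewrite mulrBl divff ?gt_eqF// mul1r.
rewrite ln_div ?posrE// => H.
rewrite -[leLHS]opprK lerNl opprB.
by apply: H; rewrite ltrN2 invf_lt1// ltr1n.
Qed.

(** Telescoping: each term is at most 6 / sqrt w - 6 / sqrt(w + 1). The bound decays in v, which
    makes the feedback of the induction hypothesis small for a large smoothing variance. *)
Lemma sum_inv_sqrt3_le (v : R) n : 1 <= v ->
  \sum_(j < n) (Num.sqrt (v + j%:R) ^+ 3)^-1 <= 6 / Num.sqrt v.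
Proof.
move=> v1; suff H : \sum_(j < n) (Num.sqrt (v + j%:R) ^+ 3)^-1 <= 6 / Num.sqrt v - 6 / Num.sqrt (v + n%:R).
  by apply: le_trans H _; rewrite gerBl divr_ge0// sqrtr_ge0.
elim: n => [|n IH]; first by rewrite big_ord0 addr0 subrr.
rewrite big_ord_recr/=; apply: le_trans (lerD IH (lexx _)) _.
have w1 : 1 <= v + n%:R by rewrite (le_trans v1)// lerDl.
have -> : v + n.+1%:R = v + n%:R + 1 by rewrite -addrA natr1.
move: (v + n%:R) w1 => w w1; have w0 : 0 < w by exact: lt_le_trans w1.
set s := Num.sqrt w; set S := Num.sqrt (w + 1).
have s0 : 0 < s by rewrite sqrtr_gt0.
have S0 : 0 < S by rewrite sqrtr_gt0 addr_gt0.
have ss : s ^+ 2 = w by rewrite sqr_sqrtr// ltW.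
have SS : S ^+ 2 = s ^+ 2 + 1 by rewrite ss sqr_sqrtr// addr_ge0// ltW.
have sS : s <= S by rewrite ler_wsqrtr// lerDl.
suff : (s ^+ 3)^-1 <= 6 / s - 6 / S by lra.
have -> : 6 / s - 6 / S = 6 / (s * S * (S + s)).
  apply/eqP; rewrite -subr_eq0; apply/eqP.
  have -> : 6 / s - 6 / S - 6 / (s * S * (S + s)) = 6 * (S ^+ 2 - s ^+ 2 - 1) / (s * S * (S + s)).
    by field; rewrite !gt_eqF// addr_gt0.
  by rewrite SS; ring.
rewrite ler_pdivlMr ?mulr_gt0 ?addr_gt0// mulrC ler_pdivrMr ?exprn_gt0//.
have : S * (S + s) <= 4 * s ^+ 2.
  have : s ^+ 2 >= 1 by rewrite ss.
  by move: SS; rewrite !expr2; nra.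
by move=> H; rewrite !exprS expr0 mulr1; move: H; rewrite expr2; nra.
Qed.

(** The hypothesis on shorter sums enters through their concentration. The errors of size 1 / (j +
    1) sum to the logarithm, and the fed-back ones carry the small factor 1 / sqrt v. *)
Lemma lindeberg_sum n (K v : R) : (4 <= n)%N -> 0 <= K -> 1 <= v ->
  (forall m, (0 < m < n)%N -> forall t, `|F m t - N m t| <= K * L n / Num.sqrt m%:R) ->
  forall t, `|G n v t - Q (- t / Num.sqrt (v + n%:R))| <=
    C * (L n / Num.sqrt n%:R) * (42 + 24 * K / Num.sqrt v).
Proof.
move=> n4 K0 v1 IH t.
have n0 : (0 < n)%N by exact: leq_trans n4.
have sn0 := sqrtn_gt0 n0; set sn := Num.sqrt n%:R in sn0 *.
have L1 : 1 <= L n by rewrite lerDl ln_ge0// ler1n.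
(* The first two terms bound the early steps: 38 is 2 * 19, with 3 + 16 sw <= 19 sw because sw >= 1,
   and 4 is 2 * 2. The last term bounds the late steps. After summation 38 + 4 = 42 and 4 * 6 =
   24. *)
pose e j := C * (38 / (j.+1%:R * sn) + 4 * (K * L n) / (Num.sqrt (v + j%:R) ^+ 3 * sn) + 4 / (n%:R * sn)).
rewrite -smoothed_cdf0.
apply: le_trans (lindeberg_telescope (e := e) _) _.
- move=> m j mjn; set w := v + j%:R.
  have w1 : 1 <= w by rewrite (le_trans v1)// lerDl.
  have w0 : 0 < w by exact: lt_le_trans w1.
  have sw0 : 0 < Num.sqrt w by rewrite sqrtr_gt0.
  set sw := Num.sqrt w in sw0 *.
  have sw2 : sw ^+ 2 = w by rewrite sqr_sqrtr// ltW.
  have jw : j.+1%:R <= w by rewrite -natr1 addrC /w lerD2r.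
  have j0 : 0 < j.+1%:R :> R by rewrite ltr0n.
  have nr0 : 0 < n%:R :> R by rewrite ltr0n.
  (* In an early step n <= 4 m, by [4 <= n], so 1 / sqrt m <= 2 / sqrt n and the induction
     hypothesis gives concentration. In a late step the smoothing variance is at least n / 2, and
     the trivial concentration bound 1 is enough. *)
  have [jn|nj] := leqP (2 * j) n.
  + have m0 : (0 < m)%N by move: mjn jn n4; clear; lia.
    have mn : (m < n)%N by move: mjn; clear; lia.
    have sm0 := sqrtn_gt0 m0; set sm := Num.sqrt m%:R in sm0 *.
    have smn : sm^-1 <= 2 / sn.
      rewrite -[2]invrK -invfM lef_pV2 ?posrE ?mulr_gt0 ?invr_gt0//.
      rewrite mulrC ler_pdivrMr// -(@ler_sqr R) ?nnegrE ?mulr_ge0 ?(ltW sm0) ?(ltW sn0)//.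
      rewrite exprMn !sqr_sqrtr// -natrX -natrM ler_nat; move: mjn jn n4; clear; lia.
    have conc := concentration_of_cdf (normal_cdf_lipschitz m0) (IH m _).
    have a0 : 0 <= 2 * sm^-1 by rewrite mulr_ge0// invr_ge0 ltW.
    have d0 : 0 <= sm^-1 + 2 * (K * L n / sm).
      by rewrite addr_ge0 ?invr_ge0 ?(ltW sm0)// !mulr_ge0 ?invr_ge0 ?(ltW sm0)// (le_trans ler01).
    apply: le_trans (lindeberg_step nuS int1 mean0 int2 var1 intw t w1 a0 d0 (conc _)) _.
      by rewrite m0 mn.
    rewrite -/M -/sw.
    have KL0 : 0 <= K * L n by rewrite mulr_ge0// (le_trans ler01).
    have bnd : 2 * sm^-1 + 8 * (2 * sm^-1) * sw + (sm^-1 + 2 * (K * L n / sm)) <=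
       (19 * sw + 2 * (K * L n)) * (2 / sn).
      have -> : 2 * sm^-1 + 8 * (2 * sm^-1) * sw + (sm^-1 + 2 * (K * L n / sm)) =
        (3 + 16 * sw + 2 * (K * L n)) * sm^-1 by ring.
      apply: ler_pM => //; rewrite ?invr_ge0 ?(ltW sm0)//.
        by lra.
      have : 1 <= sw by rewrite /sw -[leLHS]sqrtr1 ler_wsqrtr.
      by lra.
    have g0 : 0 <= gauss_env / sw ^+ 3 by rewrite divr_ge0 ?exprn_ge0 ?(ltW sw0)// ltW// gauss_env_gt0.
    apply: le_trans (ler_wpM2l g0 (ler_wpM2r M0 bnd)) _.
    have -> : gauss_env / sw ^+ 3 * ((19 * sw + 2 * (K * L n)) * (2 / sn) * M) =
       C * (38 / (sw ^+ 2 * sn) + 4 * (K * L n) / (sw ^+ 3 * sn)).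
      by rewrite /C; field; rewrite !gt_eqF.
    rewrite /e ler_wpM2l// -/w -/sw -[leLHS]addr0 lerD//; last by rewrite divr_ge0// mulr_ge0 ?(ltW sn0) ?(ltW nr0).
    rewrite lerD2r sw2 ler_wpM2l// lef_pV2 ?posrE ?mulr_gt0//.
    by rewrite ler_wpM2r ?(ltW sn0).
  + have conc (b r : R) : 0 <= r -> (nu m [set w | (`|w - b| <= r)%R] <= (0 * r + 1)%:E)%E.
      move=> r0; rewrite mul0r add0r; apply: probability_le1.
      rewrite (_ : [set w | _] = `[b - r, b + r]%classic); first exact: measurable_itv.
      by apply/seteqP; split => y /=; rewrite in_itv/= ler_norml; lra.
    apply: le_trans (lindeberg_step nuS int1 mean0 int2 var1 intw t w1 (lexx _) ler01 conc) _.
    rewrite -/M -/sw mulr0 mul0r !add0r mul1r.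
    have -> : gauss_env / sw ^+ 3 * M = C * (sw ^+ 3)^-1 by rewrite /C; ring.
    rewrite /e ler_wpM2l// -[leLHS]add0r lerD//.
      rewrite addr_ge0// divr_ge0 ?mulr_ge0 ?exprn_ge0 ?sqrtr_ge0// ?(ltW sn0) ?(ltW j0)//.
      by rewrite (le_trans ler01).
    have wn : n%:R <= 2 * w.
      apply: (@le_trans _ _ ((2 * j)%N%:R)); first by rewrite ler_nat ltnW.
      by rewrite natrM /w; have := v1; lra.
    have snw : sn <= 2 * sw.
      rewrite -(@ler_sqr R) ?nnegrE ?mulr_ge0 ?(ltW sw0) ?(ltW sn0)//.
      by rewrite exprMn sw2 /sn sqr_sqrtr//; lra.
    rewrite -[4]invrK -invfM lef_pV2 ?posrE ?exprn_gt0 ?mulr_gt0 ?invr_gt0//.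
    have : n%:R * sn <= (2 * w) * (2 * sw) by apply: ler_pM => //; rewrite ltW.
    by rewrite exprS -/sw sw2; lra.
- have -> : \sum_(j < n) e j = C / sn * (38 * \sum_(j < n) (j.+1%:R)^-1 +
     4 * (K * L n) * \sum_(j < n) (Num.sqrt (v + j%:R) ^+ 3)^-1 + 4).
    have nn : n%:R != 0 :> R by rewrite pnatr_eq0 -lt0n.
    have E4 : \sum_(j < n) (4 / n%:R) = 4 :> R.
      by rewrite sumr_const card_ord -[_ *+ n]mulr_natr divfK.
    rewrite -[X in C / sn * (_ + X)]E4.
    rewrite !mulr_sumr -!big_split/= mulr_sumr; apply: eq_bigr => j _.
    rewrite /e; field; rewrite nn !gt_eqF// ?sqrtr_gt0 ?ltr0n//.
    by rewrite (lt_le_trans ltr01)// (le_trans v1)// lerDl.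
  have H1 := harmonic_le n0; have H2 := sum_inv_sqrt3_le n v1.
  have KL0 : 0 <= 4 * (K * L n) by rewrite !mulr_ge0// (le_trans ler01).
  have H3 := ler_wpM2l KL0 H2.
  have -> : C * (L n / sn) * (42 + 24 * K / Num.sqrt v) =
     C / sn * (42 * L n + 4 * (K * L n) * (6 / Num.sqrt v)).
    by ring.
  by rewrite ler_wpM2l ?divr_ge0 ?(ltW sn0)//; lra.
Qed.

(** Strong induction on n with one constant K. The hypothesis returns as 24 C K / sqrt v, so v is
    fixed first, independently of n, and K is chosen afterwards in terms of v. *)
Theorem berry_esseen_log : exists K : R, forall n, (0 < n)%N -> forall t,
  `|F n t - N n t| <= K * L n / Num.sqrt n%:R.
Proof.
(* With sqrt v >= 96 C the fed-back term is at most K / 4, hence K / 2 after the factor 2 of the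
   desmoothing. *)
pose N0 := (Num.bound ((96 * C) ^+ 2)).+1.
pose v : R := N0%:R; have v1 : 1 <= v by rewrite ler1n.
have v0 : 0 < v by exact: lt_le_trans v1.
have sv0 : 0 < Num.sqrt v by rewrite sqrtr_gt0.
have svC : 96 * C <= Num.sqrt v.
  have c0 : 0 <= 96 * C by rewrite mulr_ge0.
  rewrite -(@ler_sqr R) ?nnegrE ?sqrtr_ge0// (sqr_sqrtr (ltW v0)).
  apply: le_trans (ltW (archi_boundP (sqr_ge0 _))) _.
  by rewrite /v /N0 ler_nat leqnSn.
have g0 := ltW (@gauss_env_gt0 R).
(* Half of K covers the terms without K: 2 * 42 C, 2 [gauss_env] v from discarding v, and 2 * 3 sqrt
   v from the desmoothing. The final 2 settles n < 4, where sqrt n <= 2. *)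
pose K := 2 * (84 * C + 2 * gauss_env * v + 6 * Num.sqrt v) + 2.
have K2 : 2 <= K by rewrite /K; have := mulr_ge0 g0 (ltW v0); have := C0; lra.
have K0 : 0 <= K by lra.
exists K; elim/ltn_ind => n IH n0 t.
have sn0 := sqrtn_gt0 n0; set sn := Num.sqrt n%:R in sn0 *.
have L1 : 1 <= L n by rewrite lerDl ln_ge0// ler1n.
have FN1 m x : `|F m x - N m x| <= 1.
  have := cdf_of_ge0 (nu m) x; have := cdf_of_le1 (nu m) x.
  have := Qfun_ge0 (- x / Num.sqrt m%:R); have := Qfun_le1 (- x / Num.sqrt m%:R).
  by rewrite ler_norml /F /N; lra.
have [n4|n4] := ltnP n 4.
  apply: le_trans (FN1 n t) _; rewrite ler_pdivlMr// mul1r.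
  have sn2 : sn <= 2.
    rewrite -(@ler_sqr R) ?nnegrE ?(ltW sn0)// sqr_sqrtr// -natrX ler_nat.
    exact: ltnW.
  by apply: le_trans sn2 _; apply: le_trans K2 _; rewrite ler_peMr.
have IH' m : (0 < m < n)%N -> forall t, `|F m t - N m t| <= K * L n / Num.sqrt m%:R.
  move=> /andP[m0 mn] x; apply: le_trans (IH m mn m0 x) _.
  rewrite ler_wpM2r ?invr_ge0 ?sqrtr_ge0// ler_wpM2l// lerD2l ler_ln ?posrE ?ltr0n//.
  by rewrite ler_nat ltnW.
pose tau := C * (L n / sn) * (42 + 24 * K / Num.sqrt v) + gauss_env * v / n%:R.
have Htau x : `|\int[nu n]_w Q ((w - x) / Num.sqrt v) - N n x| <= tau.
  have := lindeberg_sum n4 K0 v1 IH' x; have := Qfun_variance (- x) (_ : 0 < n%:R :> R) (ltW v0).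
  rewrite ltr0n n0 => /(_ isT); rewrite [n%:R + v]addrC /N /tau -/(G n v x) -/sn.
  set X := G n v x; set Y := Q _; set Z := Q _ => h1 h2.
  apply: le_trans (_ : `|(X - Y) + (Y - Z)| <= _); first by rewrite addrA subrK.
  by apply: le_trans (ler_normD _ _) _; apply: lerD.
(* The supremum is finite as both functions lie in [0, 1]. Desmoothing bounds it in terms of itself,
   D <= (4/3) X + D / 3, which is solved as D <= 2 X. *)
pose D := sup [set `|F n x - N n x| | x in [set: R]].
have ubD : has_ubound [set `|F n x - N n x| | x in [set: R]].
  by exists 1 => _ [x _ <-]; exact: FN1.
have FD x : `|F n x - N n x| <= D by apply: ub_le_sup => //; exists x.
have il0 : 0 <= sn^-1 by rewrite invr_ge0 ltW.
have Hd := desmoothing sv0 il0 (normal_cdf_lipschitz n0) FD Htau.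
have DD : D <= 4 / 3 * (tau + 3 * sn^-1 * Num.sqrt v) + D / 3.
  apply: ge_sup; first by exists `|F n 0 - N n 0|; exists 0.
  by move=> _ [x _ <-]; exact: Hd.
have {}DD : D <= 2 * (tau + 3 * sn^-1 * Num.sqrt v) by lra.
apply: le_trans (FD t) _; apply: le_trans DD _.
have n0r : 0 < n%:R :> R by rewrite ltr0n.
have nsn : n%:R^-1 <= sn^-1.
  rewrite lef_pV2 ?posrE// -(@ler_sqr R) ?nnegrE ?(ltW sn0)// sqr_sqrtr//.
  by rewrite -natrX ler_nat -mulnn leq_pmulr.
have KC : 24 * C * K / Num.sqrt v <= K / 4.
  by rewrite ler_pdivrMr//; have := ler_wpM2l K0 svC; lra.
have e1 : gauss_env * v / n%:R <= gauss_env * v * (L n / sn).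
  rewrite ler_wpM2l ?mulr_ge0 ?(ltW v0)// (le_trans nsn)// -[leLHS]mul1r ler_wpM2r//.
have e2 : 3 * sn^-1 * Num.sqrt v <= 3 * Num.sqrt v * (L n / sn).
  rewrite mulrAC ler_wpM2l ?mulr_ge0 ?(ltW sv0)// -[leLHS]mul1r ler_wpM2r//.
rewrite /tau -[leRHS]mulrA; set q := L n / sn.
have q0 : 0 <= q by rewrite divr_ge0 ?(ltW sn0)// (le_trans ler01).
have : C * q * (42 + 24 * K / Num.sqrt v) = (42 * C + 24 * C * K / Num.sqrt v) * q by ring.
move=> ->; have := ler_wpM2r q0 KC; rewrite -/q in e1 e2.
have : K * q = (2 * (84 * C + 2 * gauss_env * v + 6 * Num.sqrt v) + 2) * q by [].
have := mulr_ge0 K0 q0; lra.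
Qed.

End BerryEsseen.

(** * Logarithmic moments of the fading *)

Section FadingMoments.
Context {R : realType}.
Local Notation leb := (@lebesgue_measure R).

Lemma integral_powR_lty (b : R) : 0 < b ->
  (\int[leb]_(h in `]0%R, 1%R]) (h `^ (b - 1))%:E < +oo)%E.
Proof.
move=> b0; pose I (n : nat) := `[(n.+1%:R^-1 : R), 1]%classic.
have IE : `]0, 1]%classic = \bigcup_n I n.
  apply/seteqP; split => x; rewrite /I/= in_itv/=.
    move=> /andP[x0 x1]; have nx := archi_boundP (ltW (_ : 0 < x^-1)).
    have {}nx := nx (_ : 0 < x^-1); rewrite invr_gt0 in nx; have {}nx := nx x0.
    exists (Num.bound x^-1) => //=; rewrite in_itv/= x1 andbT.
    rewrite -[leRHS]invrK lef_pV2 ?posrE ?invr_gt0//.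
    by rewrite (le_trans (ltW nx))// ler_nat.
  by move=> [n _]; rewrite /= in_itv/= => /andP[nx ->]; rewrite (lt_le_trans _ nx)// invr_gt0 ltr0n.
have cvgI : (\int[leb]_(h in I n) (h `^ (b - 1))%:E @[n --> \oo] -->
    \int[leb]_(h in `]0%R, 1%R]) (h `^ (b - 1))%:E)%E.
  rewrite IE; apply: ge0_nondecreasing_set_cvg_integral.
  - move=> m n mn; rewrite subsetEset => x; rewrite /I/= !in_itv/= => /andP[xa ->].
    by rewrite (le_trans _ xa)// lef_pV2 ?posrE// ler_nat.
  - by move=> n; exact: measurable_itv.
  - move=> n; apply/measurable_EFinP/measurable_funTS; exact: measurable_powR.
  - by move=> n x _; rewrite lee_fin powR_ge0.
have bnd n : (\int[leb]_(h in I n) (h `^ (b - 1))%:E <= (b^-1)%:E)%E.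
  have n0 : 0 < n.+1%:R^-1 :> R by rewrite invr_gt0.
  have DF (x : R) : 0 < x -> is_derive x 1 (fun h => b^-1 * h `^ b) (x `^ (b - 1)).
    move=> x0; have D1 := is_derive1_powR b x0.
    by apply: is_derive_eq; rewrite /GRing.scale/= mulrA mulVf ?gt_eqF ?mul1r.
  (* For n = 0 the interval degenerates to the point 1, outside the scope of the fundamental
     theorem. *)
  have [n1|n1] := ltP (n.+1%:R^-1 : R) 1; last first.
    rewrite [X in (X <= _)%E](_ : _ = 0%E) ?lee_fin ?invr_ge0 ?(ltW b0)//.
    apply: (integral_Sset1 1) => x; rewrite /I/= in_itv/= => /andP[h1 h2].
    by apply/eqP; rewrite eq_le h2 (le_trans n1).
  rewrite (@continuous_FTC2 _ _ (fun h => b^-1 * h `^ b))//.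
  - rewrite powR1 mulr1 -EFinB lee_fin gerBl mulr_ge0 ?powR_ge0 ?invr_ge0 ?(ltW b0)//.
  - apply: continuous_in_subspaceT => x; rewrite inE/= in_itv/= => /andP[x0 _].
    have x00 : 0 < x by exact: lt_le_trans x0.
    apply: differentiable_continuous; apply/derivable1_diffP.
    by have [] := is_derive1_powR (b - 1) x00.
  - have cF (x : R) : 0 < x -> {for x, continuous (fun h => b^-1 * h `^ b)}.
      move=> x0; apply: differentiable_continuous; apply/derivable1_diffP.
      by have [] := DF _ x0.
    split.
    + move=> x; rewrite in_itv/= => /andP[x0 _].
      by have [] := DF _ (lt_trans n0 x0).
    + exact: cvg_at_right_filter (cF _ n0).
    + exact: cvg_at_left_filter (cF _ ltr01).
  - move=> x; rewrite in_itv/= => /andP[x0 _]; rewrite derive1E.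
    by have [_ ->] := DF _ (lt_trans n0 x0).
apply: (@le_lt_trans _ _ (b^-1)%:E); last exact: ltry.
rewrite -(cvg_lim _ cvgI)//; apply: lime_le; first by apply/cvg_ex; eexists; exact: cvgI.
by apply: nearW.
Qed.

(** The fourth-order term of the exponential series at -a ln h >= 0. *)
Lemma ln_pow4_le (a h : R) : 0 < a -> 0 < h <= 1 ->
  ln h ^+ 4 <= 24 / a ^+ 4 * h `^ (- a).
Proof.
move=> a0 /andP[h0 h1]; rewrite /powR gt_eqF// mulNr -mulrN.
have y0 : 0 <= - ln h by rewrite oppr_ge0 ln_le0.
have H : 1 + a ^+ 4 * ln h ^+ 4 / 24 <= expR (a * - ln h).
  have := expR_ge1Dxn 3 (mulr_ge0 (ltW a0) y0); rewrite exprMn.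
  by rewrite (_ : (- ln h) ^+ 4 = ln h ^+ 4)// exprNn -signr_odd /= expr0 mul1r.
move: H => H; rewrite mulrAC ler_pdivlMr ?exprn_gt0// mulrC.
by move: (expR _) H => E; lra.
Qed.

Lemma ln_pow4_ge1 (h : R) : 1 <= h -> ln h ^+ 4 <= 16 * h ^+ 2.
Proof.
move=> h1; have h0 : 0 < h by exact: lt_le_trans h1.
have s0 : 0 < Num.sqrt h by rewrite sqrtr_gt0.
have s2 : Num.sqrt h ^+ 2 = h by rewrite sqr_sqrtr// ltW.
have l0 : 0 <= ln h by rewrite ln_ge0.
have lh : ln h <= 2 * Num.sqrt h.
  rewrite (_ : ln h = 2 * ln (Num.sqrt h)); last by rewrite -[in LHS]s2 lnXn// mulr_natl.
  have L1 : -1 < Num.sqrt h - 1 by lra.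
  by have := le_ln1Dx L1; rewrite addrC subrK; lra.
have -> : 16 * h ^+ 2 = (2 * Num.sqrt h) ^+ 4.
  by rewrite -[in LHS]s2; ring.
by rewrite lerXn2r ?nnegrE ?mulr_ge0// ltW.
Qed.

(* The only use of the regularity of the fading density near 0. *)
Lemma fading_ln4_lty (f : R -> R) : regular_fading_pdf f ->
  (\int[leb]_h (f h * ln h ^+ 4)%:E < +oo)%E.
Proof.
move=> [mf [f0 [fneg [f1 [f2 [al [c [eta [al0 [c0 [eta0 fE]]]]]]]]]]].
pose e := Num.min eta 1; have e0 : 0 < e by rewrite lt_min eta0 ltr01.
have e1 : e <= 1 by rewrite ge_min lexx orbT.
(* Half of the exponent is spent on ln^4, and h^(al/2 - 1) is still integrable at 0. *)
pose a := al / 2; have a0 : 0 < a by rewrite divr_gt0.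
pose k := c * (24 / a ^+ 4).
have k0 : 0 <= k by rewrite mulr_ge0 ?divr_ge0 ?exprn_ge0 ?(ltW c0) ?(ltW a0).
pose w h : \bar R := (k%:E * (((fun h => (h `^ (a - 1))%:E) \_ `]0%R, 1%R]) h))%E.
have w0 h : (0 <= w h)%E.
  by rewrite mule_ge0 ?lee_fin//; apply: erestrict_ge0 => x _; rewrite lee_fin powR_ge0.
have mw : measurable_fun setT w.
  apply: measurable_funeM; apply/(measurable_restrictT _ _).1; first exact: measurable_itv.
  apply/measurable_EFinP/measurable_funTS; exact: measurable_powR.
have l40 h : 0 <= ln h ^+ 4 :> R by rewrite (exprM _ 2 2) sqr_ge0.
(* Three ranges of positive h: below e the power law, between e and 1 the constant ln(e)^4, above 1
   the second moment. For h <= 0 the logarithm has the default value 0. *)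
apply: (@le_lt_trans _ _ (\int[leb]_h ((16%:E * (f h * h ^+ 2)%:E + (ln e ^+ 4)%:E * (f h)%:E) + w h)))%E.
  apply: lower_le_integral => h; first by rewrite lee_fin mulr_ge0.
  have base0 : 0 <= 16 * (f h * h ^+ 2) + ln e ^+ 4 * f h.
    by apply: addr_ge0; apply: mulr_ge0 => //; apply: mulr_ge0 => //; exact: sqr_ge0.
  have [h0|h0] := leP h 0.
    by rewrite ln0// expr0n/= mulr0 adde_ge0// -!EFinM -EFinD lee_fin.
  have [he|he] := ltP h e.
    have he1 : h <= 1 by rewrite (le_trans (ltW he)).
    apply: (@le_trans _ _ (w h)); last by rewrite leeDr// -!EFinM -EFinD lee_fin.
    rewrite /w patchE mem_set/=; last by rewrite in_itv/= h0.
    rewrite -EFinM lee_fin fE; last by rewrite h0 (lt_le_trans he)// ge_min lexx.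
    rewrite /k -!mulrA ler_wpM2l ?(ltW c0)//.
    apply: le_trans (ler_wpM2l (powR_ge0 _ _) (ln_pow4_le a0 (_ : 0 < h <= 1))) _; first by rewrite h0.
    rewrite mulrCA -!mulrA ler_wpM2l// ler_wpM2l ?invr_ge0 ?exprn_ge0 ?(ltW a0)//.
    rewrite -powRD; last by rewrite (gt_eqF h0) implybT.
    by rewrite (_ : al - 1 + - a = a - 1)// /a; field.
  apply: (@le_trans _ _ (16%:E * (f h * h ^+ 2)%:E + (ln e ^+ 4)%:E * (f h)%:E)%E); last by rewrite leeDl.
  rewrite -!EFinM -EFinD lee_fin [16 * _]mulrCA [ln e ^+ 4 * _]mulrC -mulrDr ler_wpM2l//.
  have [h1|h1] := leP 1 h; first by rewrite (le_trans (ln_pow4_ge1 h1))// lerDl.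
  apply: (@le_trans _ _ (ln e ^+ 4)); last by rewrite lerDr mulr_ge0// sqr_ge0.
  have H x : ln x ^+ 4 = (- ln x) ^+ 4 :> R by rewrite exprNn -signr_odd /= expr0 mul1r.
  rewrite H [leRHS]H lerXn2r ?nnegrE ?oppr_ge0 ?ln_le0// ?(ltW h1)//.
  by rewrite lerN2 ler_ln ?posrE.
have mf2 : measurable_fun setT (fun h => (f h * h ^+ 2)%:E).
  by apply/measurable_EFinP; apply: measurable_funM => //; exact: measurable_funX.
have mfE : measurable_fun setT (fun h => (f h)%:E) by exact/measurable_EFinP.
rewrite ge0_integralD; [|exact: measurableT| | |by move=> h _|exact: mw]; last 2 first.
- by move=> h _; rewrite -!EFinM -EFinD lee_fin; apply: addr_ge0; apply: mulr_ge0 => //; apply: mulr_ge0 => //; exact: sqr_ge0.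
- by apply: emeasurable_funD; exact: measurable_funeM.
rewrite ge0_integralD; [|exact: measurableT|by move=> h _; rewrite -EFinM lee_fin; apply: mulr_ge0 => //; apply: mulr_ge0 => //; exact: sqr_ge0
  |exact: measurable_funeM|by move=> h _; rewrite -EFinM lee_fin mulr_ge0|exact: measurable_funeM].
rewrite (@ge0_integralZl _ _ _ leb setT measurableT _ mf2); [|by move=> h _; rewrite lee_fin mulr_ge0 ?sqr_ge0|by rewrite lee_fin].
rewrite (@ge0_integralZl _ _ _ leb setT measurableT _ mfE); [|by move=> h _; rewrite lee_fin|by rewrite lee_fin].
rewrite f1 f2 !mule1 -EFinD lte_add_pinfty ?ltry//.
rewrite /w ge0_integralZl; [|exact: measurableT| | |by rewrite lee_fin]; last 2 first.
- apply/(measurable_restrictT _ _).1; first exact: measurable_itv.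
  apply/measurable_EFinP/measurable_funTS; exact: measurable_powR.
- by move=> h _; apply: erestrict_ge0 => x _; rewrite lee_fin powR_ge0.
rewrite -integral_mkcond; have := integral_powR_lty a0.
have : (0 <= \int[leb]_(h in `]0%R, 1%R]) (h `^ (a - 1))%:E)%E.
  by apply: integral_ge0 => h _; rewrite lee_fin powR_ge0.
case: (\int[leb]_(h in _) _)%E => // r _ _.
by rewrite -EFinM ltry.
Qed.

End FadingMoments.

Section LinearCombinations.
Context d (T : measurableType d) (R : realType) (mu : {measure set T -> \bar R}).

Lemma integrable_finite (u : T -> R) : measurable_fun setT u -> (forall x, 0 <= u x) ->
  (\int[mu]_x (u x)%:E < +oo)%E -> mu.-integrable setT (EFin \o u).
Proof.
move=> mu_ u0 I; apply/integrableP; split; first exact/measurable_EFinP.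
by under eq_integral => x _ do rewrite /= ger0_norm//.
Qed.

Lemma integral_lincomb (u v w : T -> R) (U V W a b c : R) :
  mu.-integrable setT (EFin \o u) -> mu.-integrable setT (EFin \o v) ->
  mu.-integrable setT (EFin \o w) ->
  (\int[mu]_x (u x)%:E = U%:E)%E -> (\int[mu]_x (v x)%:E = V%:E)%E ->
  (\int[mu]_x (w x)%:E = W%:E)%E ->
  (\int[mu]_x (a * u x + b * v x + c * w x)%:E = (a * U + b * V + c * W)%:E)%E.
Proof.
move=> iu iv iw uE vE wE.
have -> : (fun x => (a * u x + b * v x + c * w x)%:E) =
    (fun x => (a%:E * (EFin \o u) x + b%:E * (EFin \o v) x) + c%:E * (EFin \o w) x)%E.
  by apply/funext => x /=; rewrite -!EFinM -!EFinD.
rewrite integralD//; [|apply: integrableD => //; exact: integrableZl|exact: integrableZl].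
rewrite integralD//; [|exact: integrableZl|exact: integrableZl].
by rewrite !integralZl//= uE vE wE.
Qed.

End LinearCombinations.

Lemma pow4_ge0 (R : realType) (x : R) : 0 <= x ^+ 4.
Proof. by rewrite (exprM _ 2 2) sqr_ge0. Qed.

Lemma pow4D_le (R : realType) (x y : R) : (x + y) ^+ 4 <= 8 * (x ^+ 4 + y ^+ 4).
Proof.
have D2 (a b : R) : (a + b) ^+ 2 <= 2 * (a ^+ 2 + b ^+ 2) by have := sqr_ge0 (a - b); nra.
rewrite !(exprM _ 2 2); have H := D2 x y.
have := D2 (x ^+ 2) (y ^+ 2); have := sqr_ge0 (x + y).
move: ((x + y) ^+ 2) H => S H S0 H2.
have : S ^+ 2 <= (2 * (x ^+ 2 + y ^+ 2)) ^+ 2 by rewrite lerXn2r ?nnegrE ?(le_trans S0 H).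
by rewrite exprMn; lra.
Qed.

Lemma cube_weight_le (R : realType) (x : R) :
  (1 + `|x| ^+ 3) * (1 + `|x|) <= 4 * (1 + x ^+ 4).
Proof.
have -> : x ^+ 4 = `|x| ^+ 4 by rewrite -normrX ger0_norm// pow4_ge0.
have := normr_ge0 x; move: `|x| => y y0.
have e : 4 * (1 + y ^+ 4) - (1 + y ^+ 3) * (1 + y) =
  (y - 1) ^+ 2 * (y ^+ 2 + y + 1) + 2 * (1 + y ^+ 4) by ring.
rewrite -subr_ge0 e addr_ge0// mulr_ge0 ?sqr_ge0 ?addr_ge0 ?sqr_ge0 ?pow4_ge0//.
Qed.

(* Mean and variance are read off from integrals of the nonnegative functions
   x ^ 2 and (x + 1) ^ 2, so that no signed change of variables is needed. *)
Lemma moments_of_shifts (R : realType) (mu : probability R R) :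
  (\int[mu]_x ((x ^+ 2)%:E) = 1)%E -> (\int[mu]_x (((x + 1) ^+ 2)%:E) = 2%:E)%E ->
  (\int[mu]_x (x ^+ 4)%:E < +oo)%E ->
  [/\ mu.-integrable setT (EFin \o (fun x : R => x)), \int[mu]_x x = 0,
      mu.-integrable setT (EFin \o (fun x : R => x ^+ 2)), \int[mu]_x (x ^+ 2) = 1 &
      mu.-integrable setT (EFin \o (fun x : R => (1 + `|x| ^+ 3) * (1 + `|x|)))].
Proof.
move=> m2 m2' m4.
have mX k : measurable_fun setT (fun x : R => x ^+ k) by exact: measurable_funX.
have i0 : mu.-integrable setT (EFin \o (fun x : R => (1 : R))).
  by apply: (@integrable_bounded _ _ _ _ _ 1) => // x; rewrite normr1.
have i4 := integrable_finite (mX 4%N) (@pow4_ge0 R) m4.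
have iw4 : mu.-integrable setT (EFin \o (fun x : R => 4 * (1 + x ^+ 4))).
  have -> : EFin \o (fun x : R => 4 * (1 + x ^+ 4)) =
      (fun x => 4%:E * ((EFin \o (fun x : R => (1%R : R))) \+ (EFin \o (fun x : R => (x ^+ 4)%R))) x)%E.
    by apply/funext => x /=; rewrite -EFinD -EFinM.
  by apply: integrableZl => //; exact: integrableD.
have dom (u : R -> R) : measurable_fun setT u -> (forall x, `|u x| <= 4 * (1 + x ^+ 4)) ->
    mu.-integrable setT (EFin \o u).
  move=> mu_ H; apply: (le_integrable measurableT _ _ iw4); first exact/measurable_EFinP.
  by move=> x _ /=; rewrite lee_fin (le_trans (H x))// ler_norm.
have i1 : mu.-integrable setT (EFin \o (fun x : R => x)).
  apply: dom => // x; rewrite (le_trans _ (cube_weight_le x))//.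
  have := normr_ge0 x; rewrite mulrDr mulr1 => y0.
  by rewrite mulrDl mul1r addrC -addrA lerDl addr_ge0// addr_ge0// mulr_ge0 ?exprn_ge0.
have i2 : mu.-integrable setT (EFin \o (fun x : R => x ^+ 2)).
  apply: dom => // x; rewrite ger0_norm ?sqr_ge0// (exprM _ 2 2).
  by have := sqr_ge0 (x ^+ 2 - 1); have := sqr_ge0 (x ^+ 2); move: (x ^+ 2) => y; nra.
have iw : mu.-integrable setT (EFin \o (fun x : R => (1 + `|x| ^+ 3) * (1 + `|x|))).
  apply: dom => [|x].
    have mn : measurable_fun setT (fun x : R => `|x|) by exact: measurableT_comp.
    by apply: measurable_funM; apply: measurable_funD => //; exact: measurable_funX.
  by rewrite ger0_norm ?cube_weight_le// mulr_ge0 ?addr_ge0 ?exprn_ge0.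
have e0 : (\int[mu]_x 1 = 1%:E)%E by rewrite integral_cst//= probability_setT mule1.
have mean : (\int[mu]_x x%:E = 0)%E.
  have [r rE] : exists r : R, (\int[mu]_x x%:E = r%:E)%E.
    by exists (fine (\int[mu]_x x%:E)); rewrite fineK//; exact: integrable_fin_num i1.
  have := integral_lincomb 1 2 1 i2 i1 i0 m2 rE e0.
  rewrite (_ : (fun x : R => _) = (fun x : R => ((x + 1) ^+ 2)%:E)); last first.
    by apply/funext => x; congr EFin; ring.
  by rewrite m2' rE => -[]; move=> H; congr EFin; lra.
split => //; first by rewrite /Rintegral mean.
by rewrite /Rintegral m2.
Qed.

(** * Mean, variance and normal approximation of the log-density *)

Section LogDensityMoments.
Context {R : realType}.
Variables (f : R -> R) (sigma : R).
Hypothesis rf : regular_fading_pdf f.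
Hypothesis sigma0 : 0 < sigma.
Local Notation leb := (@lebesgue_measure R).
Local Notation m := (delta_star f sigma).
Local Notation V := (disp_V f sigma).
Local Notation delta := (delta_H sigma).

Let mf : measurable_fun setT f. Proof. by case: rf. Qed.
Let f0 x : 0 <= f x. Proof. by case: rf => _ []. Qed.
Let fneg x : x < 0 -> f x = 0. Proof. by case: rf => _ [_ [H _]]; exact: H. Qed.
Let f1 : (\int[leb]_x (f x)%:E = 1)%E. Proof. by case: rf => _ [_ [_ [H _]]]. Qed.

Lemma measurable_delta_H : measurable_fun setT delta.
Proof.
apply: measurable_funM => //; apply: measurableT_comp => //.
by apply: measurable_funM => //; exact: measurable_funX.
Qed.

Lemma delta_HE h : 0 < h -> delta h = ln h - 2^-1 * ln (2 * pi * expR 1 * sigma ^+ 2).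
Proof.
move=> h0; have k0 : 0 < 2 * pi * expR 1 * sigma ^+ 2 :> R.
  by rewrite !mulr_gt0 ?pi_gt0 ?expR_gt0 ?exprn_gt0.
rewrite /delta_H ln_div ?posrE ?exprn_gt0// lnXn// mulrBr; congr (_ - _).
by field.
Qed.

Lemma integrable_fading (u : R -> R) (A B : R) : measurable_fun setT u -> 0 <= A -> 0 <= B ->
  (forall h, `|u h| <= A + B * delta h ^+ 4) ->
  leb.-integrable setT (EFin \o (fun h => f h * u h)).
Proof.
move=> mu_ A0 B0 H; pose c := 2^-1 * ln (2 * pi * expR 1 * sigma ^+ 2).
have if_ : leb.-integrable setT (EFin \o f) by apply: integrable_finite; rewrite ?f1 ?ltry.
have il : leb.-integrable setT (EFin \o (fun h => f h * ln h ^+ 4)).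
  apply: integrable_finite; last exact: fading_ln4_lty.
    by apply: measurable_funM => //; apply: measurable_funX; exact: measurable_ln.
  by move=> x; rewrite mulr_ge0 ?pow4_ge0.
(* The density may be nonzero at h = 0, where [delta] takes a default value; this is why the
   dominating function carries [delta 0]. *)
pose G h := (A + B * (8 * c ^+ 4 + delta 0 ^+ 4)) * f h + B * 8 * (f h * ln h ^+ 4).
have iG : leb.-integrable setT (EFin \o G).
  have -> : EFin \o G = ((fun h => (A + B * (8 * c ^+ 4 + delta 0 ^+ 4))%:E * (EFin \o f) h) \+
     (fun h => (B * 8)%:E * (EFin \o (fun h => f h * ln h ^+ 4)%R) h))%E.
    by apply/funext => h.
  by apply: integrableD => //; exact: integrableZl.
apply: (le_integrable measurableT _ _ iG).
  by apply/measurable_EFinP; exact: measurable_funM.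
move=> h _ /=; rewrite lee_fin; apply: le_trans (ler_norm _).
rewrite normrM ger0_norm// /G.
have H1 := ler_wpM2l (f0 h) (H h); apply: le_trans H1 _.
have P4 (x : R) := pow4_ge0 x.
have [h0|h0|->] := ltgtP h 0.
- by rewrite fneg// !mul0r !mulr0 addr0.
- rewrite delta_HE// -/c; have := pow4D_le (ln h) (- c).
  rewrite [(- c) ^+ 4]exprNn -signr_odd /= expr0 mul1r => D.
  have := ler_wpM2l (mulr_ge0 (f0 h) B0) D.
  have := mulr_ge0 (mulr_ge0 B0 (P4 (delta 0))) (f0 h).
  by move: (delta 0 ^+ 4) (c ^+ 4) (ln h ^+ 4) ((ln h - c) ^+ 4) => *; lra.
- have := mulr_ge0 (mulr_ge0 B0 (P4 c)) (f0 0); have := mulr_ge0 (mulr_ge0 B0 (P4 (ln 0))) (f0 0).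
  by move: (delta 0 ^+ 4) (c ^+ 4) (ln 0 ^+ 4) => *; lra.
Qed.

Lemma integrable_f : leb.-integrable setT (EFin \o (fun h => f h)).
Proof. by apply: integrable_finite; rewrite ?f1 ?ltry. Qed.

Lemma integrable_fading_delta : leb.-integrable setT (EFin \o (fun h => f h * (delta h - m))).
Proof.
apply: (@integrable_fading _ (1 + `|m|) 1).
- by apply: measurable_funB => //; exact: measurable_delta_H.
- by rewrite addr_ge0.
- by [].
- move=> h; apply: le_trans (ler_normB _ _) _; rewrite mul1r addrAC lerD2r.
  move: (delta h) => y; rewrite (exprM _ 2 2).
  have := sqr_ge0 (y ^+ 2 - 1); have := sqr_ge0 (y ^+ 2); rewrite -[y ^+ 2]real_normK ?num_real//.
  by move: `|y| => t; have := sqr_ge0 (t - 1); nra.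
Qed.

Lemma integrable_fading_delta2 :
  leb.-integrable setT (EFin \o (fun h => f h * (delta h - m) ^+ 2)).
Proof.
apply: (@integrable_fading _ (1 + 8 * m ^+ 4) 8).
- by apply: measurable_funX; apply: measurable_funB => //; exact: measurable_delta_H.
- by rewrite addr_ge0// mulr_ge0// pow4_ge0.
- by [].
- move=> h; rewrite ger0_norm ?sqr_ge0//.
  have := pow4D_le (delta h) (- m); rewrite [(- m) ^+ 4]exprNn -signr_odd /= expr0 mul1r.
  have : (delta h - m) ^+ 2 <= 1 + (delta h - m) ^+ 4.
    by rewrite [_ ^+ 4](exprM _ 2 2); move: (_ ^+ 2) => t; have := sqr_ge0 (t - 1); have := sqr_ge0 t; nra.
  by move: (delta h ^+ 4) ((delta h - m) ^+ 4) ((delta h - m) ^+ 2) (m ^+ 4) => *; lra.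
Qed.

Lemma fading_delta_mean : (\int[leb]_h (f h * (delta h - m))%:E = 0)%E.
Proof.
have i1 : leb.-integrable setT (EFin \o (fun h => f h * delta h)).
  apply: (@integrable_fading _ 1 1) => //; first exact: measurable_delta_H.
  move=> h; rewrite mul1r.
  move: (delta h) => y; rewrite (exprM _ 2 2).
  have := sqr_ge0 (y ^+ 2 - 1); have := sqr_ge0 (y ^+ 2); rewrite -[y ^+ 2]real_normK ?num_real//.
  by move: `|y| => t; have := sqr_ge0 (t - 1); nra.
have mE : (\int[leb]_h (f h * delta h)%:E = m%:E)%E.
  by rewrite /delta_star /expect fineK//; exact: integrable_fin_num i1.
have := integral_lincomb 1 (- m) 0 i1 integrable_f integrable_f mE f1 f1.
rewrite (_ : (fun x => _) = (fun h => (f h * (delta h - m))%:E)); last first.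
  by apply/funext => h; congr EFin; ring.
by move=> ->; congr EFin; ring.
Qed.

Lemma fading_delta_var : (\int[leb]_h (f h * (delta h - m) ^+ 2)%:E = (V - 2^-1)%:E)%E.
Proof.
rewrite /disp_V addrC addKr /expect fineK//.
exact: integrable_fin_num integrable_fading_delta2.
Qed.

Lemma disp_V_ge : 2^-1 <= V.
Proof.
rewrite /disp_V lerDl /expect fine_ge0//; apply: integral_ge0 => h _.
by rewrite lee_fin mulr_ge0 ?sqr_ge0.
Qed.

(** Z^2 / (2 sigma^2) has mean 1/2 and second moment 3/4. At a = x + 1/2 the right side is x^2 +
    1/2, the source of the 1/2 in the dispersion. *)
Lemma normal_quadratic (a : R) :
  (\int[leb]_z (normal_pdf 0 sigma z * (a - z ^+ 2 / (2 * sigma ^+ 2)) ^+ 2)%:E =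
   (a ^+ 2 - a + 3 / 4)%:E)%E.
Proof.
have s0 : sigma != 0 by rewrite gt_eqF.
have g0 z : 0 <= normal_pdf 0 sigma z by exact: normal_pdf_ge0.
have mg k : measurable_fun setT (fun z : R => z ^+ k * normal_pdf 0 sigma z).
  by apply: measurable_funM; [exact: measurable_funX|exact: measurable_normal_pdf].
have i k : (forall z : R, 0 <= z ^+ k) ->
    (\int[leb]_z (z ^+ k * normal_pdf 0 sigma z)%:E < +oo)%E ->
    leb.-integrable setT (EFin \o (fun z => z ^+ k * normal_pdf 0 sigma z)).
  by move=> z0 fin; apply: integrable_finite; [exact: mg|move=> z; exact: mulr_ge0|exact: fin].
have M0 := normal_moment0 sigma; have M2 := normal_moment2 sigma0; have M4 := normal_moment4 sigma0.
have i0 := i 0%N (fun _ => ler01); have i2 := i 2%N (@sqr_ge0 R); have i4 := i 4%N (@pow4_ge0 R).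
rewrite M0 in i0; rewrite M2 in i2; rewrite M4 in i4.
have := integral_lincomb (a ^+ 2) (- a / sigma ^+ 2) ((4 * sigma ^+ 4)^-1)
  (i0 (ltry _)) (i2 (ltry _)) (i4 (ltry _)) M0 M2 M4.
rewrite (_ : (fun x => _) = (fun z => (normal_pdf 0 sigma z * (a - z ^+ 2 / (2 * sigma ^+ 2)) ^+ 2)%:E)); last first.
  by apply/funext => z; congr EFin; rewrite expr0; field.
by move=> ->; congr EFin; field.
Qed.

(* Equals ln h + ln (normal_pdf 0 sigma z) for h > 0; see [sum_log_density]. *)
Definition log_density (p : R * R) : R := delta p.1 + 2^-1 - p.2 ^+ 2 / (2 * sigma ^+ 2).

Lemma measurable_log_density : measurable_fun setT log_density.
Proof.
apply: measurable_funB.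
  by apply: measurable_funD => //; apply: (measurableT_comp measurable_delta_H); exact: measurable_fst.
by apply: measurable_funM => //; apply: measurable_funX; exact: measurable_snd.
Qed.

(** Second moments about every shift c are asked for because [moments_of_shifts] reads mean and
    variance from two of them. The fourth moment combines the fourth power of [delta] with the
    eighth moment of the noise. *)
Lemma log_density_moments (P : probability (measurableTypeR R * measurableTypeR R)%type R) :
  (forall u : R * R -> \bar R, measurable_fun setT u -> (forall p, 0 <= u p)%E ->
     (\int[P]_p u p = \int[leb]_h ((f h)%:E * \int[leb]_z ((normal_pdf 0 sigma z)%:E * u (h, z))))%E) ->
  (forall c : R, \int[P]_p (((log_density p - m + c) ^+ 2)%:E) = (V + c ^+ 2)%:E)%E /\
  (\int[P]_p (((log_density p - m) ^+ 4)%:E) < +oo)%E.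
Proof.
move=> PE; have mL := measurable_log_density; split=> [c|].
  rewrite PE; last 2 first.
  - apply/measurable_EFinP; apply: measurable_funX; apply: measurable_funD => //.
    exact: measurable_funB.
  - by move=> p; rewrite lee_fin sqr_ge0.
  transitivity (\int[leb]_h (1 * (f h * (delta h - m) ^+ 2) + (2 * c) * (f h * (delta h - m)) + (c ^+ 2 + 2^-1) * f h)%:E)%E.
    apply: eq_integral => h _.
    rewrite (_ : (\int[leb]_z _)%E = ((delta h - m + c) ^+ 2 + 2^-1)%:E).
      by rewrite -EFinM; congr EFin; ring.
    under eq_integral => z _.
      rewrite -EFinM /log_density /= (_ : _ - m + c = (delta h - m + c + 2^-1) - z ^+ 2 / (2 * sigma ^+ 2)); last by ring.
      over.
    by rewrite normal_quadratic; congr EFin; field.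
  rewrite (integral_lincomb _ _ _ integrable_fading_delta2 integrable_fading_delta integrable_f
    fading_delta_var fading_delta_mean f1).
  by congr EFin; ring.
have [M ME] : exists M : R, (\int[leb]_z (z ^+ 8 * normal_pdf 0 sigma z)%:E = M%:E)%E.
  have := normal_moment8 sigma0.
  have : (0 <= \int[leb]_z (z ^+ 8 * normal_pdf 0 sigma z)%:E)%E.
    apply: integral_ge0 => z _; rewrite lee_fin mulr_ge0 ?normal_pdf_ge0//.
    by rewrite (exprM _ 2 4) pow4_ge0.
  by case: (\int[leb]_z _)%E => // M; exists M.
have M0 : 0 <= M.
  rewrite -lee_fin -ME; apply: integral_ge0 => z _; rewrite lee_fin mulr_ge0 ?normal_pdf_ge0//.
  by rewrite (exprM _ 2 4) pow4_ge0.
pose k := (2 * sigma ^+ 2) ^- 4.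
pose a h := 8 * (delta h + 2^-1 - m) ^+ 4.
have k0 : 0 <= k by rewrite invr_ge0 pow4_ge0.
have a0 h : 0 <= a h by rewrite mulr_ge0 ?pow4_ge0.
have ma : measurable_fun setT a.
  apply: measurable_funM => //; apply: measurable_funX; apply: measurable_funB => //.
  by apply: measurable_funD => //; exact: measurable_delta_H.
apply: (@le_lt_trans _ _ (\int[leb]_h (f h * (a h + 8 * k * M))%:E)%E); last first.
  have : leb.-integrable setT (EFin \o (fun h => f h * (a h + 8 * k * M))).
    apply: (@integrable_fading _ (64 * (2^-1 - m) ^+ 4 + 8 * k * M) 64).
    - exact: measurable_funD.
    - by apply: addr_ge0; apply: mulr_ge0 => //; [exact: pow4_ge0|exact: mulr_ge0].
    - by [].
    - move=> h; rewrite ger0_norm; last by rewrite addr_ge0// !mulr_ge0.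
      have := pow4D_le (delta h) (2^-1 - m); rewrite addrA /a.
      by move: (8 * k * M) (_ ^+ 4) (_ ^+ 4) (_ ^+ 4) => *; lra.
  move=> /integrableP[_]; apply: le_lt_trans; apply: ge0_le_integral => //.
  - by move=> h _; rewrite lee_fin mulr_ge0// addr_ge0// !mulr_ge0.
  - by apply/measurable_EFinP; apply: measurable_funM => //; exact: measurable_funD.
  - by apply: measurableT_comp => //; apply/measurable_EFinP; apply: measurable_funM => //; exact: measurable_funD.
  - by move=> h _; rewrite lee_fin ler_norm.
rewrite PE; last 2 first.
- by apply/measurable_EFinP; apply: measurable_funX; exact: measurable_funB.
- by move=> p; rewrite lee_fin pow4_ge0.
apply: lower_le_integral => h.
  rewrite mule_ge0 ?lee_fin//; apply: integral_ge0 => z _.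
  by rewrite -EFinM lee_fin mulr_ge0 ?normal_pdf_ge0 ?pow4_ge0.
rewrite [leRHS]EFinM lee_wpmul2l ?lee_fin//.
apply: (@le_trans _ _ (\int[leb]_z ((a h)%:E * (z ^+ 0 * normal_pdf 0 sigma z)%:E
   + (8 * k)%:E * (z ^+ 8 * normal_pdf 0 sigma z)%:E))%E).
  apply: lower_le_integral => z.
    by rewrite -EFinM lee_fin mulr_ge0 ?normal_pdf_ge0 ?pow4_ge0.
  rewrite -!EFinM -EFinD lee_fin expr0 mul1r [_ * (z ^+ 8 * _)]mulrA -mulrDl [leLHS]mulrC ler_wpM2r ?normal_pdf_ge0//.
  have := pow4D_le (delta h + 2^-1 - m) (- (z ^+ 2 / (2 * sigma ^+ 2))).
  rewrite [(- _) ^+ 4]exprNn -signr_odd /= expr0 mul1r exprMn -exprM exprVn -/k mulrDr -/(a h).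
  rewrite /log_density /= (_ : _ - _ - m = delta h + 2^-1 - m - z ^+ 2 / (2 * sigma ^+ 2)); last by ring.
  by move=> H; apply: le_trans H _; rewrite lerD2l; lra.
have mg j : measurable_fun setT (fun z : R => (z ^+ j * normal_pdf 0 sigma z)%:E).
  apply/measurable_EFinP; apply: measurable_funM; [exact: measurable_funX|exact: measurable_normal_pdf].
have z8 z : 0 <= z ^+ 8 :> R by rewrite (exprM _ 2 4) pow4_ge0.
rewrite ge0_integralD; [|exact: measurableT| | | |]; last 4 first.
- by move=> z _; rewrite -EFinM lee_fin expr0 mul1r mulr_ge0 ?normal_pdf_ge0.
- by apply: measurable_funeM; exact: mg.
- by move=> z _; rewrite -EFinM lee_fin; apply: mulr_ge0; apply: mulr_ge0; rewrite ?normal_pdf_ge0.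
- by apply: measurable_funeM; exact: mg.
rewrite (@ge0_integralZl _ _ _ leb setT measurableT _ (mg _)); [|by move=> z _; rewrite lee_fin expr0 mul1r normal_pdf_ge0|by rewrite lee_fin].
rewrite (@ge0_integralZl _ _ _ leb setT measurableT _ (mg _)); [|by move=> z _; rewrite lee_fin mulr_ge0 ?normal_pdf_ge0|by rewrite lee_fin mulr_ge0].
by rewrite normal_moment0// ME mule1 -!EFinM -EFinD.
Qed.

(** The single probabilistic input of both bounds: Berry-Esseen for the standardized log-densities,
    transported back to n coordinates by [fg_expect_law]. *)
Theorem log_density_clt : exists2 K : R, 0 <= K & forall n, (0 < n)%N -> forall c : R,
  exists2 p : R, fg_expect f sigma (fun q : n.-tuple R * n.-tuple R =>
      (\1_[set w | w <= c] (\sum_(i < n) log_density (tnth q.1 i, tnth q.2 i)))%:E) = p%:E &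
    `|p - Qfun ((n%:R * m - c) / (Num.sqrt V * Num.sqrt n%:R))| <= K * (1 + ln n%:R) / Num.sqrt n%:R.
Proof.
have [P PE] := fading_gauss_probability sigma mf f0 f1.
have [H2 H4] := log_density_moments PE.
have V0 : 0 < V by apply: lt_le_trans disp_V_ge; rewrite invr_gt0.
have s0 : 0 < Num.sqrt V by rewrite sqrtr_gt0.
have s2 : Num.sqrt V ^+ 2 = V by rewrite sqr_sqrtr// ltW.
pose X p := (log_density p - m) / Num.sqrt V.
have mX : measurable_fun setT X.
  by apply: measurable_funM => //; apply: measurable_funB => //; exact: measurable_log_density.
have [mu muE] := pushforward_probability P mX.
have [nu [nu0 nuS]] := law_sequence mu.
have mc (c : R) : measurable_fun setT (fun x : R => ((x + c) ^+ 2)%:E).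
  by apply/measurable_EFinP; apply: measurable_funX; exact: measurable_funD.
have mL (c : R) : measurable_fun setT (fun p => ((log_density p - m + c) ^+ 2)%:E).
  apply/measurable_EFinP; apply: measurable_funX; apply: measurable_funD => //.
  by apply: measurable_funB => //; exact: measurable_log_density.
have S (c : R) : (\int[mu]_x (((x + c) ^+ 2)%:E) = (1 + c ^+ 2)%:E)%E.
  rewrite muE//; last by move=> x; rewrite lee_fin sqr_ge0.
  transitivity (\int[P]_p (V^-1%:E * ((log_density p - m + c * Num.sqrt V) ^+ 2)%:E))%E.
    apply: eq_integral => p _; rewrite -EFinM; congr EFin; rewrite /X -[X in X^-1 * _]s2.
    by field; rewrite gt_eqF.
  rewrite (@ge0_integralZl _ _ _ P setT measurableT _ (mL _)); last 2 first.
  - by move=> p _; rewrite lee_fin sqr_ge0.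
  - by rewrite lee_fin invr_ge0 ltW.
  by rewrite H2 -EFinM exprMn s2; congr EFin; field; rewrite gt_eqF.
have M4 : (\int[mu]_x (x ^+ 4)%:E < +oo)%E.
  rewrite muE; last 2 first.
  - by apply/measurable_EFinP; exact: measurable_funX.
  - by move=> x; rewrite lee_fin pow4_ge0.
  under eq_integral => p _ do rewrite /X exprMn mulrC EFinM.
  have mL4 : measurable_fun setT (fun p => ((log_density p - m) ^+ 4)%:E).
    apply/measurable_EFinP; apply: measurable_funX.
    by apply: measurable_funB => //; exact: measurable_log_density.
  rewrite (@ge0_integralZl _ _ _ P setT measurableT _ mL4); last 2 first.
  - by move=> p _; rewrite lee_fin pow4_ge0.
  - by rewrite lee_fin pow4_ge0.
  have : (0 <= \int[P]_p (((log_density p - m) ^+ 4)%:E))%E.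
    by apply: integral_ge0 => p _; rewrite lee_fin pow4_ge0.
  by move: H4; case: (\int[P]_p _)%E => // r _ _; rewrite -EFinM ltry.
have [|||i1 mean0 i2 var1 iw] := @moments_of_shifts _ mu.
- by have := S 0; under eq_integral do rewrite addr0; move=> ->; rewrite expr0n /= addr0.
- by rewrite S expr1n.
- exact: M4.
have [K0 HK] := berry_esseen_log nu0 nuS i1 mean0 i2 var1 iw.
exists `|K0|; first by [].
move=> n n0 c; have sn0 : 0 < Num.sqrt n%:R :> R by rewrite sqrtr_gt0 ltr0n.
pose t := (c - n%:R * m) / Num.sqrt V.
exists (cdf_of (nu n) t).
  rewrite -cdf_ofE.
  have -> : nu n [set w | w <= t] = (\int[nu n]_w (\1_[set w | w <= t] w)%:E)%E.
    by rewrite integral_indic ?setIT//; exact: measurable_le_set.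
  rewrite -(fg_expect_law mf f0 PE mX muE nu0 nuS); last 2 first.
  - by apply/measurable_EFinP; apply: measurable_indic; exact: measurable_le_set.
  - by move=> x; rewrite lee_fin.
  congr fg_expect; apply/funext => q; congr EFin; rewrite !indicE; congr (_%:R); congr nat_of_bool.
  have -> : \sum_(i < n) X (tnth q.1 i, tnth q.2 i) =
      (\sum_(i < n) log_density (tnth q.1 i, tnth q.2 i) - n%:R * m) / Num.sqrt V.
    by rewrite -mulr_suml sumrB; congr (_ * _); congr (_ - _); rewrite big_const_ord iter_addr_0 mulr_natl.
  by apply/idP/idP; rewrite !inE /= /t ler_pM2r ?invr_gt0//; lra.
have := HK n n0 t.
rewrite (_ : - t / Num.sqrt n%:R = (n%:R * m - c) / (Num.sqrt V * Num.sqrt n%:R)); last first.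
  by rewrite /t; field; rewrite !gt_eqF.
move=> H; apply: le_trans H _.
rewrite ler_pM2r ?invr_gt0// ler_wpM2r ?ler_norm// addr_ge0// ln_ge0// ler1n//.
Qed.

End LogDensityMoments.

(** * Counting points and the limsup over cubes *)

Section Counting.
Context {R : realType}.
Local Open Scope ereal_scope.

Lemma esum_seq (T : choiceType) (s : seq T) (F : T -> \bar R) : uniq s ->
  (forall x, 0 <= F x) -> \esum_(x in [set` s]) F x = \sum_(x <- s) F x.
Proof.
move=> us F0; rewrite esum_fset; [|exact: finite_seq|by move=> x _].
by apply/esym; exact: fsbig_seq.
Qed.

Lemma sum1_size (T : Type) (s : seq T) : \sum_(x <- s) (1 : \bar R) = (size s)%:R%:E.
Proof.
elim: s => [|x s IH]; first by rewrite big_nil.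
by rewrite big_cons IH /= -EFinD -natr1 addrC.
Qed.

Lemma ecount_seq n (s : seq (n.-tuple R)) : uniq s -> ecount [set` s] = (size s)%:R%:E.
Proof. by move=> us; rewrite /ecount esum_seq// sum1_size. Qed.

Lemma ecount_ge n (A : set (n.-tuple R)) (s : seq (n.-tuple R)) : uniq s ->
  [set` s] `<=` A -> (size s)%:R%:E <= ecount A.
Proof.
move=> us sA; rewrite -ecount_seq//; apply: esum_ge.
exists [set` s]; first by split => //; exact: finite_seq.
by rewrite /ecount esum_fset//; exact: finite_seq.
Qed.

Lemma ecount_lty n (A : set (n.-tuple R)) : ecount A < +oo ->
  exists2 s : seq (n.-tuple R), uniq s & A = [set` s].
Proof.
move=> Afin; have [finA|infA] := pselect (finite_set A).
  by exists (finmap.enum_fset (fset_set A)); [exact: finmap.fset_uniq|rewrite fset_setK].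
exfalso; have : ecount A \is a fin_num.
  by rewrite ge0_fin_numE// esum_ge0.
move=> /fineK EA.
have [B BA nB] := infinite_set_fset (Num.bound (fine (ecount A))) infA.
have := ecount_ge (finmap.fset_uniq B) BA; rewrite -EA lee_fin leNgt.
by rewrite (lt_le_trans (archi_boundP _)) ?ler_nat// fine_ge0// esum_ge0.
Qed.

(** Degenerate windows do no harm: an infinite count has inverse 0, and over the empty set the sum
    is 0. *)
Lemma average_le n (A : set (n.-tuple R)) (p : n.-tuple R -> \bar R) (c : R) :
  (forall x, 0 <= p x) -> (forall x, A x -> p x <= c%:E) -> (0 <= c)%R ->
  (\esum_(s in A) p s) * (ecount A)^-1 <= c%:E.
Proof.
move=> p0 pc c0; have [Afin|] := boolP (ecount A < +oo); last first.
  by rewrite -leNgt leye_eq => /eqP ->; rewrite invey mule0 lee_fin.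
have [s us As] := ecount_lty Afin; rewrite As ecount_seq// esum_seq//.
have [s0|s0] := posnP (size s).
  by rewrite (size0nil s0) big_nil mul0e lee_fin.
rewrite inver pnatr_eq0 (gtn_eqF s0) lee_pdivrMr ?ltr0n//.
have := sum1_size s => /(congr1 (fun x => c%:E * x)) <-.
rewrite ge0_sume_distrr// [leLHS]big_seq [leRHS]big_seq; apply: lee_sum => x xs.
by rewrite mule1; apply: pc; rewrite As.
Qed.

Lemma le_elimsup (F : R -> \bar R) c : (forall A, exists2 a, (A < a)%R & c <= F a) ->
  c <= elimsup_pinfty F.
Proof.
move=> H; apply: le_ereal_inf_tmp => _ [A _ <-]; apply: le_ereal_sup_tmp.
by have [a Aa ca] := H A; exists (F a) => //; exists a.
Qed.

Lemma elimsup_le (F : R -> \bar R) c A : (forall a, (A < a)%R -> F a <= c) ->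
  elimsup_pinfty F <= c.
Proof.
move=> H; apply: ge_ereal_inf; exists (ereal_sup [set F a | a in [set a | (A < a)%R]]); first by exists A.
by apply: ge_ereal_sup => _ [a Aa <-]; exact: H.
Qed.

Lemma elimsup_lt (F : R -> \bar R) c : elimsup_pinfty F < c ->
  exists A, forall a, (A < a)%R -> F a < c.
Proof.
move=> /ereal_inf_lt[_ [A _ <-] Ac]; exists A => a Aa.
by apply: le_lt_trans Ac; apply: ereal_sup_ubound; exists a.
Qed.

Lemma elimsup_gt (F : R -> \bar R) c : c < elimsup_pinfty F ->
  forall A, exists2 a, (A < a)%R & c < F a.
Proof.
move=> cF A; have : c < ereal_sup [set F a | a in [set a | (A < a)%R]].
  by apply: lt_le_trans cF _; apply: ereal_inf_lbound; exists A.
by move=> /ereal_sup_gt[_ [a Aa <-] ca]; exists a.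
Qed.

(** The density is a limsup, so the lower bound on the count holds only along some arbitrarily large
    cubes, while finiteness of the count holds on all large ones. The loss of a factor 2 ends up in
    the constant 4 of 4 / n. *)
Lemma density_count n (S : set (n.-tuple R)) (g : R) : (0 < g)%R -> density S = g%:E ->
  forall A, exists a (s : seq (n.-tuple R)), [/\ (A < a)%R, uniq s, S `&` @Cb _ n a = [set` s] &
    (g / 2 * a ^+ n <= (size s)%:R)%R].
Proof.
move=> g0 dS A.
have [B HB] : exists B, forall a, (B < a)%R ->
    ecount (S `&` @Cb _ n a) * ((a ^+ n)^-1)%:E < +oo.
  by apply: elimsup_lt; rewrite -/(density S) dS ltry.
have : (g / 2)%:E < density S by rewrite dS lte_fin; lra.
move=> /elimsup_gt /(_ (Num.max (Num.max A B) 0%R)).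
move=> [a]; rewrite !gt_max => /andP[/andP[Aa Ba] a0] ca.
have an0 : (0 < a ^+ n)%R by rewrite exprn_gt0.
have fin : ecount (S `&` @Cb _ n a) < +oo.
  rewrite ltNge leye_eq; apply/negP => /eqP E; have := HB _ Ba.
  by rewrite E gt0_mulye ?ltxx// lte_fin invr_gt0.
have [s us sE] := ecount_lty fin; exists a, s; split => //.
by move: ca; rewrite sE ecount_seq// -EFinM lte_fin ltr_pdivlMr// => /ltW.
Qed.

End Counting.

(** * Converse for fixed fading *)

Section ConditionalConverse.
Context {R : realType}.
Variable sigma : R.
Hypothesis sigma0 : 0 < sigma.
Local Notation leb := (@lebesgue_measure R).
Local Notation g := (@gauss_n R _ sigma).
Local Open Scope ereal_scope.

Lemma measurable_indic_EFin d (T : measurableType d) (A : set T) : measurable A ->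
  measurable_fun setT (fun x => (\1_A x : R)%:E).
Proof. by move=> mA; apply/measurable_EFinP; exact: measurable_indic. Qed.

Lemma iint0 n : iint (fun _ : n.-tuple R => 0 : \bar R) = 0.
Proof. by elim: n => [|n IH] //=; apply: integral0_eq => x _. Qed.

Lemma measurable_gauss_EFin n : measurable_fun setT (fun z : n.-tuple R => (g z)%:E).
Proof. by apply/measurable_EFinP; exact: measurable_gauss_n. Qed.

Lemma measurable_gauss_indic n (A : set (n.-tuple R)) : measurable A ->
  measurable_fun setT (fun z : n.-tuple R => (g z)%:E * (\1_A z : R)%:E).
Proof.
move=> mA; apply: emeasurable_funM; [exact: measurable_gauss_EFin|exact: measurable_indic_EFin].
Qed.

Lemma gauss_indic_ge0 n (A : set (n.-tuple R)) z : 0 <= (g z)%:E * (\1_A z : R)%:E.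
Proof. by rewrite -EFinM lee_fin mulr_ge0// gauss_n_ge0. Qed.

Lemma iint_gauss n : iint (fun z : n.-tuple R => (g z)%:E) = 1.
Proof.
rewrite /gauss_n (eq_iint (G := fun z : n.-tuple R => \prod_(i < n) (normal_pdf 0 sigma (tnth z i))%:E)); last first.
  by move=> z; rewrite prodEFin.
rewrite (iint_prod (F := fun _ x => (normal_pdf 0 sigma x)%:E)).
- by rewrite big1// => i _; exact: integral_normal_pdf.
- by move=> i x; rewrite lee_fin normal_pdf_ge0.
- by move=> i; apply/measurable_EFinP; exact: measurable_normal_pdf.
Qed.

Lemma gauss_indic_le1 n (A : set (n.-tuple R)) :
  iint (fun z : n.-tuple R => (g z)%:E * (\1_A z : R)%:E) <= 1.
Proof.
rewrite -(iint_gauss n); apply: le_iint => z; first exact: gauss_indic_ge0.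
by rewrite -EFinM lee_fin ler_piMr ?gauss_n_ge0// indicE; case: (_ \in _).
Qed.

Lemma Pe_point_ge0 n (SH : set (n.-tuple R)) s : 0 <= Pe_point sigma SH s.
Proof. by apply: iint_ge0 => z; rewrite -EFinM lee_fin mulr_ge0// gauss_n_ge0. Qed.

Lemma Pe_given_H_le n (S : set (n.-tuple R)) h (c : R) : (0 <= c)%R ->
  (forall s, recIC h S s -> Pe_point sigma (recIC h S) s <= c%:E) ->
  Pe_given_H sigma S h <= c%:E.
Proof.
move=> c0 H; apply: (@elimsup_le _ _ _ 0%R) => a _; apply: average_le => //.
- by move=> s; exact: Pe_point_ge0.
- by move=> s [Ss _]; exact: H.
Qed.

Lemma Pe_given_H_le1 n (S : set (n.-tuple R)) h : Pe_given_H sigma S h <= 1.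
Proof.
apply: Pe_given_H_le => // s _; rewrite -(iint_gauss n); apply: le_iint => z.
  by rewrite -EFinM lee_fin mulr_ge0// gauss_n_ge0.
by rewrite -EFinM lee_fin ler_piMr ?gauss_n_ge0// indicE; case: (_ \in _).
Qed.

Lemma gauss_moment2 n (i : 'I_n) :
  iint (fun z : n.-tuple R => (g z * tnth z i ^+ 2)%:E) = (sigma ^+ 2)%:E.
Proof.
pose F (j : 'I_n) x := ((if j == i then x ^+ 2 else 1) * normal_pdf 0 sigma x)%:E.
rewrite (eq_iint (G := fun z : n.-tuple R => \prod_(j < n) F j (tnth z j))); last first.
  move=> z; rewrite prodEFin big_split /= -big_mkcond /= big_pred1_eq mulrC //.
rewrite (iint_prod (F := F)).
- rewrite (bigD1 i)//= big1 ?mule1.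
    by rewrite /F eqxx normal_moment2.
  by move=> j /negPf ji; rewrite /F ji; under eq_integral do rewrite mul1r; exact: integral_normal_pdf.
- move=> j x; rewrite lee_fin mulr_ge0 ?normal_pdf_ge0//; case: ifP => // _; exact: sqr_ge0.
- move=> j; apply/measurable_EFinP; apply: measurable_funM; last exact: measurable_normal_pdf.
  by case: (j == i) => //; exact: measurable_funX.
Qed.

Lemma measurable_dist2 n (s : n.-tuple R) : measurable_fun setT (fun y : n.-tuple R => dist2 y s).
Proof.
apply: measurable_sum => i; apply: measurable_funX; apply: measurable_funB => //.
exact: measurable_tnth.
Qed.

Lemma measurable_lepred d (T : measurableType d) (u v : T -> R) : measurable_fun setT u ->
  measurable_fun setT v -> measurable [set y | (u y <= v y)%R].
Proof.
move=> mu mv; have := measurable_fun_ler mu mv => /(_ measurableT [set true] I).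
by rewrite setTI.
Qed.

(** Countability of the constellation turns the cell into a countable intersection, indexed through
    an injection into the naturals. *)
Lemma measurable_voronoi n (SH : set (n.-tuple R)) s : countable SH -> measurable (voronoi SH s).
Proof.
move=> /countable_injP[e einj].
rewrite (_ : voronoi SH s = \bigcap_k
    [set y | forall s', SH s' -> e s' = k -> (dist2 y s <= dist2 y s')%R]); last first.
  by apply/seteqP; split=> [y Hy k _ s' Ss' _|y Hy s' Ss']; [exact: Hy|exact: Hy Ss' erefl].
apply: bigcap_measurableType => k _.
have [[s' Ss' ek]|H] := pselect (exists2 s', SH s' & e s' = k); last first.
  rewrite (_ : [set y | _] = setT)//; apply/seteqP; split => // y _ s' Ss' ek.
  by case: H; exists s'.
rewrite (_ : [set y | _] = [set y | (dist2 y s <= dist2 y s')%R]).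
  by apply: measurable_lepred; exact: measurable_dist2.
apply/seteqP; split=> [y Hy|y Hy t St et]; first exact: Hy.
by rewrite (einj t s') ?inE// et ek.
Qed.

(** The squares of y cancel in the difference of the two distances, which is affine in y and not
    constant. *)
Lemma bisector_null n (s s' : n.-tuple R) : s != s' ->
  iint (fun y : n.-tuple R => (\1_[set y | dist2 y s = dist2 y s'] y : R)%:E) = 0.
Proof.
move=> ss'; have [i si] : exists i, tnth s i != tnth s' i.
  apply/not_existsP => H; move: ss' => /eqP; apply; apply: eq_from_tnth => i.
  by apply/eqP/negPn/negP; exact: H.
rewrite -[RHS](@iint_hyperplane R n (fun i => 2 * (tnth s' i - tnth s i))%R
  (\sum_(i < n) (tnth s' i ^+ 2 - tnth s i ^+ 2))%R); last first.
  by exists i; rewrite mulf_neq0// subr_eq0 eq_sym.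
apply: eq_iint => y; rewrite indicE; congr (_%:R%:E); congr nat_of_bool.
have E : (dist2 y s - dist2 y s' = \sum_(i < n) 2 * (tnth s' i - tnth s i) * tnth y i -
    \sum_(i < n) (tnth s' i ^+ 2 - tnth s i ^+ 2))%R.
  by rewrite /dist2 -!sumrB; apply: eq_bigr => j _; ring.
apply/idP/idP => [|/eqP H].
  by rewrite inE /= => H; apply/eqP/subr0_eq; rewrite -E H subrr.
by rewrite inE /=; apply/eqP; rewrite -subr_eq0 E H subrr.
Qed.

(* Cells overlap only on bisecting hyperplanes, which are null. *)
Lemma sum_voronoi_le n (SH : set (n.-tuple R)) (l : seq (n.-tuple R)) : countable SH ->
  uniq l -> (forall s, s \in l -> SH s) -> forall B, measurable B ->
  \sum_(s <- l) iint (fun y => (\1_(voronoi SH s `&` B) y : R)%:E) <=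
  iint (fun y => (\1_B y : R)%:E).
Proof.
move=> cS; elim: l => [|x l IH] /= ul lS B mB.
  by rewrite big_nil iint_ge0// => y; rewrite lee_fin.
move: ul => /andP[xl ul]; rewrite big_cons.
have mV s := measurable_voronoi s cS.
have {}IH := IH ul (fun s sl => lS s (mem_behead (s := x :: l) sl)) (B `\` voronoi SH x)
   (measurableD mB (mV _)).
apply: (@le_trans _ _ (iint (fun y => (\1_(voronoi SH x `&` B) y : R)%:E) +
    iint (fun y => (\1_(B `\` voronoi SH x) y : R)%:E))).
  rewrite leeD2l//; apply: le_trans IH; rewrite [leLHS]big_seq [leRHS]big_seq.
  apply: lee_sum => s sl; have xs : x != s by apply: contraNneq xl => ->.
  rewrite -[leRHS]adde0 -(bisector_null xs) -iintD.
  - apply: le_iint => y; first by rewrite lee_fin.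
    rewrite -EFinD lee_fin !indicE.
    have [yV|yV] := boolP (y \in voronoi SH s `&` B); last by rewrite addr_ge0.
    move: yV; rewrite inE => -[yV yB].
    have [yx|yx] := pselect (voronoi SH x y).
      have E : [set y0 | dist2 y0 x = dist2 y0 s] y.
        apply/eqP; rewrite eq_le yx; last by apply: lS; rewrite inE sl orbT.
        by rewrite yV//; apply: lS; rewrite mem_head.
      by rewrite (mem_set E) lerDr.
    have E : (voronoi SH s `&` (B `\` voronoi SH x)) y by [].
    by rewrite (mem_set E) lerDl.
  - by move=> y; rewrite lee_fin.
  - by apply: measurable_indic_EFin; apply: measurableI => //; exact: measurableD.
  - by move=> y; rewrite lee_fin.
  - apply: measurable_indic_EFin.
    rewrite (_ : [set y | _] = [set y | (dist2 y x <= dist2 y s)%R] `&` [set y | (dist2 y s <= dist2 y x)%R]).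
      by apply: measurableI; apply: measurable_lepred; exact: measurable_dist2.
    apply/seteqP; split => y /=; first by move=> ->.
    by move=> [? ?]; apply/eqP; rewrite eq_le; apply/andP.
rewrite -iintD.
- apply: le_iint => y; first by rewrite -EFinD lee_fin.
  rewrite -EFinD lee_fin !indicE in_setI in_setD.
  by case: (y \in B); case: (y \in voronoi _ _); rewrite /= ?addr0 ?add0r.
- by move=> y; rewrite lee_fin.
- by apply: measurable_indic_EFin; exact: measurableI.
- by move=> y; rewrite lee_fin.
- by apply: measurable_indic_EFin; exact: measurableD.
Qed.

Lemma iint_box n (c : 'I_n -> R) : (forall i, (0 <= c i)%R) ->
  iint (fun y : n.-tuple R => (\1_[set y : n.-tuple R | forall i, (`|tnth y i| < c i)%R] y : R)%:E) =
  (\prod_(i < n) (2 * c i)%R)%:E.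
Proof.
move=> c0; pose F i x := (\1_(`](- c i)%R, (c i)[%classic) x : R)%:E.
rewrite (eq_iint (G := fun y : n.-tuple R => \prod_(i < n) F i (tnth y i))); last first.
  move=> y; rewrite /F prodEFin; congr EFin; rewrite indicE.
  have [yc|yc] := pselect (forall i, (`|tnth y i| < c i)%R).
    rewrite mem_set// big1// => i _; rewrite indicE mem_set//=.
    by rewrite in_itv/= -ltr_norml.
  rewrite memNset//; have [i yi] : exists i, ~~ (`|tnth y i| < c i)%R.
    by apply/not_existsP => H; apply: yc => i; apply/negPn/negP; exact: H.
  rewrite (bigD1 i)//= indicE memNset ?mul0r//= in_itv/= -ltr_norml.
  exact/negP.
rewrite (iint_prod (F := F)).
- rewrite -prodEFin; apply: eq_bigr => i _.
  rewrite /F integral_indic// setIT; apply: etrans (lebesgue_measure_itv _) _ => /=.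
  rewrite lte_fin; case: ifPn => [_|]; first by rewrite -EFinD; congr EFin; ring.
  by rewrite -leNgt => H; congr EFin; have := c0 i; lra.
- by move=> i x; rewrite lee_fin.
- by move=> i; apply: measurable_indic_EFin; exact: measurable_itv.
Qed.

Lemma measurable_box n (c : 'I_n -> R) :
  measurable [set y : n.-tuple R | forall i, (`|tnth y i| < c i)%R].
Proof.
rewrite (_ : [set y | _] = \bigcap_(i in [set: 'I_n]) [set y : n.-tuple R | (`|tnth y i| < c i)%R]); last first.
  by apply/seteqP; split => [y H i _|y H i]; [exact: H|exact: H].
apply: fin_bigcap_measurable => // i _.
rewrite (_ : [set y | _] = ~` [set y : n.-tuple R | (c i <= `|tnth y i|)%R]); last first.
  by apply/seteqP; split => y /=; rewrite ltNge => /negP.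
apply: measurableC; apply: measurable_lepred => //.
by apply: measurableT_comp => //; exact: measurable_tnth.
Qed.


(** A noise vector of density at most t either leaves the cell, or stays in the cell within the box,
    where it is charged t times the volume, or is itself large. Truncation to a common box is needed
    because cells may be unbounded and their volumes must add up. *)
Lemma Pe_point_lower n (SH : set (n.-tuple R)) (s : n.-tuple R) (t : R) (c b : 'I_n -> R) :
  countable SH -> (0 <= t)%R -> (forall i, (`|tnth s i| <= b i)%R) ->
  iint (fun z : n.-tuple R => (g z)%:E * (\1_[set z | (g z <= t)%R] z : R)%:E) <=
  Pe_point sigma SH s +
  t%:E * iint (fun y => (\1_(voronoi SH s `&` [set y | forall i, (`|tnth y i| < b i + c i)%R]) y : R)%:E) +
  iint (fun z : n.-tuple R => (g z)%:E * (\1_(~` [set z | forall i, (`|tnth z i| < c i)%R]) z : R)%:E).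
Proof.
move=> cS t0 sb; set Box := [set y : n.-tuple R | forall i, (`|tnth y i| < b i + c i)%R].
have mV := measurable_voronoi s cS.
have mvadd : measurable_fun setT (fun z : n.-tuple R => vadd s z).
  apply/measurable_fun_tnthP => i; rewrite [X in measurable_fun _ X](_ : _ = (fun z : n.-tuple R => (tnth s i + tnth z i)%R)).
    by apply: measurable_funD => //; exact: measurable_tnth.
  by apply/funext => z /=; rewrite tnth_mktuple.
have mB := measurable_box (fun i => b i + c i)%R; rewrite -/Box in mB.
have mVB : measurable (voronoi SH s `&` Box) by exact: measurableI.
have mI (A : set (n.-tuple R)) : measurable A ->
    measurable_fun setT (fun z => (\1_A (vadd s z) : R)%:E).
  by move=> mA; apply: (measurableT_comp (measurable_indic_EFin mA) mvadd).
have mt : measurable_fun setT (fun z => t%:E * (\1_(voronoi SH s `&` Box) (vadd s z) : R)%:E).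
  by apply: measurable_funeM; exact: mI.
have mP : measurable_fun setT (fun z : n.-tuple R => (g z)%:E * (\1_(~` voronoi SH s) (vadd s z) : R)%:E).
  by apply: emeasurable_funM; [exact: measurable_gauss_EFin|apply: mI; exact: measurableC].
rewrite -(@iint_translate R n s (fun y => (\1_(voronoi SH s `&` Box) y : R)%:E)); last 2 first.
- exact: measurable_indic_EFin.
- by move=> y; rewrite lee_fin.
rewrite -iintZl ?lee_fin//; last exact: mI.
have P0 z : 0 <= (g z)%:E * (\1_(~` voronoi SH s) (vadd s z) : R)%:E.
  by rewrite -EFinM lee_fin mulr_ge0// gauss_n_ge0.
have T0 z : 0 <= t%:E * (\1_(voronoi SH s `&` Box) (vadd s z) : R)%:E.
  by rewrite -EFinM lee_fin mulr_ge0.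
rewrite /Pe_point -iintD// -iintD//; last 4 first.
- by move=> z; rewrite adde_ge0.
- exact: emeasurable_funD.
- by move=> z; exact: gauss_indic_ge0.
- by apply: measurable_gauss_indic; apply: measurableC; exact: measurable_box.
apply: le_iint => z; first exact: gauss_indic_ge0.
rewrite -!EFinM -!EFinD lee_fin.
have g0 := gauss_n_ge0 sigma z.
have i0 (A : set (n.-tuple R)) y : (0 <= \1_A y :> R)%R by [].
have r1 : (0 <= g z * \1_(~` voronoi SH s) (vadd s z))%R by rewrite mulr_ge0.
have r2 : (0 <= t * \1_(voronoi SH s `&` Box) (vadd s z))%R by rewrite mulr_ge0.
have r3 : (0 <= g z * \1_(~` [set z : n.-tuple R | forall i, (`|tnth z i| < c i)%R]) z)%R by rewrite mulr_ge0.
have [zt|zt] := boolP (z \in [set z | (g z <= t)%R]); last first.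
  by rewrite indicE (negbTE zt) mulr0 addr_ge0// addr_ge0.
have {}zt : (g z <= t)%R by rewrite inE in zt.
apply: (@le_trans _ _ (g z)); first by rewrite ler_piMr// indicE; case: (_ \in _).
have [V|V] := pselect (voronoi SH s (vadd s z)); last first.
  rewrite [X in (_ <= _ * X + _ + _)%R]indicE mem_set// mulr1.
  by rewrite -addrA lerDl addr_ge0.
have [Z|Z] := pselect (forall i, (`|tnth z i| < c i)%R); last first.
  rewrite [X in (_ <= _ + _ * X)%R]indicE mem_set// mulr1.
  by rewrite lerDr addr_ge0.
have B : Box (vadd s z).
  move=> i; rewrite tnth_mktuple (le_lt_trans (ler_normD _ _))//.
  by rewrite ler_ltD.
rewrite [X in (_ <= _ + _ * X + _)%R]indicE mem_set// mulr1.
by rewrite addrAC (le_trans zt)// lerDr addr_ge0.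
Qed.

(** Chebyshev's inequality and a union bound over the coordinates. *)
Lemma gauss_outside_box n (c : 'I_n -> R) : (forall i, (0 < c i)%R) ->
  iint (fun z : n.-tuple R => (g z)%:E * (\1_(~` [set z | forall i, (`|tnth z i| < c i)%R]) z : R)%:E) <=
  (\sum_(i < n) sigma ^+ 2 / c i ^+ 2)%:E.
Proof.
move=> c0; pose F (i : 'I_n) (z : n.-tuple R) := (c i ^- 2)%:E * (g z * tnth z i ^+ 2)%:E.
have F0 i z : 0 <= F i z.
  by rewrite /F -EFinM lee_fin mulr_ge0 ?invr_ge0 ?sqr_ge0// mulr_ge0 ?gauss_n_ge0 ?sqr_ge0.
have mF0 i : measurable_fun setT (fun z : n.-tuple R => (g z * tnth z i ^+ 2)%:E).
  apply/measurable_EFinP; apply: measurable_funM; first exact: measurable_gauss_n.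
  by apply: measurable_funX; exact: measurable_tnth.
have mF i : measurable_fun setT (F i) by apply: measurable_funeM.
have sumE : forall l : seq 'I_n, iint (fun z => \sum_(i <- l) F i z) = \sum_(i <- l) (sigma ^+ 2 / c i ^+ 2)%:E.
  elim=> [|i l IH].
    rewrite big_nil; under eq_iint do rewrite big_nil.
    exact: iint0.
  rewrite big_cons -IH (eq_iint (G := fun z => F i z + \sum_(i <- l) F i z)); last by move=> z; rewrite big_cons.
  rewrite iintD//; last 2 first.
  - by move=> z; exact: sume_ge0.
  - by apply: emeasurable_sum.
  congr (_ + _); rewrite /F iintZl//.
  - by rewrite gauss_moment2 -EFinM mulrC.
  - by rewrite lee_fin invr_ge0 sqr_ge0.
  - by move=> z; rewrite lee_fin mulr_ge0 ?gauss_n_ge0 ?sqr_ge0.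
rewrite -sumEFin -sumE; apply: le_iint => z; first exact: gauss_indic_ge0.
have [Z|Z] := pselect (forall i, (`|tnth z i| < c i)%R).
  rewrite indicE memNset ?mule0 ?sume_ge0//; exact.
rewrite indicE mem_set// mule1.
have [i zi] : exists i, ~~ (`|tnth z i| < c i)%R.
  by apply/not_existsP => H; apply: Z => i; apply/negPn/negP; exact: H.
rewrite (bigD1 i)//= (le_trans _ (leeDl _ _)) ?sume_ge0//.
rewrite /F -EFinM lee_fin mulrCA ler_peMr ?gauss_n_ge0//.
rewrite mulrC ler_pdivlMr ?exprn_gt0// mul1r -[leRHS]real_normK ?num_real// lerXn2r ?nnegrE//.
  by rewrite ltW.
by rewrite leNgt.
Qed.


Lemma hmul_inj n (h : n.-tuple R) : (forall i, tnth h i != 0%R) -> injective (hmul h).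
Proof.
move=> h0 x y xy; apply: eq_from_tnth => i; apply: (mulfI (h0 i)).
by have := congr1 (fun t => tnth t i) xy; rewrite !tnth_mktuple.
Qed.

Lemma recIC_Cb n (h : n.-tuple R) (S : set (n.-tuple R)) a (l : seq (n.-tuple R)) :
  (forall i, tnth h i != 0%R) -> S `&` @Cb _ n a = [set` l] ->
  recIC h S `&` (hmul h @` @Cb _ n a) = [set` map (hmul h) l].
Proof.
move=> h0 Sl; apply/seteqP; split => [y [[x Sx <-] [x' Cx' /(hmul_inj h0) x'x]]|y /= /mapP[x xl ->]].
  rewrite /= map_f//; suff : [set` l] x by [].
  by rewrite -Sl; split => //; rewrite -x'x.
have [Sx Cx] : (S `&` @Cb _ n a) x by rewrite Sl.
by split; exists x.
Qed.

(** A suitable cube of side a holds at least gam a^n / 2 points, and their truncated cells share a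
    volume of at most (3/2) det h a^n. With t = gam / (n det h), t times the mean volume is at most
    3 / n; noise outside its box adds 1 / n. *)
Theorem Pe_given_H_lower n (S : set (n.-tuple R)) (gam : R) (h : n.-tuple R) (q : R) :
  (0 < n)%N -> countable S -> (0 < gam)%R -> density S = gam%:E -> (forall i, (0 < tnth h i)%R) ->
  iint (fun z : n.-tuple R => (g z)%:E *
    (\1_[set z | (g z <= gam / (n%:R * \prod_(i < n) tnth h i))%R] z : R)%:E) = q%:E ->
  (q - 4 / n%:R)%:E <= Pe_given_H sigma S h.
Proof.
move=> n0 cS gam0 dS h0 qE; pose t := (gam / (n%:R * \prod_(i < n) tnth h i))%R.
have nR0 : (0 < n%:R :> R)%R by rewrite ltr0n.
have hn0 i : tnth h i != 0%R by rewrite gt_eqF.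
have det0 : (0 < \prod_(i < n) tnth h i)%R by apply: prodr_gt0 => i _.
have t0 : (0 < t)%R by rewrite divr_gt0// mulr_gt0.
pose D := (\sum_(i < n) sigma ^+ 2 / tnth h i ^+ 2)%R.
have D0 : (0 <= D)%R by apply: sumr_ge0 => i _; rewrite divr_ge0 ?sqr_ge0.
(* Margin of the box in units of h: Chebyshev gives D / r^2 <= 1 / n. It depends on [h], which is
   harmless since [a] grows while [h] is fixed. *)
pose r : R := (n%:R * D + 1)%R.
have r1 : (1 <= r)%R by rewrite lerDr mulr_ge0.
have r0 : (0 < r)%R by exact: lt_le_trans r1.
apply: le_elimsup => A.
have l32 : (0 < ln (3 / 2) :> R)%R by rewrite ln_gt0//; lra.
(* This lower bound on [a] makes exp(2 r n / a) <= 3 / 2, so that widening the cube by the margin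
   costs at most a factor 3 / 2 in volume. *)
have [a [l [Aa ul Sl lM]]] := density_count gam0 dS (Num.max (Num.max A 0%R) (2 * r * n%:R / ln (3 / 2))%R).
move: Aa; rewrite !gt_max => /andP[/andP[Aa a0] ra]; exists a => //.
cbv zeta; rewrite (recIC_Cb hn0 Sl) ecount_seq ?map_inj_uniq//; last exact: hmul_inj.
rewrite esum_seq ?map_inj_uniq//; [|exact: hmul_inj|by move=> x; exact: Pe_point_ge0].
rewrite size_map; set M := size l in lM *.
have M0 : (0 < M%:R :> R)%R by apply: lt_le_trans lM; rewrite mulr_gt0 ?exprn_gt0 ?divr_gt0.
rewrite inver gt_eqF// lee_pdivlMr//.
have cSH : countable (recIC h S) by apply: sub_countable cS; exact: card_image_le.
pose b i := (tnth h i * (a / 2))%R; pose c i := (tnth h i * r)%R.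
have c0 i : (0 < c i)%R by rewrite mulr_gt0.
pose SH := recIC h S.
pose v s := iint (fun y : n.-tuple R => (\1_(voronoi SH s `&` [set y | forall i, (`|tnth y i| < b i + c i)%R]) y : R)%:E).
have lS s : s \in map (hmul h) l -> SH s /\ forall i, (`|tnth s i| <= b i)%R.
  move=> /mapP[x xl ->]; have [Sx Cx] : (S `&` @Cb _ n a) x by rewrite Sl.
  split; first by exists x.
  by move=> i; rewrite tnth_mktuple normrM gtr0_norm// ler_wpM2l ?ltW//; exact/ltW/Cx.
have eta : iint (fun z : n.-tuple R => (g z)%:E * (\1_(~` [set z | forall i, (`|tnth z i| < c i)%R]) z : R)%:E) <= (n%:R^-1)%:E.
  apply: le_trans (gauss_outside_box c0) _; rewrite lee_fin.
  rewrite (_ : (\sum_(i < n) _)%R = (D / r ^+ 2)%R); last first.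
    rewrite /D mulr_suml; apply: eq_bigr => i _; rewrite /c exprMn invfM mulrA //.
  rewrite ler_pdivrMr ?exprn_gt0// mulrC ler_pdivlMr//.
  have : (r <= r ^+ 2)%R by rewrite expr2 ler_peMr// ltW.
  by apply: le_trans; rewrite /r mulrC lerDl.
have pt s : s \in map (hmul h) l -> q%:E <= Pe_point sigma SH s + t%:E * v s + (n%:R^-1)%:E.
  move=> sl; have [Ss sb] := lS s sl.
  rewrite -qE; apply: le_trans (Pe_point_lower c cSH (ltW t0) sb) _.
  by rewrite leeD2l.
have vol : \sum_(s <- map (hmul h) l) v s <= (\prod_(i < n) tnth h i * (a + 2 * r) ^+ n)%:E.
  apply: le_trans (sum_voronoi_le cSH _ _ (measurable_box _)) _.
  - by rewrite map_inj_uniq//; exact: hmul_inj.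
  - by move=> s /lS[].
  rewrite iint_box; last by move=> i; rewrite addr_ge0 ?(ltW (c0 i))// mulr_ge0 ?divr_ge0 ?(ltW a0) ?(ltW (h0 i)).
  rewrite lee_fin (eq_bigr (fun i => tnth h i * (a + 2 * r))%R); last by move=> i _; rewrite /b /c; field.
  by rewrite big_split /= prodr_const card_ord.
have pw : ((a + 2 * r) ^+ n <= 3 / 2 * a ^+ n)%R.
  have -> : (a + 2 * r = (1 + 2 * r / a) * a)%R by field; rewrite gt_eqF.
  rewrite exprMn ler_wpM2r ?exprn_ge0 ?(ltW a0)//.
  apply: (@le_trans _ _ (expR (2 * r / a) ^+ n)%R).
    by rewrite lerXn2r ?nnegrE ?expR_ge0 ?expR_ge1Dx// addr_ge0// divr_ge0 ?mulr_ge0 ?(ltW a0) ?(ltW r0).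
  rewrite -expRM_natl -[leRHS](@lnK R) ?posrE ?divr_gt0// ler_expR.
  rewrite mulrC mulrAC ler_pdivrMr// -ler_pdivrMl// mulrC; exact: ltW.
have sumq : q%:E * M%:R%:E <= \sum_(s <- map (hmul h) l) Pe_point sigma SH s +
    t%:E * \sum_(s <- map (hmul h) l) v s + (n%:R^-1)%:E * M%:R%:E.
  have v0 s : 0 <= v s by apply: iint_ge0 => y; rewrite lee_fin.
  have -> : M%:R%:E = \sum_(s <- map (hmul h) l) (1 : \bar R) by rewrite sum1_size size_map.
  rewrite !ge0_sume_distrr//.
  rewrite -!big_split /= [leLHS]big_seq [leRHS]big_seq; apply: lee_sum => s sl.
  by rewrite !mule1; exact: pt.
have tv : t%:E * \sum_(s <- map (hmul h) l) v s <= (3 / n%:R * M%:R)%:E.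
  apply: le_trans (lee_wpmul2l _ vol) _; first by rewrite lee_fin ltW.
  rewrite -EFinM lee_fin /t; set det := (\prod_(i < n) _)%R in det0 *.
  rewrite (_ : (gam / (n%:R * det) * _ = gam / n%:R * (a + 2 * r) ^+ n)%R); last by field; rewrite !gt_eqF.
  apply: le_trans (ler_wpM2l _ pw) _; first by rewrite divr_ge0 ?ltW.
  rewrite [leRHS]mulrAC [leLHS](_ : _ = 3 * (gam / 2 * a ^+ n) / n%:R)%R; last by field; rewrite gt_eqF.
  by rewrite ler_pM2r ?invr_gt0// ler_wpM2l.
rewrite -EFinM mulrBl EFinB leeBlDr//; rewrite EFinM.
apply: le_trans sumq _; rewrite -addeA leeD2l//.
apply: le_trans (leeD2r _ tv) _; rewrite -EFinM -EFinD lee_fin.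
by rewrite le_eqVlt; apply/orP; left; apply/eqP; field; rewrite gt_eqF.
Qed.

End ConditionalConverse.

(** * Converse averaged over the fading *)

Section Converse.
Context {R : realType}.
Variables (f : R -> R) (sigma : R).
Hypothesis rf : regular_fading_pdf f.
Hypothesis sigma0 : 0 < sigma.
Local Notation leb := (@lebesgue_measure R).
Local Notation g := (@gauss_n R _ sigma).
Local Open Scope ereal_scope.

Let mf : measurable_fun setT f. Proof. by case: rf. Qed.
Let f0 x : (0 <= f x)%R. Proof. by case: rf => _ []. Qed.
Let fneg x : (x < 0)%R -> f x = 0%R. Proof. by case: rf => _ [_ [H _]]; exact: H. Qed.
Let f1 : \int[leb]_x (f x)%:E = 1. Proof. by case: rf => _ [_ [_ [H _]]]. Qed.

Definition positive_orthant n : set (n.-tuple R) := [set h | forall i, (0 < tnth h i)%R].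

Lemma measurable_positive_orthant n : measurable (@positive_orthant n).
Proof.
rewrite (_ : @positive_orthant n = \bigcap_(i in [set: 'I_n]) [set h : n.-tuple R | (0 < tnth h i)%R]); last first.
  by apply/seteqP; split => [y H i _|y H i]; [exact: H|exact: H].
apply: fin_bigcap_measurable => // i _.
rewrite (_ : [set y | _] = ~` [set y : n.-tuple R | (tnth y i <= 0)%R]); last first.
  by apply/seteqP; split => y /=; rewrite ltNge => /negP.
by apply: measurableC; apply: measurable_lepred => //; exact: measurable_tnth.
Qed.

Lemma fg_expect_fst n (G : n.-tuple R -> \bar R) : (forall h, 0 <= G h) ->
  fg_expect f sigma (fun p : n.-tuple R * n.-tuple R => G p.1) =
  iint (fun h => (fading_n f h)%:E * G h).
Proof.
move=> G0; apply: eq_iint => h; congr (_ * _) => /=.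
rewrite -[RHS]mule1 -(iint_gauss sigma n) -iintZl//.
- by apply: eq_iint => z; rewrite muleC.
- by move=> z; rewrite lee_fin gauss_n_ge0.
- exact: measurable_gauss_EFin.
Qed.

Lemma integral_fading_fst (P : probability (measurableTypeR R * measurableTypeR R)%type R) :
  (forall u : R * R -> \bar R, measurable_fun setT u -> (forall p, 0 <= u p) ->
     \int[P]_p u p = \int[leb]_h ((f h)%:E * \int[leb]_z ((normal_pdf 0 sigma z)%:E * u (h, z)))) ->
  forall w : R -> R, measurable_fun setT w -> (forall h, (0 <= w h)%R) ->
  \int[P]_p (w p.1)%:E = \int[leb]_h (f h * w h)%:E.
Proof.
move=> PE w mw w0; rewrite PE; last 2 first.
- by apply/measurable_EFinP; apply: (measurableT_comp mw); exact: measurable_fst.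
- by move=> p; rewrite lee_fin.
apply: eq_integral => h _; rewrite EFinM; congr (_ * _) => /=.
have mN : measurable_fun setT (fun z : R => (normal_pdf 0 sigma z)%:E).
  by apply/measurable_EFinP; exact: measurable_normal_pdf.
under eq_integral do rewrite muleC.
rewrite (@ge0_integralZl _ _ _ leb setT measurableT _ mN) ?lee_fin//.
- by rewrite integral_normal_pdf mule1.
- by move=> z _; rewrite lee_fin normal_pdf_ge0.
Qed.

(** Negative h carry no density, and h = 0 is a single point, whatever the value of the density
    there. *)
Lemma integral_nonpositive_fading : \int[leb]_h (f h * \1_[set h : R | (h <= 0)%R] h)%:E = 0.
Proof.
rewrite -[RHS](@integral_Sset1 R (fun h => (f h)%:E) [set 0%R] 0%R)//.
rewrite [RHS]integral_mkcond; apply: eq_integral => h _; rewrite /patch indicE.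
have [h0|h0|->] := ltgtP h 0%R.
- by rewrite fneg// mul0r memNset//= => h00; rewrite h00 ltxx in h0.
- rewrite memNset ?mulr0 ?memNset//=; last by apply/negP; rewrite -ltNge.
  by move=> h00; rewrite h00 ltxx in h0.
- by rewrite !mem_set//= ?mulr1.
Qed.

(** A union bound over the coordinates. It allows h > 0 to be assumed wherever diag(h) is inverted
    or ln h is taken. *)
Lemma nonpositive_fading_null n :
  iint (fun h : n.-tuple R => (fading_n f h)%:E * (\1_(~` @positive_orthant n) h : R)%:E) = 0.
Proof.
have [P PE] := fading_gauss_probability sigma mf f0 f1.
pose u (p : R * R) := (\1_[set h : R | (h <= 0)%R] p.1 : R)%:E.
have mw : measurable_fun setT (\1_[set h : R | (h <= 0)%R] : R -> R).
  by apply: measurable_indic; exact: measurable_le_set.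
have mu : measurable_fun setT u.
  by apply/measurable_EFinP; apply: (measurableT_comp mw); exact: measurable_fst.
have u0 p : 0 <= u p by rewrite lee_fin.
have Pu : \int[P]_p u p = 0.
  by rewrite (integral_fading_fst PE mw)// integral_nonpositive_fading.
apply/eqP; rewrite eq_le; apply/andP; split; last first.
  by apply: iint_ge0 => h; rewrite -EFinM lee_fin mulr_ge0// fading_n_ge0.
rewrite -fg_expect_fst; last by move=> h; rewrite lee_fin.
have <- : fg_expect f sigma (fun p : n.-tuple R * n.-tuple R => \sum_(i < n) u (tnth p.1 i, tnth p.2 i)) = 0.
  by rewrite (fg_expect_sum mf f0 PE)// big1.
apply: le_fg_expect => // h z _ /=.
have [H|H] := pselect (@positive_orthant n h).
  rewrite indicE memNset ?sume_ge0//; exact.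
have [i hi] : exists i, ~~ (0 < tnth h i)%R.
  by apply/not_existsP => H'; apply: H => i; apply/negPn/negP; exact: H'.
rewrite (bigD1 i)//= (le_trans _ (leeDl _ _)) ?sume_ge0//.
by rewrite /u !indicE mem_set// mem_set//= leNgt.
Qed.

Lemma ln_normal_pdf (z : R) :
  ln (normal_pdf 0 sigma z) = (2^-1 - 2^-1 * ln (2 * pi * expR 1 * sigma ^+ 2) - z ^+ 2 / (2 * sigma ^+ 2))%R.
Proof.
have k0 : (0 < sigma ^+ 2 * pi *+ 2)%R by rewrite pmulrn_lgt0// mulr_gt0 ?pi_gt0 ?exprn_gt0.
have s0 : (0 < Num.sqrt (sigma ^+ 2 * pi *+ 2))%R by rewrite sqrtr_gt0.
rewrite normal_pdf0E// /normal_peak.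
have -> : ln ((Num.sqrt (sigma ^+ 2 * pi *+ 2))^-1 * expR (- (z ^+ 2 / (2 * sigma ^+ 2)))) =
    (- ln (Num.sqrt (sigma ^+ 2 * pi *+ 2)) - z ^+ 2 / (2 * sigma ^+ 2))%R.
  by rewrite lnM ?posrE ?expR_gt0 ?invr_gt0// lnV ?posrE// expRK.
rewrite (_ : 2 * pi * expR 1 * sigma ^+ 2 = Num.sqrt (sigma ^+ 2 * pi *+ 2) ^+ 2 * expR 1)%R; last first.
  by rewrite sqr_sqrtr ?(ltW k0)// -mulr_natl; ring.
rewrite lnM ?posrE ?expR_gt0 ?exprn_gt0// expRK lnXn// -mulr_natl.
by field; rewrite gt_eqF.
Qed.

Lemma normal_pdf0_gt0 (z : R) : (0 < normal_pdf 0 sigma z)%R.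
Proof.
rewrite normal_pdf0E// mulr_gt0 ?expR_gt0// invr_gt0 sqrtr_gt0 pmulrn_lgt0//.
by rewrite mulr_gt0 ?pi_gt0 ?exprn_gt0.
Qed.

Lemma sum_log_density n (h z : n.-tuple R) : @positive_orthant n h ->
  (\sum_(i < n) log_density sigma (tnth h i, tnth z i) = ln (\prod_(i < n) tnth h i * g z))%R.
Proof.
move=> h0; rewrite /gauss_n -big_split /=.
suff H : forall l : seq 'I_n, (\sum_(i <- l) log_density sigma (tnth h i, tnth z i) =
    ln (\prod_(i <- l) (tnth h i * normal_pdf 0 sigma (tnth z i))))%R by exact: H.
elim=> [|i l IH]; first by rewrite !big_nil ln1.
rewrite !big_cons IH lnM ?posrE//; last 2 first.
- by rewrite mulr_gt0 ?normal_pdf0_gt0.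
- by apply: prodr_gt0 => j _; rewrite mulr_gt0 ?normal_pdf0_gt0.
congr (_ + _)%R; rewrite lnM ?posrE ?normal_pdf0_gt0// ln_normal_pdf /log_density delta_HE//=.
by ring.
Qed.

Lemma measurable_sum_log_density n : measurable_fun setT (fun q : n.-tuple R * n.-tuple R =>
  \sum_(i < n) log_density sigma (tnth q.1 i, tnth q.2 i))%R.
Proof.
apply: measurable_sum => i; apply: (measurableT_comp (measurable_log_density sigma)).
by apply/measurable_fun_pair => /=; [apply: (measurableT_comp (measurable_tnth i))|
  apply: (measurableT_comp (measurable_tnth i))].
Qed.

Lemma iint_fading n : iint (fun h : n.-tuple R => (fading_n f h)%:E) = 1.
Proof.
rewrite /fading_n (eq_iint (G := fun z : n.-tuple R => \prod_(i < n) (f (tnth z i))%:E)); last first.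
  by move=> z; rewrite prodEFin.
rewrite (iint_prod (F := fun _ x => (f x)%:E)).
- by rewrite big1// => i _.
- by move=> i x; rewrite lee_fin.
- by move=> i; apply/measurable_EFinP.
Qed.

Lemma Pe_given_H_ge0 n (S : set (n.-tuple R)) h : 0 <= Pe_given_H sigma S h.
Proof.
apply: le_elimsup => A; exists (A + 1)%R; first by rewrite ltrDl.
by rewrite mule_ge0 ?inve_ge0 ?esum_ge0// => x _; exact: Pe_point_ge0.
Qed.

(** The conditional lower bound is averaged over h without measurability of [Pe_given_H]: additivity
    is used for a measurable minorant only, and monotonicity passes from it to [Pe_IC]. *)
Theorem converse_bound n (S : set (n.-tuple R)) (gam eps : R) : (0 < n)%N ->
  IC_with_density S gam -> Pe_IC f sigma S <= eps%:E ->
  fg_expect f sigma (fun q : n.-tuple R * n.-tuple R =>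
      (\1_[set w : R | (w <= ln gam - ln n%:R)%R] (\sum_(i < n) log_density sigma (tnth q.1 i, tnth q.2 i))%R)%:E)
    <= (eps + 4 / n%:R)%:E.
Proof.
move=> n0 [cS [gam0 dS]] Pe; set c := (ln gam - ln n%:R)%R.
have nR0 : (0 < n%:R :> R)%R by rewrite ltr0n.
pose F (q : n.-tuple R * n.-tuple R) :=
  (\1_[set w : R | (w <= c)%R] (\sum_(i < n) log_density sigma (tnth q.1 i, tnth q.2 i))%R)%:E : \bar R.
have mF : measurable_fun setT F.
  apply/measurable_EFinP; apply: (measurableT_comp _ (@measurable_sum_log_density n)).
  by apply: measurable_indic; exact: measurable_le_set.
have F0 q : 0 <= F q by rewrite lee_fin.
pose q h := iint (fun z : n.-tuple R => (g z)%:E * F (h, z)).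
have mq : measurable_fun setT q by exact: measurable_gauss_expect.
have q0 h : 0 <= q h by apply: iint_ge0 => z; rewrite mule_ge0// lee_fin gauss_n_ge0.
have q1 h : q h <= 1.
  rewrite -(iint_gauss sigma n); apply: le_iint => z; first by rewrite mule_ge0// lee_fin gauss_n_ge0.
  by rewrite -EFinM lee_fin ler_piMr ?gauss_n_ge0// indicE; case: (_ \in _).
have qfin h : (fine (q h))%:E = q h by rewrite fineK// ge0_fin_numE// (le_lt_trans (q1 h))// ltry.
pose r h := maxe (q h - (4 / n%:R)%:E) 0 * (\1_(@positive_orthant n) h : R)%:E.
have r0 h : 0 <= r h by rewrite mule_ge0 ?lee_fin// le_max lexx orbT.
have mpos := @measurable_positive_orthant n.
have mr : measurable_fun setT r.
  apply: emeasurable_funM; last exact: measurable_indic_EFin.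
  by apply: measurable_maxe => //; exact: emeasurable_funB.
have mff : measurable_fun setT (fun h : n.-tuple R => (fading_n f h)%:E).
  by apply/measurable_EFinP; exact: measurable_fading_n.
have ff0 (h : n.-tuple R) : 0 <= (fading_n f h)%:E by rewrite lee_fin fading_n_ge0.
have n40 : (0 <= 4 / n%:R :> R)%R by rewrite divr_ge0.
have rPe h : r h <= Pe_given_H sigma S h.
  rewrite /r; have [hp|hp] := pselect (@positive_orthant n h); last first.
    by rewrite indicE memNset// mule0; exact: Pe_given_H_ge0.
  rewrite indicE mem_set// mule1 ge_max; apply/andP; split; last exact: Pe_given_H_ge0.
  rewrite -qfin -EFinB; apply: (Pe_given_H_lower sigma0 n0 cS gam0 dS hp).
  rewrite qfin /q; apply: eq_iint => z; congr (_ * _%:E); rewrite /F !indicE.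
  congr (_%:R); congr nat_of_bool.
  have det0 : (0 < \prod_(i < n) tnth h i)%R by apply: prodr_gt0 => i _.
  have gz0 : (0 < g z)%R by apply: prodr_gt0 => i _; exact: normal_pdf0_gt0.
  have E : (ln (\prod_(i < n) tnth h i * g z) <= c)%R = (g z <= gam / (n%:R * \prod_(i < n) tnth h i))%R.
    rewrite /c -ln_div ?posrE// ler_ln ?posrE ?mulr_gt0 ?divr_gt0 ?invr_gt0//.
    rewrite ler_pdivlMr// [RHS]ler_pdivlMr ?mulr_gt0//.
    by congr (_ <= _)%R; ring.
  apply/idP/idP; rewrite !inE /= (sum_log_density _ hp) E //.
rewrite -/F /fg_expect -/q.
apply: (@le_trans _ _ (iint (fun h : n.-tuple R => ((fading_n f h)%:E * r h + (4 / n%:R)%:E * (fading_n f h)%:E) +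
    (fading_n f h)%:E * (\1_(~` @positive_orthant n) h : R)%:E))).
  apply: le_iint => h; first by rewrite mule_ge0//; exact: q0.
  rewrite -/(q h) [(4 / n%:R)%:E * _]muleC -ge0_muleDr ?lee_fin// -ge0_muleDr ?lee_fin ?adde_ge0// lee_wpmul2l//.
  rewrite /r; have [hp|hp] := pselect (@positive_orthant n h).
    rewrite !indicE mem_set// memNset; last by move=> /(_ hp).
    by rewrite mule1 adde0 -leeBlDr// le_max lexx.
  rewrite !indicE memNset// [in X in _ <= X]mem_set// mule0 add0e.
  by rewrite (le_trans (q1 h))// leeDr// lee_fin.
rewrite iintD; last 4 first.
- by move=> h; apply: adde_ge0; apply: mule_ge0.
- by apply: emeasurable_funD; [exact: emeasurable_funM|exact: measurable_funeM].
- by move=> h; apply: mule_ge0; rewrite ?lee_fin// -lee_fin.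
- apply: emeasurable_funM => //; apply: measurable_indic_EFin; exact: measurableC.
rewrite nonpositive_fading_null adde0 iintD; last 4 first.
- by move=> h; rewrite mule_ge0.
- exact: emeasurable_funM.
- by move=> h; apply: mule_ge0; rewrite ?lee_fin// -lee_fin.
- exact: measurable_funeM.
rewrite iintZl ?lee_fin// iint_fading mule1 EFinD leeD2r//.
apply: le_trans Pe; apply: le_iint => h; first by rewrite mule_ge0.
by rewrite lee_wpmul2l.
Qed.

End Converse.

(** * Riemann sums of the Gaussian density *)

Section NormalRiemannSum.
Context {R : realType}.
Local Notation psi := (normal_pdf (0 : R) 1).
Local Notation Q := (@Qfun R).

Lemma normal_pdf01_le (u v : R) : `|v| <= `|u| -> psi u <= psi v.
Proof.
move=> vu; rewrite !normal_pdf01E ler_wpM2l ?invr_ge0// ler_expR lerN2 ler_pM2r//.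
by rewrite -[leLHS]real_normK ?num_real// -[leRHS]real_normK ?num_real// lerXn2r ?nnegrE.
Qed.

Lemma Qfun_drop (u x a : R) : 0 <= a -> (forall c, x <= c <= x + a -> `|c| <= `|u|) ->
  a * psi u <= Q x - Q (x + a).
Proof.
move=> a0 H; have xa : x <= x + a by rewrite lerDl.
have [c cI E] := @MVT_segment R Q (fun x => - psi x) x (x + a) xa
  (fun y _ => is_derive_Qfun y) (continuous_subspaceT (@continuous_Qfun R)).
rewrite -[leRHS]opprB E addrC addKr mulNr opprK mulrC ler_wpM2r//.
by apply: normal_pdf01_le; apply: H; rewrite in_itv/= in cI.
Qed.

(* The two terms nearest to the mode are charged to the jumps [a] of [T];
   every other term is bounded by the mass of the adjacent cell closer to 0. *)
Lemma normal_riemann_sum (a y : R) (N : nat) : 0 < a ->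
  \sum_(j < N) a * psi (y - a * j%:R) <= 1 + 2 * a.
Proof.
move=> a0; pose T u := if 0 <= u then 2 * a - Q u else
  if - a <= u then a - Q (u + a) else - Q (u + a).
have step u : a * psi u <= T u - T (u - a).
  have p1 : a * psi u <= a by rewrite ler_piMr ?(ltW a0)// normal_pdf01_le1.
  rewrite /T; have [u0|u0] := leP 0 u.
    have [ua|ua] := leP 0 (u - a).
      have := @Qfun_drop u (u - a) a (ltW a0); rewrite subrK => D.
      have {}D := D _; rewrite [leRHS](_ : _ = Q (u - a) - Q u); last by ring.
      apply: D => c /andP[c1 c2]; rewrite !ger0_norm//; exact: le_trans c1.
    have -> : - a <= u - a by lra.
    by rewrite subrK; lra.
  have -> : (0 <= u - a) = false by apply/negbTE; rewrite -ltNge; lra.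
  have [ua|ua] := leP (- a) u.
    have -> : (- a <= u - a) = false by apply/negbTE; rewrite -ltNge; lra.
    rewrite subrK; have : Q (u + a) <= Q u.
      rewrite -subr_ge0; apply: le_trans (@Qfun_drop (`|u| + a) u a (ltW a0) _).
        by rewrite mulr_ge0 ?normal_pdf_ge0 ?ltW.
      move=> c /andP[c1 c2]; rewrite [leRHS]ger0_norm ?addr_ge0 ?(ltW a0)// ler_norml.
      by have := ler_norm u; have := ler_norm (- u); rewrite normrN; lra.
    by lra.
  have -> : (- a <= u - a) = false by apply/negbTE; rewrite -ltNge; lra.
  rewrite subrK; have := @Qfun_drop u u a (ltW a0); rewrite [in X in _ -> X]addrC opprK; apply.
  by move=> c /andP[c1 c2]; rewrite !ler0_norm; lra.
apply: (@le_trans _ _ (\sum_(j < N) (T (y - a * j%:R) - T (y - a * j.+1%:R)))).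
  by apply: ler_sum => j _; apply: le_trans (step _) _; rewrite -natr1 mulrDr mulr1 opprD addrA.
have -> : \sum_(j < N) (T (y - a * j%:R) - T (y - a * j.+1%:R)) = T y - T (y - a * N%:R).
  elim: N => [|N IH]; first by rewrite big_ord0 mulr0 subr0 subrr.
  by rewrite big_ord_recr /= IH addrA subrK.
have Tle u : T u <= 2 * a.
  have := Qfun_ge0 u; have := Qfun_ge0 (u + a).
  by rewrite /T; case: ifP => _; [|case: ifP => _]; lra.
have Tge u : - 1 <= T u.
  have := Qfun_le1 u; have := Qfun_le1 (u + a).
  by rewrite /T; case: ifP => _; [|case: ifP => _]; lra.
by have := Tle y; have := Tge (y - a * N%:R); lra.
Qed.

Lemma normal_pdf_scale (sigma x : R) : 0 < sigma ->
  normal_pdf 0 sigma x = psi (x / sigma) / sigma.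
Proof.
move=> s0; rewrite normal_pdf0E// normal_pdf01E /normal_peak.
have -> : Num.sqrt (sigma ^+ 2 * pi *+ 2) = sigma * Num.sqrt (pi *+ 2).
  by rewrite -mulrnAr sqrtrM ?sqr_ge0// sqrtr_sqr gtr0_norm.
have -> : (x / sigma) ^+ 2 / 2 = x ^+ 2 / (2 * sigma ^+ 2) by field; rewrite gt_eqF.
by rewrite invfM; ring.
Qed.

Lemma normal_pdf_riemann_sum (sigma a y : R) (N : nat) : 0 < sigma -> 0 < a ->
  \sum_(j < N) normal_pdf 0 sigma (y - a * j%:R) <= a^-1 * (1 + 2 * a / sigma).
Proof.
move=> s0 a0; rewrite ler_pdivlMl// mulr_sumr -mulrA.
apply: le_trans (normal_riemann_sum (y / sigma) N (divr_gt0 a0 s0)).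
rewrite le_eqVlt; apply/orP; left; apply/eqP; apply: eq_bigr => j _.
rewrite normal_pdf_scale// (_ : (y - a * j%:R) / sigma = y / sigma - a / sigma * j%:R); last by ring.
by ring.
Qed.

End NormalRiemannSum.

(** * Construction A lattices and the counting of errors *)

Section LatticeCounting.
Context {R : realType}.
Variables (m p : nat) (beta sigma : R).
Hypothesis p_prime : prime p.
Hypothesis beta0 : 0 < beta.
Hypothesis sigma0 : 0 < sigma.
Local Notation n := m.+1.
Local Notation g := (@gauss_n R n sigma).
Local Notation code := {ffun 'I_m -> 'I_p}.

Definition int_point (c : {ffun 'I_n -> int}) : n.-tuple R := [tuple beta * (c i)%:~R | i < n].

(* Construction A: c modulo p is a multiple of (1, v). *)
Definition code_word (v : code) (c : {ffun 'I_n -> int}) : Prop :=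
  forall i : 'I_m, (p%:Z %| c (lift ord0 i) - (v i : nat)%:Z * c ord0)%Z.

Definition lattice (v : code) : set (n.-tuple R) := int_point @` [set c | code_word v c].

(** The received lattice point h x beats the origin. By linearity, errors at the origin are the only
    ones to be studied. *)
Definition closer (h : n.-tuple R) (z : n.-tuple R) (x : n.-tuple R) : Prop :=
  dist2 z (hmul h x) < \sum_(i < n) tnth z i ^+ 2.

Lemma gauss_n_le (y z : n.-tuple R) : \sum_(i < n) tnth y i ^+ 2 <= \sum_(i < n) tnth z i ^+ 2 ->
  g z <= g y.
Proof.
have E (x : n.-tuple R) : g x = (normal_peak sigma) ^+ n *
    expR (- ((\sum_(i < n) tnth x i ^+ 2) / (2 * sigma ^+ 2))).
  rewrite /gauss_n mulr_suml -sumrN expR_sum -[X in _ ^+ X]card_ord -prodr_const -big_split /=.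
  by apply: eq_bigr => i _; rewrite normal_pdf0E.
move=> yz; rewrite !E ler_wpM2l ?exprn_ge0 ?normal_peak_ge0// ler_expR lerN2.
by rewrite ler_pM2r// invr_gt0 mulr_gt0 ?exprn_gt0.
Qed.

(** c_0 is invertible modulo p, so it determines v_i from c_i; two representatives below p that are
    congruent modulo p are equal. *)
Lemma code_word_unique (v w : code) (c : {ffun 'I_n -> int}) : ~~ (p%:Z %| c ord0)%Z ->
  code_word v c -> code_word w c -> v = w.
Proof.
move=> pc vc wc; apply/ffunP => i; apply/ord_inj.
have D : (p%:Z %| ((v i : nat)%:Z - (w i : nat)%:Z) * c ord0)%Z.
  have := rpredB (wc i) (vc i).
  by rewrite (_ : _ - _ - _ = ((v i : nat)%:Z - (w i : nat)%:Z) * c ord0) //; ring.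
have {}D : (p%:Z %| (v i : nat)%:Z - (w i : nat)%:Z)%Z.
  have cop : coprimez p%:Z (c ord0) by rewrite coprimezE prime_coprime.
  by rewrite -(Gauss_dvdzl _ cop).
have vi := ltn_ord (v i); have wi := ltn_ord (w i).
move: D => /dvdzP[q]; move: (v i : nat) (w i : nat) vi wi => a b ap bp E.
have : q = 0 by nia.
by move=> q0; move: E; rewrite q0 mul0r => E; lia.
Qed.

(** If p divides c_0, it divides the whole code word, and such vectors lie in every lattice, so
    uniqueness fails for them. They are excluded geometrically: a nonzero coordinate is displaced by
    at least [L], while the noise coordinate stays below [L] / 2. *)
Lemma multiple_not_closer (h z : n.-tuple R) (c : {ffun 'I_n -> int}) :
  (forall i, 0 < tnth h i) -> (forall i, `|tnth z i| < tnth h i * (p%:R * beta) / 2) ->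
  (forall i, (p%:Z %| c i)%Z) -> ~ closer h z (int_point c).
Proof.
move=> h0 zL pc; apply/negP; rewrite -leNgt; apply: ler_sum => i _; rewrite !tnth_mktuple.
have /dvdzP[q ->] := pc i; have [->|q0] := eqVneq q 0; first by rewrite mul0r mulr0 mulr0 subr0.
rewrite -[leLHS]real_normK ?num_real// -[leRHS]real_normK ?num_real// lerXn2r ?nnegrE//.
set L := tnth h i * (p%:R * beta).
have -> : tnth h i * (beta * (q * p)%:~R) = L * q%:~R.
  by rewrite /L intrM; ring.
have L0 : 0 < L by rewrite !mulr_gt0// ltr0n prime_gt0.
have q1 : 1 <= `|q%:~R : R| by rewrite -intr_norm ler1z -gtz0_ge1 normr_gt0.
have := zL i; rewrite -/L => zi.
have : L <= `|L * q%:~R| by rewrite normrM gtr0_norm// ler_peMr// ltW.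
have := lerB_dist (L * q%:~R) (tnth z i); rewrite [`|L * _ - _|]distrC; lra.
Qed.

(* A witness of the error for v determines v, and g(z) <= g(z - h beta c) for it;
   the sum over a box of integer vectors factorizes into Riemann sums. *)
Lemma lattice_error_count (h z : n.-tuple R) (E : {set code}) :
  (forall i, 0 < tnth h i) -> (forall i, `|tnth z i| < tnth h i * (p%:R * beta) / 2) ->
  (forall v, v \in E -> exists2 x, lattice v x & closer h z x) ->
  #|E|%:R * g z <= \prod_(i < n) ((tnth h i * beta)^-1 * (1 + 2 * (tnth h i * beta) / sigma)).
Proof.
move=> h0 zL HE.
have [c Hc] : exists c : code -> {ffun 'I_n -> int}, forall v, v \in E ->
    code_word v (c v) /\ closer h z (int_point (c v)).
  have H v : exists cv : {ffun 'I_n -> int}, v \in E -> code_word v cv /\ closer h z (int_point cv).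
    have [vE|vE] := boolP (v \in E); last by exists [ffun=> 0].
    by have [_ [cv vcv <-] cl] := HE v vE; exists cv.
  by exists (fun v => projT1 (cid (H v))) => v; exact: (projT2 (cid (H v))).
(* One cube of integers contains the finitely many chosen witnesses; the shift by [K] makes their
   coordinates elements of ['I_N]. *)
pose K := (\sum_(v : code) \sum_(i < n) `|c v i|%N)%N.
have cK v i : (`|c v i| <= K)%N.
  rewrite /K (bigD1 v)//= (bigD1 i)//= -addnA; exact: leq_addr.
pose N := (2 * K).+1.
pose e v : {ffun 'I_n -> 'I_N} := [ffun i => inord `|c v i + K%:Z|].
have eE v i : (e v i : nat)%:Z = c v i + K%:Z.
  by rewrite ffunE inordK; have := cK v i; rewrite /N; lia.
have einj : {in E &, injective e}.
  move=> v w vE wE ew; have cvw : c v = c w.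
    by apply/ffunP => i; have := eE v i; rewrite ew eE => /addIr.
  have [vc cl] := Hc v vE; have [wc _] := Hc w wE; rewrite -cvw in wc.
  apply: (code_word_unique _ vc wc); apply/negP => p0.
  apply: multiple_not_closer h0 zL _ cl => i.
  case: (unliftP ord0 i) => [j ->|-> //].
  by have := rpredD (vc j) (dvdz_mull (v j : nat)%:Z p0); rewrite subrK.
pose F (f : {ffun 'I_n -> 'I_N}) := \prod_(i < n)
  normal_pdf 0 sigma (tnth z i + tnth h i * beta * K%:R - tnth h i * beta * (f i : nat)%:R).
have F0 f : 0 <= F f by apply: prodr_ge0 => i _; exact: normal_pdf_ge0.
apply: (@le_trans _ _ (\sum_(v in E) F (e v))).
  rewrite mulrC mulr_natr -sumr_const; apply: ler_sum => v vE.
  have [_ cl] := Hc v vE.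
  have -> : F (e v) = g [tuple tnth z i - tnth h i * (beta * (c v i)%:~R) | i < n].
    apply: eq_bigr => i _; rewrite tnth_mktuple; congr normal_pdf.
    have -> : (e v i : nat)%:R = (c v i)%:~R + K%:R :> R by rewrite pmulrn eE intrD.
    by ring.
  apply: gauss_n_le; apply: ltW; move: cl; rewrite /closer /dist2.
  by under eq_bigr do rewrite !tnth_mktuple; under [X in _ -> X < _]eq_bigr do rewrite tnth_mktuple.
apply: (@le_trans _ _ (\sum_f F f)).
  rewrite -(big_imset _ einj) [leRHS](bigID (mem (e @: E)))/= lerDl.
  by apply: sumr_ge0 => f _.
have := bigA_distr_bigA (fun i (j : 'I_N) => normal_pdf 0 sigma
  (tnth z i + tnth h i * beta * K%:R - tnth h i * beta * (j : nat)%:R)).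
rewrite -/F => <-; apply: ler_prod => i _; apply/andP; split.
  by apply: sumr_ge0 => j _; exact: normal_pdf_ge0.
by apply: normal_pdf_riemann_sum => //; rewrite mulr_gt0.
Qed.

End LatticeCounting.

(** * Density and error probability of a lattice *)

Section LatticeDensity.
Context {R : realType}.
Variables (m p : nat) (beta : R).
Hypothesis p_prime : prime p.
Hypothesis beta0 : 0 < beta.
Local Notation n := m.+1.
Local Notation code := {ffun 'I_m -> 'I_p}.

Lemma lattice_countable (v : code) : countable (lattice beta v).
Proof. exact: sub_countable (card_image_le _ _) (countableP _). Qed.

Lemma lattice_sub (v : code) (x y : n.-tuple R) : lattice beta v x -> lattice beta v y ->
  lattice beta v [tuple tnth x i - tnth y i | i < n].
Proof.
move=> [c /= vc <-] [d vd <-]; exists [ffun i => c i - d i] => /=.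
  move=> i; rewrite !ffunE; have := rpredB (vc i) (vd i).
  by rewrite (_ : _ - _ - _ = c (lift ord0 i) - d (lift ord0 i) - (v i : nat)%:Z * (c ord0 - d ord0))//; ring.
by apply: eq_from_tnth => i; rewrite !tnth_mktuple ffunE intrB mulrBr.
Qed.

Lemma int_point_inj : injective (@int_point R m beta).
Proof.
move=> c d cd; apply/ffunP => i; have := congr1 (fun x => tnth x i) cd.
by rewrite !tnth_mktuple => /(mulfI (lt0r_neq0 beta0)) /intr_inj.
Qed.

Lemma ecount_le_size k (A : set (k.-tuple R)) (s : seq (k.-tuple R)) : A `<=` [set` s] ->
  (ecount A <= (size s)%:R%:E)%E.
Proof.
move=> As; have finA : finite_set A by apply: sub_finite_set As _; exact: finite_seq.
rewrite -(fset_setK finA) ecount_seq ?finmap.fset_uniq// lee_fin ler_nat.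
apply: uniq_leq_size; first exact: finmap.fset_uniq.
by move=> x xA; apply: As; rewrite -[A](fset_setK finA).
Qed.

(* Odd p and N make the open cube contain exactly p N consecutive values of each c_i. *)
Lemma lattice_count_ge (v : code) (N : nat) : odd p -> odd N ->
  ((p * N ^ n)%N%:R%:E <= ecount (lattice beta v `&` @Cb R n (beta * (p * N)%N%:R)))%E.
Proof.
move=> op oN; have opN : odd (p * N) by rewrite oddM op oN.
pose s := (p * N)./2; have sE : (p * N = 2 * s + 1)%N.
  by rewrite -[LHS]odd_double_half opN -muln2 mulnC addnC.
have p0 : (p%:Z > 0)%R by rewrite ltz_nat prime_gt0.
pose T : finType := ('I_(p * N) * {ffun 'I_m -> 'I_N})%type.
pose c0 (t : T) : int := (t.1 : nat)%:Z - s%:Z.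
pose c (t : T) : {ffun 'I_n -> int} := [ffun i =>
  if unlift ord0 i is Some j then
    (((v j : nat)%:Z * c0 t + s%:Z) %% p%:Z)%Z + p%:Z * (t.2 j : nat)%:Z - s%:Z
  else c0 t].
have cE0 t : c t ord0 = c0 t by rewrite ffunE unlift_none.
have cES t j : c t (lift ord0 j) =
    (((v j : nat)%:Z * c0 t + s%:Z) %% p%:Z)%Z + p%:Z * (t.2 j : nat)%:Z - s%:Z.
  by rewrite ffunE liftK.
have cinj : injective c.
  move=> t t' tt'; have e0 : t.1 = t'.1.
    by apply/ord_inj; have := congr1 (fun f : {ffun _ -> _} => f ord0) tt'; rewrite /= !cE0 => /addIr[].
  have e1 : t.2 = t'.2.
    apply/ffunP => j; apply/ord_inj; have := congr1 (fun f : {ffun _ -> _} => f (lift ord0 j)) tt'.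
    rewrite /= !cES /c0 e0 => /addIr/addrI/(mulfI (lt0r_neq0 p0)) []//.
  by rewrite [t]surjective_pairing e0 e1 -surjective_pairing.
have cs t i : `|c t i| <= s%:Z.
  case: (unliftP ord0 i) => [j ->|->]; last first.
    by rewrite cE0 /c0; have := ltn_ord t.1; move: (t.1 : nat) => x; lia.
  rewrite cES; have := modz_ge0 ((v j : nat)%:Z * c0 t + s%:Z) (lt0r_neq0 p0).
  have := ltz_pmod ((v j : nat)%:Z * c0 t + s%:Z) p0.
  move: (_ %% _)%Z => q; have := ltn_ord (t.2 j); move: (t.2 j : nat) => x xN q1 q0.
  have : (p * x + p <= p * N)%N by rewrite -mulnSr leq_mul2l xN orbT.
  by move=> H; lia.
have -> : (p * N ^ n)%N = size [seq int_point beta (c t) | t <- enum {: T}].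
  by rewrite size_map -cardE card_prod card_ffun !card_ord expnS mulnA.
apply: ecount_ge.
  by rewrite map_inj_uniq ?enum_uniq// => t t' /int_point_inj /cinj.
move=> x /= /mapP[t _ ->]; split.
  exists (c t) => //= j; rewrite cES cE0.
  set A := (v j : nat)%:Z * c0 t; rewrite [X in X + _ - _ - _](_ : _ = A + s%:Z - ((A + s%:Z) %/ p%:Z)%Z * p%:Z); last first.
    by rewrite [X in X - _](divz_eq (A + s%:Z) p%:Z); ring.
  rewrite (_ : _ - _ = ((t.2 j : nat)%:Z - ((A + s%:Z) %/ p%:Z)%Z) * p%:Z); last by ring.
  exact: dvdz_mull.
move=> i; rewrite tnth_mktuple normrM gtr0_norm// -mulrA ltr_pM2l//.
rewrite -intr_norm ltr_pdivlMr//; have : (`|c t i|%:~R : R) <= s%:R.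
  by rewrite [s%:R]pmulrn ler_int.
by rewrite sE natrD natrM; lra.
Qed.

(** A crude count of all integer points in the cube, whose only purpose is that the density be
    finite. *)
Lemma lattice_count_le (v : code) (a : R) : 1 <= a ->
  (ecount (lattice beta v `&` @Cb R n a) <= (((beta^-1 + 1) * a) ^+ n)%:E)%E.
Proof.
move=> a1; have a0 : 0 < a by exact: lt_le_trans a1.
pose x := a / 2 / beta; have x0 : 0 <= x by rewrite !divr_ge0// ltW.
pose K := Num.truncn x; have /andP[K1 K2] := truncn_itv x0; rewrite -/K in K1 K2.
pose N := (2 * K).+1.
pose c (e : {ffun 'I_n -> 'I_N}) : {ffun 'I_n -> int} := [ffun i => (e i : nat)%:Z - K%:Z].
apply: (@le_trans _ _ (size [seq int_point beta (c e) | e <- enum {: {ffun 'I_n -> 'I_N}}])%:R%:E); last first.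
  rewrite size_map -cardE card_ffun !card_ord lee_fin natrX lerXn2r ?nnegrE//.
    by rewrite mulr_ge0 ?addr_ge0 ?invr_ge0 ?(ltW beta0) ?(ltW a0).
  have NE : N%:R = 2 * K%:R + 1 :> R by rewrite /N -natr1 natrM.
  have xE : 2 * x = beta^-1 * a by rewrite /x; field; rewrite gt_eqF.
  by rewrite NE [leRHS]mulrDl -xE mul1r; lra.
apply: ecount_le_size => _ [[d vd <-] dC] /=.
apply/mapP; exists [ffun i => inord `|d i + K%:Z|]; first by rewrite mem_enum.
congr int_point; apply/ffunP => i; rewrite !ffunE inordK.
  have : `|d i| <= K%:Z.
    have := dC i; rewrite tnth_mktuple normrM gtr0_norm// -ltr_pdivlMl// mulrC -/x => dx.
    have := lt_trans dx K2; rewrite -intr_norm [K.+1%:R]pmulrn ltr_int; lia.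
  by move=> dK; rewrite gez0_abs ?addrK//; move: (d i) dK => y; lia.
have : `|d i| <= K%:Z.
  have := dC i; rewrite tnth_mktuple normrM gtr0_norm// -ltr_pdivlMl// mulrC -/x => dx.
  have := lt_trans dx K2; rewrite -intr_norm [K.+1%:R]pmulrn ltr_int; lia.
by rewrite /N; lia.
Qed.

(** Cubes of side beta p N contain at least p N^n points, whence the lower bound. The exact density
    is not computed: a density larger than intended only helps. *)
Lemma lattice_density (v : code) : odd p -> exists2 g : R, IC_with_density (lattice beta v) g &
  p%:R / (beta * p%:R) ^+ n <= g.
Proof.
move=> op; have p0 : 0 < p%:R :> R by rewrite ltr0n prime_gt0.
have lo : ((p%:R / (beta * p%:R) ^+ n)%:E <= density (lattice beta v))%E.
  apply: le_elimsup => A; have bp0 : 0 < beta * p%:R by rewrite mulr_gt0.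
  have A0 : 0 <= `|A| / (beta * p%:R) by rewrite divr_ge0// ltW.
  pose N := (2 * Num.bound (`|A| / (beta * p%:R))).+1.
  have oN : odd N by rewrite /N -addn1 oddD oddM.
  have N0 : 0 < N%:R :> R by rewrite ltr0n.
  exists (beta * (p * N)%N%:R).
    rewrite natrM mulrA mulrC -ltr_pdivrMr// (le_lt_trans _ (lt_le_trans (archi_boundP A0) _))//.
      by rewrite ler_pM2r ?invr_gt0// ler_norm.
    by rewrite ler_nat /N; lia.
  have H := lattice_count_ge v op oN.
  have a0 : 0 < beta * (p * N)%N%:R by rewrite mulr_gt0// ltr0n muln_gt0 prime_gt0.
  rewrite lee_pdivlMr ?exprn_gt0//.
  apply: le_trans H; rewrite -EFinM lee_fin [(p * N)%N%:R]natrM natrM natrX mulrA [(_ * N%:R) ^+ n]exprMn.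
  by rewrite mulrA divfK// expf_neq0// gt_eqF.
have hi : (density (lattice beta v) <= ((beta^-1 + 1) ^+ n)%:E)%E.
  apply: (@elimsup_le _ _ _ 1) => a a1; have a0 : 0 < a by exact: lt_trans a1.
  rewrite lee_pdivrMr ?exprn_gt0// -EFinM -exprMn; exact: lattice_count_le (ltW a1).
have dfin : (fine (density (lattice beta v)))%:E = density (lattice beta v).
  rewrite fineK// ge0_fin_numE ?(le_lt_trans hi) ?ltry// (le_trans _ lo)// lee_fin.
  by rewrite divr_ge0 ?exprn_ge0 ?mulr_ge0 ?ltW.
exists (fine (density (lattice beta v))); last by rewrite -lee_fin dfin.
split; first exact: lattice_countable.
split; last by rewrite dfin.
rewrite -lte_fin dfin (lt_le_trans _ lo)// lte_fin divr_gt0// exprn_gt0// mulr_gt0//.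
Qed.

(** If y beats the transmitted point x, then y - x is a lattice vector that beats the origin for the
    same noise. So every point errs at most as often as the origin. *)
Lemma lattice_Pe_le (sigma : R) (v : code) (h : n.-tuple R) (q : R) :
  iint (fun z : n.-tuple R => (gauss_n sigma z)%:E *
    (\1_[set z | exists2 x, lattice beta v x & closer h z x] z : R)%:E)%E = q%:E ->
  (Pe_given_H sigma (lattice beta v) h <= q%:E)%E.
Proof.
move=> qE; apply: Pe_given_H_le.
  by rewrite -lee_fin -qE; apply: iint_ge0 => z; exact: gauss_indic_ge0.
move=> _ [x Lx <-]; rewrite -qE; apply: le_iint => z.
  by rewrite -EFinM lee_fin mulr_ge0// gauss_n_ge0.
rewrite -!EFinM lee_fin ler_wpM2l ?gauss_n_ge0// !indicE.
have [|_] := boolP (_ \in ~` _); last by rewrite ler0n.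
rewrite inE /= => /existsNP[_ /not_implyP[[y Ly <-] /negP]].
rewrite -ltNge => D; rewrite mem_set//=; exists [tuple tnth y i - tnth x i | i < n]; first exact: lattice_sub.
rewrite /closer; move: D; rewrite /dist2.
under eq_bigr do rewrite !tnth_mktuple; under [X in _ < X -> _]eq_bigr do rewrite !tnth_mktuple.
under [X in _ -> X < _]eq_bigr do rewrite !tnth_mktuple.
rewrite (eq_bigr (fun i => (tnth z i - tnth h i * (tnth y i - tnth x i)) ^+ 2)).
  rewrite [X in _ < X -> _](eq_bigr (fun i => tnth z i ^+ 2))//.
  by move=> i _; congr (_ ^+ 2); ring.
by move=> i _; congr (_ ^+ 2); ring.
Qed.

End LatticeDensity.

(** * Random lattices *)

Section Achievability.
Context {R : realType}.
Variables (f : R -> R) (sigma : R).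
Hypothesis rf : regular_fading_pdf f.
Hypothesis sigma0 : 0 < sigma.
Local Notation leb := (@lebesgue_measure R).
Local Notation g := (@gauss_n R _ sigma).
Local Open Scope ereal_scope.

Let mf : measurable_fun setT f. Proof. by case: rf. Qed.
Let f0 x : (0 <= f x)%R. Proof. by case: rf => _ []. Qed.
Let f1 : \int[leb]_x (f x)%:E = 1. Proof. by case: rf => _ [_ [_ [H _]]]. Qed.
Let f2 : \int[leb]_x (f x * x ^+ 2)%:E = 1. Proof. by case: rf => _ [_ [_ [_ [H _]]]]. Qed.

Section WithLaw.
Variable P : probability (measurableTypeR R * measurableTypeR R)%type R.
Hypothesis PE : forall u : R * R -> \bar R, measurable_fun setT u -> (forall p, 0 <= u p) ->
  \int[P]_p u p = \int[leb]_h ((f h)%:E * \int[leb]_z ((normal_pdf 0 sigma z)%:E * u (h, z))).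

Lemma measurable_noise_dominates (k : R) :
  measurable [set q : measurableTypeR R * measurableTypeR R | (q.1 * k <= `|q.2|)%R].
Proof.
apply: measurable_lepred.
  by apply: measurable_funM => //; exact: measurable_fst.
by apply: measurableT_comp => //; exact: measurable_snd.
Qed.

(** The events decrease to {h <= 0}, a null event, so continuity from above suffices. A rate in k is
    dispensable, because the scale of the lattice is chosen after k0. *)
Lemma noise_dominates_rare (d : R) : (0 < d)%R -> exists2 k0, (0 < k0)%R & forall k, (k0 <= k)%R ->
  \int[P]_q (\1_[set q : R * R | (q.1 * k <= `|q.2|)%R] q)%:E <= d%:E.
Proof.
move=> d0; pose A (n : nat) := [set q : measurableTypeR R * measurableTypeR R | (q.1 * n%:R <= `|q.2|)%R].
have mA n : measurable (A n) by exact: measurable_noise_dominates.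
have mcap : measurable (\bigcap_n A n) by apply: bigcap_measurableType.
have capA : \bigcap_n A n = [set q : measurableTypeR R * measurableTypeR R | (q.1 <= 0)%R].
  apply/seteqP; split=> q /=; last first.
    by move=> q0 n _; rewrite /A /= (le_trans _ (normr_ge0 _))// mulr_le0_ge0.
  move=> H; rewrite leNgt; apply/negP => q0.
  have z0 : (0 <= `|q.2| / q.1)%R by rewrite divr_ge0// ltW.
  have := H (Num.bound (`|q.2| / q.1)) I; rewrite /A /= leNgt => /negP; apply.
  by rewrite mulrC -ltr_pdivrMr//; exact: archi_boundP.
have PA0 : P (\bigcap_n A n) = 0.
  have -> : P (\bigcap_n A n) = \int[P]_p (\1_[set h : R | (h <= 0)%R] p.1)%:E.
    transitivity (\int[P]_q (\1_(\bigcap_n A n) q)%:E).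
      by rewrite integral_indic ?setIT.
    by rewrite capA; apply: eq_integral => q _.
  rewrite (integral_fading_fst PE (w := \1_[set h : R | (h <= 0)%R]))//.
    exact: integral_nonpositive_fading.
  by apply: measurable_indic; exact: measurable_le_set.
have cvgA : P \o A @ \oo --> 0.
  rewrite -PA0; apply: nonincreasing_cvg_mu => //.
  - by rewrite -ge0_fin_numE// fin_num_measure.
  - move=> i j ij; apply/subsetPset => q; rewrite /A /=.
    have [q0|q0] := leP 0%R q.1; last by move=> _; rewrite (le_trans _ (normr_ge0 _))// mulr_le0_ge0// ltW.
    by apply: le_trans; rewrite ler_wpM2l// ler_nat.
have [_ cvgfA] := (fine_cvgP _ _).1 cvgA.
have [N _ HN] : \forall n \near \oo, (`|0 - (fine \o (P \o A)) n| < d)%R.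
  by move/cvgrPdist_lt : cvgfA => /(_ d d0).
exists N.+1%:R; first by rewrite ltr0n.
move=> k Nk; rewrite integral_indic// ?setIT; last exact: measurable_noise_dominates.
apply: (@le_trans _ _ (P (A N))).
  apply: le_measure; [by apply/mem_set; exact: measurable_noise_dominates|by apply/mem_set|].
  move=> q /=; rewrite /A /=.
  have [q0|q0] := leP 0%R q.1; last by move=> _; rewrite (le_trans _ (normr_ge0 _))// mulr_le0_ge0// ltW.
  by apply: le_trans; rewrite ler_wpM2l// (le_trans _ Nk)// ler_nat.
have := HN N (leqnn N); rewrite /= sub0r normrN ger0_norm ?fine_ge0// => /ltW.
by rewrite -lee_fin fineK// fin_num_measure.
Qed.

(** From |h| <= (1 + h^2) / 2 and E H^2 = 1. *)
Lemma expect_affine_le (k : R) : (0 <= k)%R -> \int[P]_q (1 + k * `|q.1|)%:E <= (1 + k)%:E.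
Proof.
move=> k0; rewrite (integral_fading_fst PE (w := fun h => 1 + k * `|h|)%R); last 2 first.
- by apply: measurable_funD => //; apply: measurable_funM => //; exact: measurableT_comp.
- by move=> h; rewrite addr_ge0// mulr_ge0.
have if_ : leb.-integrable setT (EFin \o f) by apply: integrable_finite; rewrite ?f1 ?ltry.
have if2 : leb.-integrable setT (EFin \o (fun h => f h * h ^+ 2)%R).
  apply: integrable_finite; rewrite ?f2 ?ltry//.
  - by apply: measurable_funM => //; exact: measurable_funX.
  - by move=> h; rewrite mulr_ge0 ?sqr_ge0.
have := integral_lincomb (1 + k / 2)%R (k / 2)%R 0%R if_ if2 if_ f1 f2 f1.
rewrite (_ : ((1 + k / 2) * 1 + k / 2 * 1 + 0 * 1)%R = (1 + k)%R); last by field.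
move=> <-; apply: lower_le_integral => h.
  by rewrite lee_fin mulr_ge0// addr_ge0// mulr_ge0.
rewrite lee_fin mul0r addr0.
have -> : ((1 + k / 2) * f h + k / 2 * (f h * h ^+ 2) = f h * (1 + k * ((1 + h ^+ 2) / 2)))%R by field.
rewrite ler_wpM2l// lerD2l ler_wpM2l// -[(h ^+ 2)%R]real_normK ?num_real//.
by have := sqr_ge0 (`|h| - 1)%R; nra.
Qed.

End WithLaw.

(** At fixed density beta is of order p^(-m/(m+1)), which tends to 0 because m > 0, while p beta is
    of order p^(1/(m+1)) and tends to infinity. A large prime thus gives a fine grid and, at the
    same time, far multiples of p. *)
Lemma lattice_scale (m : nat) (gam b L : R) :
  (0 < m)%N -> (0 < gam)%R -> (0 < b)%R -> (0 < L)%R ->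
  exists N : nat, forall p : nat, (N <= p)%N -> (0 < p)%N -> exists beta : R,
    [/\ (0 < beta)%R, (beta ^+ m.+1 = (gam * p%:R ^+ m)^-1)%R, (beta <= b)%R & (L <= p%:R * beta)%R].
Proof.
move=> m0 gam0 b0 L0.
have gb0 : (0 < gam * b ^+ m.+1)%R by rewrite mulr_gt0// exprn_gt0.
have gL0 : (0 < gam * L ^+ m.+1)%R by rewrite mulr_gt0// exprn_gt0.
(* The two summands are the thresholds on p for beta <= b and for p beta >= L. *)
pose X : R := ((gam * b ^+ m.+1)^-1 + gam * L ^+ m.+1)%R.
have X0 : (0 <= X)%R by apply: addr_ge0; rewrite ?invr_ge0; exact: ltW.
exists (Num.bound X) => p Np p0; have p0' : (0 < p%:R :> R)%R by rewrite ltr0n.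
have Xp : (X <= p%:R)%R by rewrite (le_trans (ltW (archi_boundP X0)))// ler_nat.
have p1 : (1 <= p%:R :> R)%R by rewrite ler1n.
have D0 : (0 < gam * p%:R ^+ m)%R by rewrite mulr_gt0// exprn_gt0.
pose beta : R := expR (- ln (gam * p%:R ^+ m) / m.+1%:R).
have beta0 : (0 < beta)%R by exact: expR_gt0.
have bn : (beta ^+ m.+1 = (gam * p%:R ^+ m)^-1)%R.
  by rewrite /beta -expRM_natl mulrC divfK ?pnatr_eq0// expRN lnK ?posrE.
exists beta; split=> //.
  rewrite -(ler_pXn2r (ltn0Sn m)) ?nnegrE ?(ltW b0) ?(ltW beta0)// bn.
  rewrite -[leRHS]invrK lef_pV2 ?posrE ?invr_gt0 ?exprn_gt0//.
  have H : ((gam * b ^+ m.+1)^-1 <= p%:R)%R by apply: le_trans Xp; rewrite lerDl ltW.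
  rewrite invfM ler_pdivrMl// in H; rewrite (le_trans H)// ler_wpM2l ?(ltW gam0)//.
  by rewrite -[leLHS]expr1 ler_weXn2l.
rewrite -(ler_pXn2r (ltn0Sn m)) ?nnegrE ?mulr_ge0 ?(ltW L0) ?(ltW beta0)//.
rewrite exprMn bn [(p%:R ^+ m.+1)%R]exprS (_ : p%:R * p%:R ^+ m * _ = p%:R / gam)%R; last first.
  by field; rewrite gt_eqF//= expf_neq0// gt_eqF.
rewrite ler_pdivlMr// mulrC; apply: le_trans Xp; by rewrite lerDr invr_ge0 ltW.
Qed.


Section RandomLattice.
Variables (m p : nat) (beta gam : R).
Hypothesis p_prime : prime p.
Hypothesis beta0 : (0 < beta)%R.
Hypothesis gam0 : (0 < gam)%R.
Hypothesis betaE : (beta ^+ m.+1 = (gam * p%:R ^+ m)^-1)%R.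
Local Notation n := m.+1.
Local Notation code := {ffun 'I_m -> 'I_p}.
Local Notation c := (ln gam + ln n%:R)%R.

(** Fading outside the positive orthant is declared an error. It has probability 0, and there the
    trivial bound 1 on the conditional error probability is used. *)
Definition error_event (v : code) : set (n.-tuple R * n.-tuple R) :=
  [set q | ~ @positive_orthant R n q.1 \/ exists2 x, lattice beta v x & closer q.1 q.2 x].

Definition low_density_event : set (n.-tuple R * n.-tuple R) :=
  [set q | (\sum_(i < n) log_density sigma (tnth q.1 i, tnth q.2 i) <= c)%R].

Definition outside_cell (i : 'I_n) : set (n.-tuple R * n.-tuple R) :=
  [set q | (tnth q.1 i * (p%:R * beta / 2) <= `|tnth q.2 i|)%R].

Lemma Pe_lattice_le (v : code) : Pe_IC f sigma (lattice beta v) <=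
  fg_expect f sigma (fun q => (\1_(error_event v) q : R)%:E).
Proof.
apply: le_iint => h.
  by rewrite mule_ge0 ?lee_fin ?fading_n_ge0//; exact: Pe_given_H_ge0.
rewrite lee_wpmul2l ?lee_fin ?fading_n_ge0//.
have [hp|hp] := pselect (@positive_orthant R n h); last first.
  apply: le_trans (Pe_given_H_le1 sigma _ _) _; rewrite -(iint_gauss sigma n).
  apply: le_iint => z; first by rewrite lee_fin gauss_n_ge0.
  by rewrite indicE mem_set ?mule1//; left.
rewrite (eq_iint (G := fun z : n.-tuple R => (g z)%:E *
  (\1_[set z | exists2 x, lattice beta v x & closer h z x] z : R)%:E)); last first.
  move=> z; congr (_ * _%:E); rewrite !indicE; congr (_%:R); congr nat_of_bool.
  by apply/idP/idP; rewrite !inE /= /error_event /=; [case|right].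
set I := iint _; have I0 : 0 <= I by apply: iint_ge0 => z; exact: gauss_indic_ge0.
have IE : (fine I)%:E = I.
  by rewrite fineK// ge0_fin_numE// (le_lt_trans (gauss_indic_le1 sigma _))// ltry.
by rewrite -IE; apply: lattice_Pe_le; rewrite IE.
Qed.

(** On each exceptional event the right side is at least p^m, the number of codes. Elsewhere det h
    g(z) > n gam, and dividing the bound of [lattice_error_count] by it yields the factor 1 / n; the
    normalization of beta turns beta^(-n) into gam p^m. *)
Lemma sum_error_le (h z : n.-tuple R) :
  (\sum_(v : code) \1_(error_event v) (h, z) <= (p ^ m)%N%:R *
   (\1_low_density_event (h, z) + \sum_(i < n) \1_(outside_cell i) (h, z) +
    \1_(~` @positive_orthant R n) h +
    n%:R^-1 * \prod_(i < n) (1 + 2 * beta / sigma * `|tnth h i|)))%R.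
Proof.
set T1 := \1_low_density_event _; set T2 := (\sum_(i < n) \1_(outside_cell i) (h, z))%R.
set T3 := \1_(~` _) h; set T4 := (n%:R^-1 * _)%R.
have T10 : (0 <= T1 :> R)%R by [].
have T20 : (0 <= T2 :> R)%R by apply: sumr_ge0 => i _.
have T30 : (0 <= T3 :> R)%R by [].
have w0 i : (0 <= 1 + 2 * beta / sigma * `|tnth h i|)%R.
  by rewrite addr_ge0// mulr_ge0// divr_ge0 ?(ltW sigma0)// mulr_ge0 ?(ltW beta0).
have T40 : (0 <= T4 :> R)%R by rewrite mulr_ge0 ?invr_ge0// prodr_ge0.
have triv : (1 <= T1 + T2 + T3 + T4 ->
    \sum_(v : code) \1_(error_event v) (h, z) <= (p ^ m)%N%:R * (T1 + T2 + T3 + T4))%R.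
  move=> H; apply: (@le_trans _ _ (p ^ m)%N%:R%R); last by rewrite ler_peMr.
  rewrite -[X in (_ <= (X ^ _)%:R)%R](card_ord p) -[X in (_ <= (_ ^ X)%:R)%R](card_ord m) -card_ffun.
  rewrite -sum1_card natr_sum; apply: ler_sum => v _.
  by rewrite indicE; case: (_ \in _).
have [hp|hp] := pselect (@positive_orthant R n h); last first.
  apply: triv; rewrite [T3](_ : _ = 1%R); last by rewrite /T3 indicE mem_set.
  by rewrite -addrA [(1 + T4)%R]addrC addrA lerDr !addr_ge0.
have [zL|zL] := pselect (forall i, (`|tnth z i| < tnth h i * (p%:R * beta) / 2)%R); last first.
  apply: triv; have [i zi] : exists i, ~~ (`|tnth z i| < tnth h i * (p%:R * beta) / 2)%R.
    by apply/not_existsP => H; apply: zL => i; apply/negPn/negP; exact: H.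
  have : (1 <= T2)%R.
    rewrite /T2 (bigD1 i)//= indicE mem_set ?lerDl ?sumr_ge0//.
    by rewrite /outside_cell /= leNgt mulrA.
  by move=> T21; lra.
have [low|low] := pselect (low_density_event (h, z)).
  by apply: triv; rewrite [T1](_ : _ = 1%R) ?/T1 ?indicE ?mem_set//; lra.
apply: (@le_trans _ _ ((p ^ m)%N%:R * T4)%R); last first.
  by rewrite ler_wpM2l// lerDr !addr_ge0.
pose E : {set code} := [set v | (h, z) \in error_event v]%SET.
have -> : (\sum_(v : code) \1_(error_event v) (h, z) = #|E|%:R :> R)%R.
  rewrite -sum1_card natr_sum [RHS]big_mkcond /=; apply: eq_bigr => v _.
  by rewrite indicE inE; case: (_ \in _).
have det0 : (0 < \prod_(i < n) tnth h i)%R by apply: prodr_gt0 => i _.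
have gz0 : (0 < g z)%R by apply: prodr_gt0 => i _; exact: normal_pdf0_gt0.
have nR0 : (0 < n%:R :> R)%R by rewrite ltr0n.
have pm0 : (0 < p%:R ^+ m :> R)%R by rewrite exprn_gt0// ltr0n prime_gt0.
have HE : forall v, v \in E -> exists2 x, lattice beta v x & closer h z x.
  by move=> v; rewrite !inE => -[].
have cnt := lattice_error_count p_prime beta0 sigma0 hp zL HE.
have glow : (gam * n%:R < \prod_(i < n) tnth h i * g z)%R.
  rewrite -ltr_ln ?posrE ?mulr_gt0// lnM ?posrE// -(sum_log_density sigma0 _ hp) ltNge.
  by apply/negP.
have E1 : (\prod_(i < n) ((tnth h i * beta)^-1 * (1 + 2 * (tnth h i * beta) / sigma)) =
   (\prod_(i < n) tnth h i)^-1 * (gam * p%:R ^+ m) * (n%:R * T4))%R.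
  rewrite /T4 mulVKf ?gt_eqF// -[(gam * _)%R]invrK -betaE.
  rewrite -[X in (_ ^+ X)^-1%R]card_ord -prodr_const -!prodfV -!big_split /=; apply: eq_bigr => i _.
  by rewrite gtr0_norm ?hp// invfM; congr (_ * _)%R; ring.
rewrite E1 in cnt.
have {}cnt : (#|E|%:R * (\prod_(i < n) tnth h i * g z) <= gam * p%:R ^+ m * (n%:R * T4))%R.
  rewrite mulrCA [leLHS]mulrC -ler_pdivlMr//; apply: le_trans cnt _.
  by rewrite -mulrA mulrC.
have : (#|E|%:R * (gam * n%:R) <= gam * p%:R ^+ m * (n%:R * T4))%R.
  by apply: le_trans cnt; rewrite ler_wpM2l// ltW.
rewrite natrX (_ : gam * _ * (n%:R * T4) = (p%:R ^+ m * T4) * (gam * n%:R))%R; last by ring.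
by rewrite ler_pM2r// mulr_gt0.
Qed.

End RandomLattice.

End Achievability.

Section AchievabilityBound.
Context {R : realType}.
Variables (f : R -> R) (sigma : R).
Hypothesis rf : regular_fading_pdf f.
Hypothesis sigma0 : 0 < sigma.
Local Notation leb := (@lebesgue_measure R).
Local Open Scope ereal_scope.

Let mf : measurable_fun setT f. Proof. by case: rf. Qed.
Let f0 x : (0 <= f x)%R. Proof. by case: rf => _ []. Qed.
Let f1 : \int[leb]_x (f x)%:E = 1. Proof. by case: rf => _ [_ [_ [H _]]]. Qed.

Lemma exists_le_average (I : finType) (e : I -> \bar R) (B : R) : (0 < #|I|)%N ->
  (forall i, 0 <= e i) -> \sum_i e i <= #|I|%:R%:E * B%:E -> exists i, e i <= B%:E.
Proof.
move=> I0 e0 H; apply/not_existsP => N.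
have eB i : B%:E < e i by rewrite ltNge; apply/negP; exact: N.
have efin i : (fine (e i))%:E = e i.
  rewrite fineK// ge0_fin_numE//; apply: le_lt_trans (ltry (#|I|%:R * B)); apply: le_trans H.
  by rewrite (bigD1 i)//= leeDl// sume_ge0.
have : (\sum_i fine (e i) <= #|I|%:R * B)%R.
  rewrite -lee_fin -sumEFin EFinM; apply: le_trans H.
  by rewrite le_eqVlt; apply/orP; left; apply/eqP; apply: eq_bigr => i _; rewrite efin.
rewrite leNgt => /negP; apply.
rewrite mulr_natl -sumr_const; apply: ltr_sum.
  by apply/hasP; have [i _] := card_gt0P I0; exists i => //; rewrite mem_index_enum.
by move=> i _; rewrite -lte_fin efin.
Qed.

(** Integrates the bound of [sum_error_le]. Its terms, unlike the error events, are known to be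
    measurable, so linearity and independence apply. *)
Lemma fg_expect_error_bound (m : nat) (gam k b C : R)
    (P : probability (measurableTypeR R * measurableTypeR R)%type R) :
  (forall u : R * R -> \bar R, measurable_fun setT u -> (forall p, 0 <= u p) ->
     \int[P]_p u p = \int[leb]_h ((f h)%:E * \int[leb]_z ((normal_pdf 0 sigma z)%:E * u (h, z)))) ->
  (0 <= b)%R -> (0 <= C)%R ->
  fg_expect f sigma (fun q : m.+1.-tuple R * m.+1.-tuple R => C%:E *
    (\1_(low_density_event sigma gam) q + \sum_(i < m.+1) \1_[set q | (tnth q.1 i * k <= `|tnth q.2 i|)%R] q +
     \1_(~` @positive_orthant R m.+1) q.1 +
     m.+1%:R^-1 * \prod_(i < m.+1) (1 + b * `|tnth q.1 i|))%:E) <=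
  C%:E * (fg_expect f sigma (fun q => (\1_(@low_density_event R sigma m gam) q : R)%:E) +
  m.+1%:R%:E * \int[P]_q (\1_[set q : R * R | (q.1 * k <= `|q.2|)%R] q)%:E +
  (m.+1%:R^-1 * (1 + b) ^+ m.+1)%:E).
Proof.
move=> PE b0 C0; set n := m.+1.
pose F1 (q : n.-tuple R * n.-tuple R) := (\1_(@low_density_event R sigma m gam) q : R)%:E.
pose u (q : R * R) := (\1_[set q : measurableTypeR R * measurableTypeR R | (q.1 * k <= `|q.2|)%R] q : R)%:E.
pose w (q : R * R) := (1 + b * `|q.1|)%:E.
pose F2 (q : n.-tuple R * n.-tuple R) := \sum_(i < n) u (tnth q.1 i, tnth q.2 i).
pose N (h : n.-tuple R) := (\1_(~` @positive_orthant R n) h : R)%:E.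
pose W (q : n.-tuple R * n.-tuple R) := \prod_(i < n) w (tnth q.1 i, tnth q.2 i).
have u0 q : 0 <= u q by rewrite lee_fin.
have w0 q : 0 <= w q by rewrite lee_fin addr_ge0// mulr_ge0.
have F10 q : 0 <= F1 q by rewrite lee_fin.
have F20 q : 0 <= F2 q by exact: sume_ge0.
have N0 h : 0 <= N h by rewrite lee_fin.
have W0 q : 0 <= W q by exact: prode_ge0.
have mu : measurable_fun setT u.
  by apply: measurable_indic_EFin; exact: measurable_noise_dominates.
have mw : measurable_fun setT w.
  apply/measurable_EFinP; apply: measurable_funD => //; apply: measurable_funM => //.
  by apply: measurableT_comp => //; exact: measurable_fst.
have mF1 : measurable_fun setT F1.
  apply/measurable_EFinP; rewrite (_ : \1_(low_density_event sigma gam) =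
    (\1_[set w | (w <= ln gam + ln n%:R)%R] : R -> R) \o
    (fun q : n.-tuple R * n.-tuple R => \sum_(i < n) log_density sigma (tnth q.1 i, tnth q.2 i))%R).
    apply: measurableT_comp; last exact: measurable_sum_log_density.
    by apply: measurable_indic; exact: measurable_le_set.
  by apply/funext.
have mF2 : measurable_fun setT F2.
  by apply: emeasurable_sum => i; exact: measurable_tnth_pair.
have mN : measurable_fun setT (fun q : n.-tuple R * n.-tuple R => N q.1).
  apply: (@measurableT_comp _ _ _ _ _ _ N); last exact: measurable_fst.
  by apply: measurable_indic_EFin; apply: measurableC; exact: measurable_positive_orthant.
have mW : measurable_fun setT W.
  rewrite (_ : W = fun q => (\prod_(i < n) (1 + b * `|tnth q.1 i|))%:E); last first.
    by apply/funext => q; rewrite /W prodEFin.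
  apply/measurable_EFinP; apply: measurable_prod => i _; apply: measurable_funD => //.
  apply: measurable_funM => //; apply: measurableT_comp => //.
  by apply: (measurableT_comp (measurable_tnth i)); exact: measurable_fst.
have n0 : 0 <= (n%:R^-1 : R)%:E by rewrite lee_fin invr_ge0.
rewrite (_ : (fun _ => _ * _) = (fun q => C%:E * (((F1 \+ F2) \+ (fun q => N q.1)) \+ (fun q => (n%:R^-1)%:E * W q)) q)); last first.
  by apply/funext => q; rewrite /F1 /F2 /u /N /W prodEFin -EFinM sumEFin -!EFinD.
have mF12 : measurable_fun setT (F1 \+ F2) by exact: emeasurable_funD.
have mF123 : measurable_fun setT ((F1 \+ F2) \+ (fun q => N q.1)) by exact: emeasurable_funD.
have mW' : measurable_fun setT (fun q => (n%:R^-1)%:E * W q) by exact: measurable_funeM.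
have W'0 q : 0 <= (n%:R^-1)%:E * W q by exact: mule_ge0.
have F120 q : 0 <= F1 q + F2 q by exact: adde_ge0.
have F1230 q : 0 <= F1 q + F2 q + N q.1 by exact: adde_ge0.
rewrite (fg_expectZl sigma mf f0) ?lee_fin//; last 2 first.
- by move=> q; exact: adde_ge0.
- exact: emeasurable_funD.
rewrite lee_wpmul2l ?lee_fin//.
rewrite (fg_expectD sigma mf f0 F1230 mF123 W'0 mW').
rewrite (fg_expectD sigma mf f0 F120 mF12 (fun q => N0 q.1) mN).
rewrite (fg_expectD sigma mf f0 F10 mF1 F20 mF2).
rewrite fg_expect_fst// nonpositive_fading_null// adde0.
rewrite (fg_expect_sum mf f0 PE)// (fg_expectZl sigma mf f0)// (fg_expect_prod mf f0 PE)//.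
rewrite -addeA -[leRHS]addeA leeD2l//.
have -> : \sum_(i < n) \int[P]_p u p = n%:R%:E * \int[P]_p u p.
  elim: (n) => [|j IH]; first by rewrite big_ord0 mul0e.
  by rewrite big_ord_recr /= IH -natr1 EFinD ge0_muleDl ?lee_fin// mul1e.
rewrite leeD2l// EFinM lee_wpmul2l//.
have H := expect_affine_le rf PE b0.
have : 0 <= \int[P]_q w q by exact: integral_ge0.
rewrite -/(w _) in H *; move: H; rewrite -/w.
case: (\int[P]_p w p) => // r; rewrite !lee_fin => rb r0.
by rewrite prodEFin lee_fin prodr_const card_ord lerXn2r ?nnegrE// addr_ge0.
Qed.

(** * Existence of a good lattice *)

Theorem achievability_bound (m : nat) (gam : R) : (0 < m)%N -> (0 < gam)%R ->
  exists (S : set (m.+1.-tuple R)) gam', [/\ IC_with_density S gam', (gam <= gam')%R &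
    Pe_IC f sigma S <= fg_expect f sigma (fun q : m.+1.-tuple R * m.+1.-tuple R =>
      (\1_[set w : R | (w <= ln gam + ln m.+1%:R)%R]
        (\sum_(i < m.+1) log_density sigma (tnth q.1 i, tnth q.2 i))%R)%:E) + (3 / m.+1%:R)%:E].
Proof.
move=> m0 gam0; set n := m.+1.
have nR0 : (0 < n%:R :> R)%R by rewrite ltr0n.
have [P PE] := fading_gauss_probability sigma mf f0 f1.
(* The n coordinates together then contribute n / n^2 = 1 / n. *)
have d0 : (0 < (n%:R ^+ 2)^-1 :> R)%R by rewrite invr_gt0 exprn_gt0.
have [k0 k00 Hk] := noise_dominates_rare rf PE d0.
have ln2 : (0 < ln 2 :> R)%R by rewrite ln_gt0// ltr1n.
(* This bound on beta gives (1 + 2 beta / sigma)^n <= exp(2 n beta / sigma) <= 2, the source of the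
   remaining 2 / n. *)
have b0 : (0 < sigma * ln 2 / (2 * n%:R))%R by rewrite divr_gt0 ?mulr_gt0.
(* The half-width p beta / 2 is what has to reach [k0]. *)
have L0 : (0 < 2 * k0)%R by rewrite mulr_gt0.
have [N HN] := lattice_scale m0 gam0 b0 L0.
have [p pN pp] := prime_above (N + 2).
(* A prime above N + 2 is not 2; oddness is required by the point count behind [lattice_density]. *)
have op : odd p by have [p2|//] := even_prime pp; move: pN; rewrite p2; clear; lia.
have p0 := prime_gt0 pp.
have Np : (N <= p)%N by move: pN; clear; lia.
have [beta [beta0 betaE bb bL]] := HN p Np p0.
pose phi := fg_expect f sigma (fun q : n.-tuple R * n.-tuple R => (\1_(low_density_event sigma gam) q : R)%:E).
have phi0 : 0 <= phi by apply: fg_expect_ge0 => // q; rewrite lee_fin.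
have phi1 : phi <= 1.
  rewrite -[leRHS](fg_expect_cst mf f0 PE n ler01).
  apply: le_fg_expect => // h z _.
  by rewrite lee_fin indicE; case: (_ \in _).
have phiE : (fine phi)%:E = phi by rewrite fineK// ge0_fin_numE// (le_lt_trans phi1)// ltry.
have [v Hv] : exists v : {ffun 'I_m -> 'I_p}, fg_expect f sigma (fun q => (\1_(error_event beta v) q : R)%:E) <=
    (fine phi + 3 / n%:R)%:E.
  apply: exists_le_average.
  - by rewrite card_ffun !card_ord expn_gt0 p0.
  - by move=> v; apply: fg_expect_ge0 => // q; rewrite lee_fin.
  apply: le_trans (fg_expect_sum_le sigma f0 _ _) _; first by move=> v q; rewrite lee_fin.
  pose B (q : n.-tuple R * n.-tuple R) : R :=
    (\1_(low_density_event sigma gam) q + \sum_(i < m.+1) \1_[set q | (tnth q.1 i * (p%:R * beta / 2) <= `|tnth q.2 i|)%R] q +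
     \1_(~` @positive_orthant R m.+1) q.1 +
     m.+1%:R^-1 * \prod_(i < m.+1) (1 + 2 * beta / sigma * `|tnth q.1 i|))%R.
  have bs0 : (0 <= 2 * beta / sigma)%R by rewrite divr_ge0 ?mulr_ge0 ?ltW.
  have B0 q : 0 <= (B q)%:E.
    rewrite lee_fin /B !addr_ge0 ?sumr_ge0// mulr_ge0 ?invr_ge0// prodr_ge0// => i _.
    by rewrite addr_ge0// mulr_ge0.
  apply: (@le_trans _ _ (fg_expect f sigma (fun q => (#|{ffun 'I_m -> 'I_p}|%:R)%:E * (B q)%:E))).
    apply: le_fg_expect => // [q|h z _]; first by apply: sume_ge0 => v _; rewrite lee_fin.
    rewrite sumEFin -EFinM lee_fin card_ffun !card_ord.
    exact: sum_error_le.
  apply: le_trans (fg_expect_error_bound _ _ _ PE bs0 (ler0n _ _)) _.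
  rewrite lee_wpmul2l ?lee_fin// -/phi -phiE EFinD -addeA leeD2l//.
  have k0L : (k0 <= p%:R * beta / 2)%R by rewrite ler_pdivlMr// mulrC.
  have := Hk _ k0L.
  have : 0 <= \int[P]_q (\1_[set q : R * R | (q.1 * (p%:R * beta / 2) <= `|q.2|)%R] q)%:E.
    by apply: integral_ge0 => q _; rewrite lee_fin.
  case: (\int[P]_q _) => // r _; rewrite lee_fin => rd.
  rewrite -EFinM -EFinD lee_fin.
  have H1 : (n%:R * r <= n%:R^-1)%R.
    by rewrite mulrC -ler_pdivlMr// (le_trans rd)// expr2 invfM.
  have H2 : ((1 + 2 * beta / sigma) ^+ n <= 2)%R.
    apply: (@le_trans _ _ (expR (2 * beta / sigma) ^+ n)%R).
      by rewrite lerXn2r ?nnegrE ?expR_ge0 ?expR_ge1Dx// addr_ge0.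
    rewrite -expRM_natl -[leRHS](@lnK R) ?posrE// ler_expR.
    rewrite mulrA ler_pdivrMr// mulrCA [leRHS]mulrC.
    by move: bb; rewrite ler_pdivlMr ?mulr_gt0// => H; lra.
  have H3 : (n%:R^-1 * (1 + 2 * beta / sigma) ^+ n <= n%:R^-1 * 2)%R by rewrite ler_wpM2l// invr_ge0.
  by rewrite -/n; lra.
have [gam' icS gg'] := lattice_density pp beta0 v op.
exists (lattice beta v), gam'; split=> //.
  apply: le_trans gg'; rewrite exprMn betaE exprS.
  rewrite le_eqVlt; apply/orP; left; apply/eqP; field.
  have pR0 : p%:R != 0%R :> R by rewrite pnatr_eq0 -lt0n.
  by rewrite expf_neq0// gt_eqF.
apply: le_trans (Pe_lattice_le sigma rf beta v) _ => //.
apply: le_trans Hv _; rewrite EFinD phiE leeD2r//.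
Qed.

End AchievabilityBound.

(** With s = n^(1/4), ln n = 4 ln s <= 4 (s - 1). The explicit decay n^(-1/4) yields a threshold
    beyond which [y n <= 1]. *)
Lemma log_over_sqrt_le (R : realType) (n : nat) : (0 < n)%N ->
  (1 + ln n%:R) / Num.sqrt n%:R <= 5 / Num.sqrt (Num.sqrt n%:R) :> R.
Proof.
move=> n0; have n1 : 1 <= n%:R :> R by rewrite ler1n.
set a := Num.sqrt n%:R; have a0 : 0 < a :> R by rewrite sqrtr_gt0 ltr0n.
set s := Num.sqrt a; have s0 : 0 < s by rewrite sqrtr_gt0.
have as2 : s ^+ 2 = a by rewrite sqr_sqrtr// ltW.
have ns4 : n%:R = s ^+ 4 :> R by rewrite (exprM _ 2 2) as2 sqr_sqrtr// ltW.
have s1 : 1 <= s.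
  rewrite leNgt; apply/negP => s1; move: n1; rewrite leNgt ns4 => /negP; apply.
  by rewrite exprn_ilt1// ltW.
have l : ln s <= s - 1.
  have L1 : -1 < s - 1 by lra.
  by have := le_ln1Dx L1; rewrite addrC subrK.
rewrite -as2 ler_pdivrMr ?exprn_gt0// expr2 mulrA divfK ?gt_eqF//.
by rewrite ns4 lnXn// -mulr_natl; lra.
Qed.

(** * Inversion of the normal approximation *)

Section SecondOrder.
Context {R : realType}.
Variables (f : R -> R) (sigma eps qinv K : R).
Hypothesis rf : regular_fading_pdf f.
Hypothesis sigma0 : 0 < sigma.
Hypothesis qinvE : Qfun qinv = eps.
Hypothesis K0 : 0 <= K.
Local Notation m := (delta_star f sigma).
Local Notation V := (disp_V f sigma).
Hypothesis clt : forall n, (0 < n)%N -> forall c : R,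
  exists2 p : R, fg_expect f sigma (fun q : n.-tuple R * n.-tuple R =>
      (\1_[set w | w <= c] (\sum_(i < n) log_density sigma (tnth q.1 i, tnth q.2 i)))%:E) = p%:E &
    `|p - Qfun ((n%:R * m - c) / (Num.sqrt V * Num.sqrt n%:R))| <= K * (1 + ln n%:R) / Num.sqrt n%:R.

(** A lower bound for the slope of Q within distance 1 of [qinv]. Below, [rate] also absorbs the
    O(1/n) errors, and [y n] moves Q by at least 2 [rate]; the surplus over one [rate] gives a
    strict contradiction in the converse. *)
Let c0 := normal_pdf 0 1 (`|qinv| + 1).
Let rate (n : nat) : R := (K + 4) * ((1 + ln n%:R) / Num.sqrt n%:R).
Let y n := 2 * rate n / c0.

Let c0_gt0 : 0 < c0. Proof. by rewrite /c0 normal_pdf0_gt0. Qed.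

Let V_gt0 : 0 < V. Proof. by apply: (@lt_le_trans _ _ 2^-1); [rewrite invr_gt0|exact: disp_V_ge]. Qed.

Lemma Qfun_step (t : R) : 0 <= t <= 1 ->
  eps + c0 * t <= Qfun (qinv - t) /\ Qfun (qinv + t) <= eps - c0 * t.
Proof.
move=> /andP[t0 t1]; rewrite -qinvE.
have q1 := ler_norm qinv; have q2 := ler_norm (- qinv); rewrite normrN in q2.
have n0 : 0 <= `|qinv| + 1 by rewrite addr_ge0.
split.
  have := @Qfun_drop R (`|qinv| + 1) (qinv - t) t t0; rewrite subrK mulrC -/c0 => H.
  rewrite -lerBrDl H// => c /andP[c1 c2]; rewrite [leRHS]ger0_norm// ler_norml; lra.
have := @Qfun_drop R (`|qinv| + 1) qinv t t0; rewrite mulrC -/c0 => H.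
rewrite lerBrDr -lerBrDl H// => c /andP[c1 c2]; rewrite [leRHS]ger0_norm// ler_norml; lra.
Qed.

Lemma Qfun_antitone (a b : R) : a <= b -> Qfun b <= Qfun a.
Proof.
move=> ab; have := @Qfun_drop R (`|a| + `|b|) a (b - a); rewrite subr_ge0 => /(_ ab).
rewrite addrC subrK => H; rewrite -subr_ge0; apply: le_trans (H _).
  by rewrite mulr_ge0 ?subr_ge0 ?normal_pdf_ge0.
move=> c /andP[c1 c2]; rewrite [leRHS]ger0_norm ?addr_ge0// ler_norml.
have := ler_norm a; have := ler_norm b; have := ler_norm (- a); have := ler_norm (- b).
by rewrite !normrN; have := normr_ge0 a; have := normr_ge0 b; lra.
Qed.

Section FixedDimension.
Variable n : nat.
Hypothesis n2 : (4 <= n)%N.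
Hypothesis y1 : y n <= 1.

Let nR0 : 0 < n%:R :> R. Proof. by rewrite ltr0n (leq_trans _ n2). Qed.
Let n0 : (0 < n)%N. Proof. exact: leq_trans n2. Qed.

Let sn0 : 0 < Num.sqrt n%:R :> R. Proof. by rewrite sqrtr_gt0. Qed.
Let sV0 : 0 < Num.sqrt V. Proof. by rewrite sqrtr_gt0 V_gt0. Qed.
Let ln0 : 0 <= ln n%:R :> R. Proof. by rewrite ln_ge0// ler1n. Qed.
Let rate_gt0 : 0 < rate n.
Proof. by rewrite /rate mulr_gt0 ?divr_gt0//; have := K0; have := ln0; lra. Qed.
Let y_ge0 : 0 <= y n. Proof. by rewrite /y divr_ge0 ?(ltW c0_gt0)// mulr_ge0// ltW. Qed.
Let c0y : c0 * y n = 2 * rate n. Proof. by rewrite /y mulrCA divff ?gt_eqF ?mulr1. Qed.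

Let slack (k : R) : 0 <= k <= 4 -> K * (1 + ln n%:R) / Num.sqrt n%:R + k / n%:R <= rate n.
Proof.
move=> /andP[k0 k4]; rewrite /rate mulrDl mulrA lerD2l.
apply: (@le_trans _ _ (4 * (1 / Num.sqrt n%:R))).
  rewrite mulrA mulr1 ler_pM ?invr_ge0 ?ler0n// lef_pV2 ?posrE//.
  rewrite -[leRHS](sqr_sqrtr (ltW nR0)) expr2 ler_peMr ?(ltW sn0)//.
  by rewrite -[leLHS]sqrtr1 ler_wsqrtr// ler1n.
by rewrite ler_wpM2l// ler_wpM2r ?invr_ge0 ?(ltW sn0)// lerDl.
Qed.

Let sqrtVn : Num.sqrt (V / n%:R) = Num.sqrt V * Num.sqrt n%:R / n%:R.
Proof.
rewrite sqrtrM ?(ltW V_gt0)// sqrtrV ?(ltW nR0)// -mulrA; congr (_ * _).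
by rewrite -[X in _ / X](sqr_sqrtr (ltW nR0)) expr2 invfM mulrA divff ?mul1r// gt_eqF.
Qed.

(** If the normalized threshold were below qinv - y, Q there would be at least eps + 2 [rate],
    whereas the converse and the normal approximation allow eps + [rate]. *)
Lemma converse_rate (S : set (n.-tuple R)) (gam : R) : IC_with_density S gam ->
  (Pe_IC f sigma S <= eps%:E)%E ->
  n%:R^-1 * ln gam <= m - Num.sqrt (V / n%:R) * (qinv - y n) + ln n%:R / n%:R.
Proof.
move=> icS Pe; have := converse_bound rf sigma0 n0 icS Pe.
have [p -> Hp] := clt n0 (ln gam - ln n%:R); rewrite lee_fin => pe.
set x := (_ / _) in Hp.
have Qx : Qfun x <= eps + rate n.
  have sl : K * (1 + ln n%:R) / Num.sqrt n%:R + 4 / n%:R <= rate n by apply: slack; lra.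
  by move: Hp; rewrite ler_norml => /andP[H1 H2]; lra.
have xq : qinv - y n <= x.
  rewrite leNgt; apply/negP => xq.
  have y01 : 0 <= y n <= 1 by rewrite y_ge0 y1.
  have [+ _] := Qfun_step y01.
  by have := Qfun_antitone (ltW xq); rewrite c0y; have := rate_gt0; lra.
move: xq; rewrite /x ler_pdivlMr ?mulr_gt0// => xq.
rewrite sqrtVn mulrC ler_pdivrMr// mulrDl mulrBl divfK ?gt_eqF//.
rewrite [_ / n%:R * (qinv - y n)]mulrAC divfK ?gt_eqF//; lra.
Qed.

Lemma achievability_rate : exists (S : set (n.-tuple R)) (gam : R),
  [/\ IC_with_density S gam, (Pe_IC f sigma S <= eps%:E)%E &
  m - Num.sqrt (V / n%:R) * (qinv + y n) - ln n%:R / n%:R <= n%:R^-1 * ln gam].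
Proof.
(* Solved from the requirement that the argument of Q in the normal approximation be exactly qinv +
   y. *)
pose gam := expR (n%:R * m - Num.sqrt V * Num.sqrt n%:R * (qinv + y n) - ln n%:R).
have gam0 : 0 < gam by exact: expR_gt0.
have [k nk k0] : exists2 k, n = k.+1 & (0 < k)%N by case: (n) n2 => [|[|k]] // _; exists k.+1.
have [S [gam' [icS gg' Pe]]] : exists (S : set (n.-tuple R)) gam', [/\ IC_with_density S gam', (gam <= gam')%R &
    (Pe_IC f sigma S <= fg_expect f sigma (fun q : n.-tuple R * n.-tuple R =>
      (\1_[set w : R | (w <= ln gam + ln n%:R)%R]
        (\sum_(i < n) log_density sigma (tnth q.1 i, tnth q.2 i))%R)%:E) + (3 / n%:R)%:E)%E].
  by rewrite nk; exact: achievability_bound.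
exists S, gam'; split=> //.
  apply: le_trans Pe _; have [p -> Hp] := clt n0 (ln gam + ln n%:R); rewrite -EFinD lee_fin.
  move: Hp; rewrite (_ : _ / (_ * _) = qinv + y n); last first.
    by rewrite /gam expRK; field; rewrite (gt_eqF sn0) (gt_eqF sV0).
  have y01 : 0 <= y n <= 1 by rewrite y_ge0 y1.
  have [_] := Qfun_step y01.
  rewrite c0y ler_norml => H1 /andP[_ H2].
  have sl : K * (1 + ln n%:R) / Num.sqrt n%:R + 3 / n%:R <= rate n by apply: slack; lra.
  by have := rate_gt0; lra.
apply: (@le_trans _ _ (n%:R^-1 * ln gam)); last by rewrite ler_wpM2l ?invr_ge0 ?(ltW nR0)// ler_ln ?posrE// (lt_le_trans gam0).
rewrite /gam expRK sqrtVn le_eqVlt; apply/orP; left; apply/eqP.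
by field; rewrite gt_eqF.
Qed.

Lemma delta_star_n_rate : exists d : R, delta_star_n n f sigma eps = d%:E /\
  `| d - (m - Num.sqrt (V / n%:R) * qinv) | <= (4 * Num.sqrt V * (K + 4) / c0 + 1) * ln n%:R / n%:R.
Proof.
pose r := Num.sqrt (V / n%:R) * y n + ln n%:R / n%:R.
have ub : (delta_star_n n f sigma eps <= (m - Num.sqrt (V / n%:R) * qinv + r)%:E)%E.
  apply: ge_ereal_sup => _ [g [S [icS Pe]] <-]; rewrite lee_fin.
  by have := converse_rate icS Pe; rewrite /r mulrBr; lra.
have lb : ((m - Num.sqrt (V / n%:R) * qinv - r)%:E <= delta_star_n n f sigma eps)%E.
  have [S [g [icS Pe H]]] := achievability_rate.
  apply: le_ereal_sup_tmp; exists (n%:R^-1 * ln g)%:E; first by exists g => //; exists S.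
  by rewrite lee_fin; move: H; rewrite /r mulrDr; lra.
have rle : r <= (4 * Num.sqrt V * (K + 4) / c0 + 1) * ln n%:R / n%:R.
  rewrite /r [leRHS](_ : _ = 4 * Num.sqrt V * (K + 4) / c0 * ln n%:R / n%:R + ln n%:R / n%:R); last by ring.
  rewrite lerD2r sqrtVn /y /rate.
  have -> : Num.sqrt V * Num.sqrt n%:R / n%:R * (2 * ((K + 4) * ((1 + ln n%:R) / Num.sqrt n%:R)) / c0) =
      (2 * Num.sqrt V * (K + 4) / c0) * (1 + ln n%:R) / n%:R by field; rewrite !gt_eqF.
  rewrite ler_pM2r ?invr_gt0// (_ : 4 * _ * _ / c0 * _ = (2 * Num.sqrt V * (K + 4) / c0) * (2 * ln n%:R)); last by ring.
  rewrite ler_wpM2l ?divr_ge0 ?mulr_ge0 ?addr_ge0 ?(ltW c0_gt0) ?(ltW sV0)//.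
  (* From n >= 4 and ln 2 >= 1/2; it turns 1 + ln n into 2 ln n, so that the error has the form C ln
     n / n. *)
  have : 1 <= ln n%:R :> R.
    have h2 : -1 < - 2^-1 :> R by lra.
    have := le_ln1Dx h2; rewrite (_ : 1 + - 2^-1 = 2^-1 :> R); last by field.
    rewrite lnV ?posrE// => l2; apply: (@le_trans _ _ (ln (2 ^+ 2))).
      by rewrite lnXn// mulr2n; lra.
    by rewrite ler_ln ?posrE ?exprn_gt0// -natrX ler_nat.
  by lra.
have dfin : delta_star_n n f sigma eps \is a fin_num.
  by rewrite fin_numE; apply/andP; split; apply/eqP => E; move: lb ub; rewrite E// leeNy_eq.
exists (fine (delta_star_n n f sigma eps)); rewrite fineK//; split=> //.
rewrite -(fineK dfin) !lee_fin in lb ub.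
by rewrite (le_trans _ rle)// ler_norml; apply/andP; split; lra.
Qed.

End FixedDimension.

Lemma delta_star_n_expansion : exists (C : R) (N : nat), forall n : nat, (N <= n)%N ->
  exists d : R, delta_star_n n f sigma eps = d%:E /\
    `| d - (m - Num.sqrt (V / n%:R) * qinv) | <= C * ln n%:R / n%:R.
Proof.
exists (4 * Num.sqrt V * (K + 4) / c0 + 1).
(* Chosen so that y n <= X / n^(1/4); hence y n <= 1 as soon as n >= X^4. *)
pose X := 10 * (K + 4) / c0.
have X0 : 0 <= X by rewrite divr_ge0 ?mulr_ge0 ?addr_ge0 ?(ltW c0_gt0).
exists (4 + Num.bound (X ^+ 4))%N => n Nn.
have n3 : (4 <= n)%N by move: Nn; clear; lia.
have n0 : (0 < n)%N by exact: leq_trans n3.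
apply: delta_star_n_rate => //.
have nR0 : 0 < n%:R :> R by rewrite ltr0n.
set s := Num.sqrt (Num.sqrt (n%:R : R)).
have s0 : 0 < s by rewrite !sqrtr_gt0.
have s4 : s ^+ 4 = n%:R by rewrite (exprM _ 2 2) !sqr_sqrtr ?sqrtr_ge0 ?ltW.
have Xs : X <= s.
  rewrite -(ler_pXn2r (isT : (0 < 4)%N)) ?nnegrE ?(ltW s0)// s4.
  apply: le_trans (ltW (archi_boundP (exprn_ge0 4 X0))) _.
  by rewrite ler_nat (leq_trans (leq_addl _ _) Nn).
apply: (@le_trans _ _ (X / s)); last by rewrite ler_pdivrMr// mul1r.
rewrite /y /rate /X (_ : 10 * (K + 4) / c0 / s = 2 * ((K + 4) * (5 / s)) / c0); last by field; rewrite !gt_eqF.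
rewrite ler_pM2r ?invr_gt0// !ler_wpM2l ?addr_ge0//; exact: log_over_sqrt_le.
Qed.

End SecondOrder.

Theorem theorem4p1 (R : realType) (f : R -> R) (sigma eps qinv : R) :
  regular_fading_pdf f -> 0 < sigma -> 0 < eps < 1 -> Qfun qinv = eps ->
  exists (C : R) (N : nat), forall n : nat, (N <= n)%N ->
    exists d : R, delta_star_n n f sigma eps = d%:E /\
      `| d - (delta_star f sigma - Num.sqrt (disp_V f sigma / n%:R) * qinv) |
        <= C * ln (n%:R) / n%:R.
Proof.
move=> rf sigma0 _ qinvE; have [K K0 clt] := log_density_clt rf sigma0.
exact: (delta_star_n_expansion rf sigma0 qinvE K0 clt).
Qed.
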